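(* Let $R>0$, let $f\ge0$ be a function on $B_{2R}\subset\mathbb R^4$ with $\|f\|_{L^p(B_{2R})}<\infty$ for some $p>1$, and let $w$ be an admissible $W^{2,2}$ supersolution on $B_{2R}$ of $$\sigma_2(g_0^{-1}\circ A_g)=f(x),\qquad g=e^{2w}g_0.$$ Then $w$ is bounded from below on $B_R$, and for any $\beta>0$ there exists a constant $C>0$, depending only on $p$, $R^{4(1-\frac1p)}\|f\|_{L^p(B_{2R})}$ and $\beta$, such that $$\inf_{B_R}e^{w}\ge C\left(\frac1{R^4}\int_{B_{2R}}e^{-\beta w}\right)^{-1/\beta},$$ and there exists a constant $C^*>0$, depending only on $p$ and $\beta$, such that, if $m\le w\le M$ on $B_{2R}$ for real constants $m,M$, and $\gamma=\max\left(1,R^{\frac43(1-\frac1p)}\|f\|_{L^p(B_{2R})}^{1/3}\right)$, then $$\sup_{B_R}(\gamma+M-w)\le C^*\left(\frac1{R^4}\int_{B_{2R}}(\gamma+M-w)^\beta\right)^{1/\beta}$$ and $$\left(\frac1{R^4}\int_{B_{2R}}(\gamma+w-m)^\beta\right)^{1/\beta}\le C^*\inf_{B_R}(\gamma+w-m).$$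
   Context: The background metric is the flat metric $g_0=|dx|^2$ on $\mathbb R^4$; integrals are taken with respect to the measure of $g_0$ (Lebesgue measure); $B_r$ denotes a ball of radius $r$, the balls $B_R$ and $B_{2R}$ being concentric. For $W^{2,2}$ functions, $\sup$ and $\inf$ are essential. For $g=e^{2w}g_0$, the Weyl-Schouten tensor of $g$ in dimension $n=4$ is $A_g=\frac1{n-2}\{Ric_g-\frac{R_g}{2(n-1)}g\}$ ($Ric_g$ the Ricci tensor and $R_g$ the scalar curvature of $g$), which here equals $$A_g=-\left[\nabla^2w-dw\otimes dw+\tfrac12|\nabla w|^2g_0\right],$$ where $\nabla$ and $|\cdot|$ are taken with respect to $g_0$. For a $1$-$1$ tensor $\Lambda$, $\sigma_k(\Lambda)$ is the $k$-th elementary symmetric function of its eigenvalues. The condition $A_g\in\Gamma_2^+$ at a point means $\sigma_1(g^{-1}\circ A_g)>0$ and $\sigma_2(g^{-1}\circ A_g)>0$ there. An admissible $W^{2,2}$ supersolution on $B_{2R}$ is a function $w\in W^{2,2}(B_{2R})$ such that, for a.e. $x\in B_{2R}$, $A_g(x)\in\Gamma_2^+$ and $\sigma_2(g_0^{-1}\circ A_g)(x)\ge f(x)$. *)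

(* Defs.v *)
From HB Require Import structures.
From mathcomp Require Import all_boot all_order all_algebra.
From mathcomp Require Import all_classical all_reals all_analysis.
From mathcomp Require Import complex.

Set Implicit Arguments.
Unset Strict Implicit.
Unset Printing Implicit Defensive.

Import Order.TTheory GRing.Theory Num.Theory.
Import numFieldNormedType.Exports.

Local Open Scope classical_set_scope.
Local Open Scope ring_scope.

(* The product type carries both the normed-module structure used for
   derivatives and the product (Borel) sigma-algebra used for integrals. Its
   library norm is the sup norm, hence the separate Euclidean [enorm]. *)
Notation R4 R := (R * R * R * R)%type.

(* [measurableTypeR R], on which the library puts [lebesgue_measure], is
   convertible to [R]; so functions on [R4 R] can be integrated as they are. *)
Definition leb4 (R : realType) :
    {measure set (measurableTypeR R * measurableTypeR R *
                  measurableTypeR R * measurableTypeR R) -> \bar R} :=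
  (((@lebesgue_measure R \x @lebesgue_measure R)
     \x @lebesgue_measure R) \x @lebesgue_measure R)%E.

Definition coord4 (R : realType) (i : 'I_4) (x : R4 R) : R :=
  tnth [tuple x.1.1.1; x.1.1.2; x.1.2; x.2] i.

Definition evec (R : realType) (i : 'I_4) : R4 R :=
  ((i == 0%N :> nat)%:R, (i == 1%N :> nat)%:R,
   (i == 2%N :> nat)%:R, (i == 3%N :> nat)%:R).

Definition enorm (R : realType) (x : R4 R) : R :=
  Num.sqrt (\sum_(i < 4) coord4 i x ^+ 2).

Definition eball (R : realType) (c : R4 R) (r : R) : set (R4 R) :=
  [set x | enorm (x - c) < r].

Fixpoint Ck (R : realType) (k : nat) (phi : R4 R -> R) : Prop :=
  if k is k'.+1 then
    forall i : 'I_4, (forall x, derivable phi x (evec R i)) /\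
                     Ck k' (fun x => 'D_(evec R i) phi x)
  else continuous phi.

Definition smooth (R : realType) (phi : R4 R -> R) : Prop :=
  forall k, Ck k phi.

Definition test_function (R : realType) (U : set (R4 R)) (phi : R4 R -> R) :=
  let K := closure [set x | phi x != 0] in
  [/\ smooth phi, compact K & K `<=` U].

(* Meaningful for [u], [v] locally integrable on [U], which [W22] ensures. *)
Definition weak_partial (R : realType) (U : set (R4 R)) (i : 'I_4)
    (u v : R4 R -> R) : Prop :=
  forall phi, test_function U phi ->
    \int[@leb4 R]_(x in U) (u x * 'D_(evec R i) phi x) =
    - \int[@leb4 R]_(x in U) (v x * phi x).

(* [u \_ U] is [u] extended by 0 outside [U]. *)
Definition Lp_norm (R : realType) (U : set (R4 R)) (p : R) (u : R4 R -> R) :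
    \bar R :=
  Lnorm (@leb4 R) p%:E (EFin \o u \_ U).

Definition in_Lp (R : realType) (U : set (R4 R)) (p : R) (u : R4 R -> R) :=
  measurable_fun U u /\ (Lp_norm U p u < +oo)%E.

(* [u] is in W^{2,2}(U) with weak gradient [Du] and weak Hessian [D2u]; these
   are determined by [u] up to null sets. *)
Definition W22 (R : realType) (U : set (R4 R)) (u : R4 R -> R)
    (Du : R4 R -> 'rV[R]_4) (D2u : R4 R -> 'M[R]_4) : Prop :=
  [/\ in_Lp U 2 u,
      forall i, in_Lp U 2 (fun x => Du x 0 i) /\
                weak_partial U i u (fun x => Du x 0 i) &
      forall i j, in_Lp U 2 (fun x => D2u x i j) /\
                  weak_partial U i (fun x => Du x 0 j) (fun x => D2u x i j)].

Definition ess_sup_on (R : realType) (U : set (R4 R)) (u : R4 R -> R) :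
    \bar R :=
  ereal_inf [set y | {ae (@leb4 R), forall x, U x -> ((u x)%:E <= y)%E}].

Definition ess_inf_on (R : realType) (U : set (R4 R)) (u : R4 R -> R) :
    \bar R :=
  ereal_sup [set y | {ae (@leb4 R), forall x, U x -> (y <= (u x)%:E)%E}].

(* The complex roots of the characteristic polynomial, with multiplicity. *)
Definition eigenvalues (R : realType) (n : nat) (L : 'M[R]_n) : seq R[i] :=
  sval (closed_field_poly_normal
          (char_poly (map_mx (real_complex R) L))).

Definition elem_sym (F : comNzRingType) (k : nat) (s : seq F) : F :=
  \sum_(J : {set 'I_(size s)} | #|J| == k) \prod_(j in J) s`_j.

(* Non-real eigenvalues of a real matrix come in conjugate pairs, so the
   symmetric function is real and taking the real part only changes its type. *)
Definition sigma (R : realType) (n k : nat) (L : 'M[R]_n) : R :=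
  complex.Re (elem_sym k (eigenvalues L)).

Definition flat_metric (R : realType) : 'M[R]_4 := 1%:M.

(* The value at a point of the metric e^{2w} g_0, in terms of that of [w]. *)
Definition conformal_metric (R : realType) (w : R) : 'M[R]_4 :=
  expR (2 * w) *: flat_metric R.

(* The 1-1 tensor g^{-1} o A. *)
Definition raise (R : realType) (g A : 'M[R]_4) : 'M[R]_4 := invmx g *m A.

(* The Weyl-Schouten tensor (1/2) (Ric_g - (R_g/6) g) of g = e^{2w} g_0 at a
   point where [w] has gradient [dw] and Hessian [d2w]. For w in W^{2,2} the
   conformal transformation law is the definition of the tensor. *)
Definition schouten (R : realType) (dw : 'rV[R]_4) (d2w : 'M[R]_4) :
    'M[R]_4 :=
  - (d2w - dw^T *m dw +
     (2^-1 * \sum_(i < 4) dw 0 i ^+ 2) *: flat_metric R).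

Definition Gamma2_plus (R : realType) (g A : 'M[R]_4) : Prop :=
  0 < sigma 1 (raise g A) /\ 0 < sigma 2 (raise g A).

Definition admissible_supersolution (R : realType) (U : set (R4 R))
    (f w : R4 R -> R) : Prop :=
  exists (Dw : R4 R -> 'rV[R]_4) (D2w : R4 R -> 'M[R]_4),
    W22 U w Dw D2w /\
    {ae (@leb4 R), forall x, U x ->
       let A := schouten (Dw x) (D2w x) in
       Gamma2_plus (conformal_metric (w x)) A /\
       f x <= sigma 2 (raise (flat_metric R) A)}.

(* Main.v *)
(* Taking traces, [Gamma2_plus] gives [Delta w + |grad w|^2 <= 0] a.e. This survives
   mollification, by Jensen's inequality, so for a mollification [v] of a truncation
   of [w] the functions [v], [- (g + M - v)^b] and [(g + b + v - m)^b] are smooth and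
   superharmonic. Green's formula against an explicit kernel gives the mean value
   inequality and, for nonnegative functions, a doubling inequality, and both pass
   to the limit because the mollifications converge in L^1. The lower bound for [w]
   and its exponential form follow from the mean value inequality and the convexity
   of exp, the bound on the supremum from the mean value inequality for
   [(g + M - w)^b], and the weak Harnack inequality by chaining doublings. *)

Require Import Defs.
From HB Require Import structures.
From mathcomp Require Import all_boot all_order all_algebra.
From mathcomp Require Import all_classical all_reals all_analysis.
From mathcomp Require Import measurable_realfun.
From mathcomp Require Import complex ring lra.

Set Implicit Arguments.
Unset Strict Implicit.
Unset Printing Implicit Defensive.

Import Order.TTheory GRing.Theory Num.Theory.
Import numFieldNormedType.Exports.

Local Open Scope classical_set_scope.
Local Open Scope ring_scope.

(** * Smooth bump functions *)

(** The gradient term in [Delta w + |grad w|^2 <= 0] is what allows every exponent [b > 0]. For a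
    positive superharmonic function in dimension four the weak Harnack inequality stops at exponent
    2, whereas here a power of [const + w] is superharmonic as soon as its base is at least [b - 1],
    and a power of [const - w] is subharmonic as soon as its base is at least [1 - b]. The first
    condition is bought with a shift by [b], the second is guaranteed by [g >= 1]. Since [w] has
    only weak derivatives, the chain rule is applied to mollifications, and truncation keeps these
    in the range of [w]. The auxiliary function in Green's formula vanishes with its gradient on the
    sphere: no boundary term and no surface measure occur, and the formula reduces to the
    fundamental theorem of calculus on chords. Convergence in L^1 does not give convergence at a
    given point, but an inequality at a point survives if the mollifications are close there for
    infinitely many indices. *)

Fixpoint C1k (R : realType) (k : nat) (f : R -> R) : Prop :=
  if k is k'.+1 then
    exists2 g, (forall t : R, is_derive t 1 f (g t)) & C1k k' g
  else continuous f.

Section is_derive1.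
Variables (R : realType) (t : R).
Implicit Types (f g : R -> R) (a b c : R).

Lemma is_derive1D f g a b : is_derive t 1 f a -> is_derive t 1 g b ->
  is_derive t 1 (fun s => f s + g s) (a + b).
Proof. exact: is_deriveD. Qed.

Lemma is_derive1B f g a b : is_derive t 1 f a -> is_derive t 1 g b ->
  is_derive t 1 (fun s => f s - g s) (a - b).
Proof. exact: is_deriveB. Qed.

Lemma is_derive1N f a : is_derive t 1 f a -> is_derive t 1 (fun s => - f s) (- a).
Proof. exact: is_deriveN. Qed.

Lemma is_derive1M f g a b : is_derive t 1 f a -> is_derive t 1 g b ->
  is_derive t 1 (fun s => f s * g s) (a * g t + f t * b).
Proof.
by move=> fa gb; apply: is_derive_eq (is_deriveM fa gb) _;
  rewrite /GRing.scale/= addrC mulrC.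
Qed.

Lemma is_derive1Zl c f a : is_derive t 1 f a ->
  is_derive t 1 (fun s => c * f s) (c * a).
Proof. exact: is_deriveZ. Qed.

Lemma is_derive1V f a : f t != 0 -> is_derive t 1 f a ->
  is_derive t 1 (fun s => (f s)^-1) (- (f t) ^- 2 * a).
Proof. exact: is_deriveV. Qed.

Lemma is_derive1_comp_ext f g a b : is_derive (g t) 1 f a -> is_derive t 1 g b ->
  is_derive t 1 (fun s => f (g s)) (a * b).
Proof. exact: is_derive1_comp. Qed.

Lemma is_derive1_cst c : is_derive t 1 (fun _ : R => c) 0.
Proof. exact: is_derive_cst. Qed.

Lemma is_derive1_id : is_derive t 1 (fun s : R => s) 1.
Proof. exact: is_derive_id. Qed.

End is_derive1.

Section C1k.
Variable R : realType.
Implicit Types (f g : R -> R) (k : nat).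

Lemma is_derive1_cvg f (t d : R) : is_derive t 1 f d -> {for t, continuous f}.
Proof.
by move=> H; apply: differentiable_continuous; apply/derivable1_diffP; exact: ex_derive.
Qed.

Lemma C1kW k f : C1k k.+1 f -> C1k k f.
Proof.
elim: k f => [|k IH] f [g fg gk].
  by move=> t; exact: is_derive1_cvg (fg t).
by exists g => //; exact: IH.
Qed.

Lemma C1k_cst k (c : R) : C1k k (fun=> c).
Proof.
elim: k c => [|k IH] c; first by move=> t; exact: cvg_cst.
exists (fun=> 0) => // t; exact: is_derive1_cst.
Qed.

Lemma C1kD k f g : C1k k f -> C1k k g -> C1k k (fun t => f t + g t).
Proof.
elim: k f g => [|k IH] f g; first by move=> cf cg t; exact: (cvgD (cf t) (cg t)).
move=> [f' ff' kf'] [g' gg' kg']; exists (fun t => f' t + g' t); last exact: IH.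
by move=> t; exact: is_derive1D.
Qed.

Lemma C1kM k f g : C1k k f -> C1k k g -> C1k k (fun t => f t * g t).
Proof.
elim: k f g => [|k IH] f g; first by move=> cf cg t; exact: (cvgM (cf t) (cg t)).
move=> kf kg; have kf0 := C1kW kf; have kg0 := C1kW kg.
move: kf kg => [f' ff' kf'] [g' gg' kg'].
exists (fun t => f' t * g t + f t * g' t).
  by move=> t; exact: is_derive1M.
by apply: C1kD; apply: IH.
Qed.

Lemma C1k_comp_affine k f (a b : R) : C1k k f -> C1k k (fun t => f (a * t + b)).
Proof.
have dab (t : R) : is_derive t 1 (fun t => a * t + b) a.
  have := is_derive1D (is_derive1Zl a (is_derive1_id t)) (is_derive1_cst t b).
  by rewrite addr0 mulr1.
elim: k f => [|k IH] f.
  move=> cf t; apply: (@continuous_comp _ _ _ (fun t => a * t + b) f); last exact: cf.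
  exact: is_derive1_cvg (dab t).
move=> [f' ff' kf']; exists (fun t => a * f' (a * t + b)).
  move=> t; rewrite mulrC; exact: is_derive1_comp_ext (ff' _) (dab t).
by apply: C1kM; [exact: C1k_cst|exact: IH].
Qed.

End C1k.

Section flat.
Variable R : realType.
Implicit Types (t h : R).

(* The factor [t ^- n] makes the family closed under derivation. *)
Definition flatfun (n : nat) t : R := if 0 < t then t ^- n * expR (- t^-1) else 0.

Lemma flatfun_ge0 n t : 0 <= flatfun n t.
Proof.
rewrite /flatfun; case: ifPn => // t0.
by rewrite mulr_ge0 ?expR_ge0// invr_ge0 exprn_ge0// ltW.
Qed.

Lemma flatfun0_gt0 t : 0 < t -> 0 < flatfun 0 t.
Proof. by move=> t0; rewrite /flatfun t0 mulr_gt0 ?expR_gt0// invr_gt0 exprn_gt0. Qed.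

Lemma flatfun_le0 n t : t <= 0 -> flatfun n t = 0.
Proof. by move=> t0; rewrite /flatfun ltNge t0. Qed.

(** Follows from [expR u >= u ^ (n + 1) / (n + 1)!] at [u = t^-1]. The linear bound is what gives
    continuity at 0. *)
Lemma flatfun_le n t : 0 <= t -> flatfun n t <= n.+1`!%:R * t.
Proof.
rewrite le_eqVlt => /predU1P[<-|t0]; first by rewrite flatfun_le0// mulr0.
rewrite /flatfun t0 expRN ler_pdivrMr ?expR_gt0//.
have u0 : 0 <= t^-1 by rewrite invr_ge0 ltW.
have := expR_ge1Dxn n u0.
move=> /(le_trans _) => /(_ (t^-1 ^+ n.+1 / n.+1`!%:R)).
rewrite lerDr ler01 => /(_ isT) H.
rewrite -mulrA; apply: le_trans (_ : n.+1`!%:R * (t * (t^-1 ^+ n.+1 / n.+1`!%:R)) <= _); last first.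
  by rewrite ler_pM2l ?ltr0n ?fact_gt0// ler_pM2l.
have F0 : (n.+1`!%:R : R) != 0 by rewrite pnatr_eq0 -lt0n fact_gt0.
have tn0 : t != 0 by rewrite gt_eqF.
suff <- : t ^- n = n.+1`!%:R * (t * (t^-1 ^+ n.+1 / n.+1`!%:R)) by [].
by rewrite -exprVn exprS; field; rewrite F0 tn0.
Qed.

Lemma is_derive_flatfun n t :
  is_derive t 1 (flatfun n) (flatfun n.+2 t - n%:R * flatfun n.+1 t).
Proof.
have [t0|t0|->] := ltgtP t 0.
- rewrite !flatfun_le0 ?ltW// mulr0 subr0.
  apply: (@near_eq_is_derive R R^o R^o (fun _ : R => 0)).
  + near=> s; rewrite flatfun_le0 ?ltW//; near: s; exact: lt_nbhsl.
- have tn0 : t != 0 by rewrite gt_eqF.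
  apply: (@near_eq_is_derive R R^o R^o (fun s : R => s ^- n * expR (- s^-1))).
  + near=> s; rewrite /flatfun ifT//; near: s; exact: lt_nbhsr.
  + have dV : is_derive t 1 (fun s : R => s^-1) (- t ^- 2).
      by have := is_derive1V tn0 (is_derive1_id t); rewrite mulr1.
    have dE : is_derive t 1 (fun s : R => expR (- s^-1)) (expR (- t^-1) * t ^- 2).
      have dN : is_derive t 1 (fun s : R => - s^-1) (t ^- 2).
        by have := is_derive1N dV; rewrite opprK.
      exact: is_derive1_comp_ext (is_derive_expR _) dN.
    have dX : is_derive t 1 (fun s : R => s^-1 ^+ n) (- n%:R * t ^- n.+1).
      have -> : (fun s : R => s^-1 ^+ n) = (fun s : R => s^-1) ^+ n.
        by apply/funext => s; rewrite exprfctE.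
      apply: (@is_derive_eq _ _ _ _ _ _ _ _ (@is_deriveX R _ (fun s : R => s^-1) n t 1 _ dV)).
      case: n => [|n]; first by rewrite mulr0n mul0r oppr0 mul0r scale0r.
      rewrite [LHS]/GRing.scale/= -!exprVn -[n.+2]addn2 exprD.
      ring.
    rewrite /flatfun t0.
    have -> : (fun s : R => s ^- n * expR (- s^-1)) =
              (fun s : R => s^-1 ^+ n * expR (- s^-1)).
      by apply/funext => s; rewrite exprVn.
    apply: is_derive_eq (is_derive1M dX dE) _.
    rewrite -!exprVn -[n.+2]addn2 exprD; ring.
- rewrite !flatfun_le0// mulr0 subr0.
  (* The difference quotient of [flatfun n] at 0 is exactly [flatfun n.+1], so it remains to see
     that the latter is continuous at 0. *)
  apply/is_derive1_caratheodory; exists (flatfun n.+1); split.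
  + move=> z; rewrite (flatfun_le0 n (lexx 0)) !subr0.
    have [z0|z0] := leP z 0; first by rewrite !flatfun_le0// mul0r.
    by rewrite /flatfun z0 -!exprVn exprS; field; rewrite gt_eqF.
  + suff : flatfun n.+1 x @[x --> (0 : R)] --> (0 : R).
      by rewrite -[X in _ --> X](flatfun_le0 n.+1 (lexx 0)).
    apply/cvgrPdist_le => /= e e0; near=> z.
    rewrite sub0r normrN ger0_norm ?flatfun_ge0//.
    have [z0|z0] := leP z 0; first by rewrite flatfun_le0// ltW.
    apply: le_trans (flatfun_le _ (ltW z0)) _.
    rewrite mulrC -ler_pdivlMr ?ltr0n ?fact_gt0//; apply: ltW.
    near: z; apply: lt_nbhsl; by rewrite divr_gt0// ltr0n fact_gt0.
  + exact: flatfun_le0.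
Unshelve. all: end_near.
Qed.

Lemma C1k_flatfun k n : C1k k (flatfun n).
Proof.
elim: k n => [|k IH] n.
  by move=> t; exact: is_derive1_cvg (is_derive_flatfun n t).
exists (fun t => flatfun n.+2 t - n%:R * flatfun n.+1 t).
  exact: is_derive_flatfun.
apply: C1kD; first exact: IH.
have -> : (fun t => - (n%:R * flatfun n.+1 t)) = (fun t => - n%:R * flatfun n.+1 t).
  by apply/funext => t; rewrite mulNr.
by apply: C1kM; [exact: C1k_cst|exact: IH].
Qed.

End flat.

Lemma FTC2_C1 (R : realType) (F f : R -> R) (a b : R) : a < b ->
  continuous f -> (forall t, a <= t <= b -> is_derive t 1 F (f t)) ->
  (\int[@lebesgue_measure R]_(t in `[a, b]) (f t)%:E = (F b - F a)%:E)%E.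
Proof.
move=> ab cf dF; rewrite EFinB; apply: continuous_FTC2 => //.
- exact: continuous_subspaceT.
- have cF t : a <= t <= b -> {for t, continuous F} by move=> /dF; exact: is_derive1_cvg.
  split.
  + by move=> t /[!in_itv]/= /andP[/ltW at_ /ltW tb]; apply: ex_derive; apply: dF; rewrite at_.
  + by apply/cvg_at_right_filter/cF; rewrite lexx ltW.
  + by apply/cvg_at_left_filter/cF; rewrite lexx ltW.
- move=> t /[!in_itv]/= /andP[/ltW at_ /ltW tb]; rewrite derive1E; apply: derive_val.
  by apply: dF; rewrite at_.
Qed.

(** Evenness makes the mollification kernel symmetric, hence a probability density in each of its
    two variables. The mass is prescribed for every translate, which builds translation invariance
    of the integral into the definition. *)
Definition normalized_bump (R : realType) (e : R) (rho : R -> R) :=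
  [/\ forall k, C1k k rho, forall t, 0 <= rho t, forall t, e <= `|t| -> rho t = 0,
      forall t, rho (- t) = rho t &
      forall x, (\int[@lebesgue_measure R]_y (rho (y - x))%:E = 1)%E].

Lemma exists_normalized_bump (R : realType) (e : R) : 0 < e ->
  exists rho : R -> R, normalized_bump e rho.
Proof.
move=> e0; have en0 : e != 0 by rewrite gt_eqF.
pose b (t : R) := flatfun 0 (- e^-1 * t + 1) * flatfun 0 (e^-1 * t + 1).
have Cb k : C1k k b by apply: C1kM; apply: C1k_comp_affine; exact: C1k_flatfun.
have b_ge0 t : 0 <= b t by rewrite mulr_ge0// flatfun_ge0.
have b_even t : b (- t) = b t by rewrite /b mulrC mulrNN mulrN mulNr.
have b_gt0 t : - e < t < e -> 0 < b t.
  move=> /andP[et te]; rewrite mulr_gt0// flatfun0_gt0//.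
    by rewrite mulNr addrC subr_gt0 mulrC ltr_pdivrMr// mul1r.
  by rewrite -ltrBlDr sub0r mulrC ltr_pdivlMr// mulN1r.
have b0 t : e <= `|t| -> b t = 0.
  rewrite ler_normr => /orP[et|et]; rewrite /b.
    rewrite [flatfun 0 (- _ * _ + _)]flatfun_le0 ?mul0r//.
    by rewrite mulNr addrC subr_le0 mulrC ler_pdivlMr// mul1r.
  rewrite [X in _ * X]flatfun_le0 ?mulr0//.
  by rewrite -lerBrDr sub0r mulrC ler_pdivrMr// mulN1r lerNr.
have cb : continuous b by exact: (Cb 0%N).
(* The base point lies strictly to the left of [- e], so that [P] is differentiable on all of
   [[- e, e]], end points included. *)
pose P (t : R) := \int[@lebesgue_measure R]_(s in `[- e - 1, t]) b s.
have dP t : - e <= t <= e -> is_derive t 1 P (b t).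
  move=> /andP[et te].
  have [||||dPt Pt] := @continuous_FTC1_closed R b (- e - 1) t (e + 1).
  - by rewrite (le_lt_trans te)// ltrDl.
  - apply: continuous_compact_integrable; first exact: segment_compact.
    exact: continuous_subspaceT.
  - by rewrite (lt_le_trans _ et)// ltrBlDr ltrDl.
  - exact: cb.
  - by apply: DeriveDef; [exact: dPt|rewrite -derive1E Pt].
have NeE : - e < e by rewrite (lt_trans _ e0)// oppr_lt0.
pose m := P e - P (- e).
have m_gt0 : 0 < m.
  rewrite /m; have [||c ec ->] := @MVT _ P b _ _ NeE.
  - by move=> t /[!in_itv]/= /andP[/ltW at_ /ltW tb]; apply: dP; rewrite at_.
  - apply: derivable_within_continuous => t /[!in_itv]/= teb.
    by apply: ex_derive; exact: dP.
  - rewrite mulr_gt0//; first by apply: b_gt0; move: ec; rewrite in_itv.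
    by rewrite subr_gt0.
have int_b x : (\int[@lebesgue_measure R]_y (b (y - x))%:E = m%:E)%E.
  have cbx : continuous (fun y => b (y - x)).
    have := C1k_comp_affine 1 (- x) (Cb 0%N) => /=.
    by under eq_fun do rewrite mul1r.
  transitivity (\int[@lebesgue_measure R]_(y in `[(x - e)%R, (x + e)%R]) (b (y - x))%:E)%E.
    rewrite [RHS]integral_mkcond; apply: eq_integral => y _.
    rewrite patchE; case: ifPn => // /negP; rewrite inE/= in_itv/= => /negP.
    rewrite negb_and -!ltNge => yx; rewrite b0// ler_normr.
    by case/orP: yx => yx; apply/orP; [right|left]; lra.
  apply: etrans (@FTC2_C1 R (fun y => P (y - x)) (fun y => b (y - x)) _ _ _ _ _) _; last first.
  - by rewrite /m; congr (_ - _)%:E; congr P; ring.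
  - move=> y /andP[xy yx].
    have dyx : is_derive y 1 (fun s : R => s - x) 1.
      by have := is_derive1B (is_derive1_id y) (is_derive1_cst y x); rewrite subr0.
    have dPy : is_derive (y - x) 1 P (b (y - x)) by apply: dP; apply/andP; split; lra.
    by have := @is_derive1_comp_ext R y P (fun s => s - x) _ _ dPy dyx; rewrite mulr1.
  - exact: cbx.
  - by rewrite -subr_gt0; lra.
exists (fun t => m^-1 * b t); split.
- by move=> k; apply: C1kM; [exact: C1k_cst|exact: Cb].
- by move=> t; rewrite mulr_ge0// invr_ge0 ltW.
- by move=> t /b0 ->; rewrite mulr0.
- by move=> t; rewrite b_even.
- move=> x; under eq_integral do rewrite EFinM.
  rewrite ge0_integralZl_EFin//.
  + by rewrite int_b -EFinM mulVf// gt_eqF.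
  + by move=> y _; rewrite lee_fin.
  + apply/measurable_EFinP; apply: continuous_measurable_fun.
    have := C1k_comp_affine 1 (- x) (Cb 0%N) => /=.
    by under eq_fun do rewrite mul1r.
  + by rewrite invr_ge0 ltW.
Qed.

(** * Lebesgue measure on the four-dimensional space *)

Lemma sigma_finite_prod d1 d2 (T1 : measurableType d1) (T2 : measurableType d2)
    (R : realType) (m1 : {sigma_finite_measure set T1 -> \bar R})
    (m2 : {sigma_finite_measure set T2 -> \bar R}) :
  sigma_finite setT (m1 \x m2)%E.
Proof.
have /sigma_finiteP[F [F_T F_nd F_fin]] := sigma_finiteT m1.
have /sigma_finiteP[G [G_T G_nd G_fin]] := sigma_finiteT m2.
exists (fun n => F n `*` G n).
  apply/seteqP; split => // -[x y] _.
  have [i _ Fi] : (\bigcup_i F i) x by rewrite -F_T.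
  have [j _ Gj] : (\bigcup_i G i) y by rewrite -G_T.
  exists (maxn i j) => //; split => /=.
    by move: Fi; apply/subsetPset/F_nd/leq_maxl.
  by move: Gj; apply/subsetPset/G_nd/leq_maxr.
move=> n; have [mF Foo] := F_fin n; have [mG Goo] := G_fin n.
split; first exact: measurableX.
by rewrite product_measure1E// lte_mul_pinfty// ge0_fin_numE.
Qed.

Notation T2 R := (measurableTypeR R * measurableTypeR R)%type.
Notation T3 R := (measurableTypeR R * measurableTypeR R * measurableTypeR R)%type.
Notation T4 R := (measurableTypeR R * measurableTypeR R *
                  measurableTypeR R * measurableTypeR R)%type.

(* The library registers products of measures as s-finite, not as
   sigma-finite, hence these copies of [leb4 R] and its factors. *)
Section lebesgue_products.
Variable R : realType.

Definition mu2 : set (T2 R) -> \bar R := (@lebesgue_measure R \x @lebesgue_measure R)%E.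
HB.instance Definition _ := Measure.on mu2.
HB.instance Definition _ := Measure_isSigmaFinite.Build _ _ _ mu2
  (sigma_finite_prod (@lebesgue_measure R) (@lebesgue_measure R)).

Definition mu3 : set (T3 R) -> \bar R := (mu2 \x @lebesgue_measure R)%E.
HB.instance Definition _ := Measure.on mu3.
HB.instance Definition _ := Measure_isSigmaFinite.Build _ _ _ mu3
  (sigma_finite_prod mu2 (@lebesgue_measure R)).

Definition mu4 : set (T4 R) -> \bar R := (mu3 \x @lebesgue_measure R)%E.
HB.instance Definition _ := Measure.on mu4.
HB.instance Definition _ := Measure_isSigmaFinite.Build _ _ _ mu4
  (sigma_finite_prod mu3 (@lebesgue_measure R)).

Lemma mu2X (A B : set (measurableTypeR R)) : measurable A -> measurable B ->
  mu2 (A `*` B) = (lebesgue_measure A * lebesgue_measure B)%E.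
Proof. exact: product_measure1E. Qed.

Lemma mu3X (A : set (T2 R)) (B : set (measurableTypeR R)) : measurable A ->
  measurable B -> mu3 (A `*` B) = (mu2 A * lebesgue_measure B)%E.
Proof. exact: product_measure1E. Qed.

Lemma mu4X (A : set (T3 R)) (B : set (measurableTypeR R)) : measurable A ->
  measurable B -> mu4 (A `*` B) = (mu3 A * lebesgue_measure B)%E.
Proof. exact: product_measure1E. Qed.

End lebesgue_products.
Arguments mu4 {R}.

Section coordinates.
Variable R : realType.
Implicit Types (x y c : R4 R) (i j : 'I_4).

Lemma ord4P (P : 'I_4 -> Prop) :
  P (@Ordinal 4 0 isT) -> P (@Ordinal 4 1 isT) -> P (@Ordinal 4 2 isT) ->
  P (@Ordinal 4 3 isT) -> forall i, P i.
Proof.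
move=> P0 P1 P2 P3 [[|[|[|[|//]]]] lti]; by rewrite (bool_irrelevance lti isT).
Qed.

Lemma sum4E (V : nmodType) (F : 'I_4 -> V) : \sum_i F i =
  F (@Ordinal 4 0 isT) + F (@Ordinal 4 1 isT) + F (@Ordinal 4 2 isT) +
  F (@Ordinal 4 3 isT).
Proof.
rewrite !big_ord_recl big_ord0 addr0 !addrA.
by congr (F _ + F _ + F _ + F _); apply: val_inj.
Qed.

Lemma prod4E (V : pzSemiRingType) (F : 'I_4 -> V) : \prod_i F i =
  F (@Ordinal 4 0 isT) * F (@Ordinal 4 1 isT) * F (@Ordinal 4 2 isT) *
  F (@Ordinal 4 3 isT).
Proof.
rewrite !big_ord_recl big_ord0 mulr1 !mulrA.
by congr (F _ * F _ * F _ * F _); apply: val_inj.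
Qed.

Definition upd4 i (t : R) x : R4 R :=
  (if i == 0%N :> nat then t else x.1.1.1, if i == 1%N :> nat then t else x.1.1.2,
   if i == 2%N :> nat then t else x.1.2, if i == 3%N :> nat then t else x.2).

Lemma coord4_upd4 i j t x : coord4 i (upd4 j t x) = if i == j then t else coord4 i x.
Proof. by move: i j; apply: ord4P; apply: ord4P; rewrite /upd4. Qed.

Lemma coord4E x : (coord4 (@Ordinal 4 0 isT) x = x.1.1.1) *
  (coord4 (@Ordinal 4 1 isT) x = x.1.1.2) *
  (coord4 (@Ordinal 4 2 isT) x = x.1.2) * (coord4 (@Ordinal 4 3 isT) x = x.2).
Proof. by []. Qed.

Lemma coord4_ext x y : (forall i, coord4 i x = coord4 i y) -> x = y.
Proof.
move: x y => [[[a b] c] d] [[[a' b'] c'] d'] H.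
have := H (@Ordinal 4 0 isT); have := H (@Ordinal 4 1 isT).
have := H (@Ordinal 4 2 isT); have := H (@Ordinal 4 3 isT).
by rewrite !coord4E/= => -> -> -> ->.
Qed.

Lemma upd4_id i x : upd4 i (coord4 i x) x = x.
Proof. by apply: coord4_ext => j; rewrite coord4_upd4; case: eqP => [->|]. Qed.

Lemma coord4D i x y : coord4 i (x + y) = coord4 i x + coord4 i y.
Proof. by move: i; apply: ord4P. Qed.

Lemma coord4N i x : coord4 i (- x) = - coord4 i x.
Proof. by move: i; apply: ord4P. Qed.

Lemma coord4B i x y : coord4 i (x - y) = coord4 i x - coord4 i y.
Proof. by rewrite coord4D coord4N. Qed.

Lemma coord4Z i (k : R) x : coord4 i (k *: x) = k * coord4 i x.
Proof. by move: i; apply: ord4P. Qed.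

Lemma coord4_evec i j : coord4 i (evec R j) = (i == j)%:R.
Proof. by move: i j; apply: ord4P; apply: ord4P. Qed.

Lemma add_evec i (h : R) x : x + h *: evec R i = upd4 i (coord4 i x + h) x.
Proof.
apply: coord4_ext => j; rewrite coord4D coord4Z coord4_evec coord4_upd4.
by case: eqP => [->|_]; rewrite ?mulr1// mulr0 addr0.
Qed.

Lemma measurable_coord4 i :
  measurable_fun setT (@coord4 R i : T4 R -> measurableTypeR R).
Proof.
move: i; apply: ord4P; rewrite /coord4/=.
- by apply: (measurableT_comp (f := fst)) => //; apply: (measurableT_comp (f := fst)).
- by apply: (measurableT_comp (f := snd)) => //; apply: (measurableT_comp (f := fst)).
- by apply: (measurableT_comp (f := snd)).
- exact: measurable_snd.
Qed.

Lemma continuous_coord4 i : continuous (@coord4 R i).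
Proof.
move: i; apply: ord4P; rewrite /coord4/= => x.
- apply: (@continuous_comp _ _ _ (fun x : R4 R => x.1.1) fst); last exact: cvg_fst.
  by apply: (@continuous_comp _ _ _ (fun x : R4 R => x.1) fst); exact: cvg_fst.
- apply: (@continuous_comp _ _ _ (fun x : R4 R => x.1.1) snd); last exact: cvg_snd.
  by apply: (@continuous_comp _ _ _ (fun x : R4 R => x.1) fst); exact: cvg_fst.
- by apply: (@continuous_comp _ _ _ (fun x : R4 R => x.1) snd); [exact: cvg_fst|exact: cvg_snd].
- exact: cvg_snd.
Qed.

Definition box c (e : R) : set (R4 R) :=
  [set x | forall i, `|coord4 i x - coord4 i c| < e].

Lemma nbhs_box x (A : set (R4 R)) : nbhs x A ->
  exists2 d : R, 0 < d & box x d `<=` A.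
Proof.
move=> /nbhs_ballP[d /= d0 Hd].
exists d => // y Hy; apply: Hd.
have H i : ball (coord4 i x) d (coord4 i y) by rewrite /ball/= distrC; exact: Hy.
split; [split; [split|]|].
- exact: (H (@Ordinal 4 0 isT)).
- exact: (H (@Ordinal 4 1 isT)).
- exact: (H (@Ordinal 4 2 isT)).
- exact: (H (@Ordinal 4 3 isT)).
Qed.

Lemma open_box x (A : set (R4 R)) : open A -> A x ->
  exists2 d : R, 0 < d & box x d `<=` A.
Proof. by rewrite openE => oA /oA; exact: nbhs_box. Qed.

Definition itvbox c (e : R) : set (T4 R) :=
  (((`](c.1.1.1 - e), (c.1.1.1 + e)[%classic `*` `](c.1.1.2 - e), (c.1.1.2 + e)[%classic)
   `*` `](c.1.2 - e), (c.1.2 + e)[%classic) `*` `](c.2 - e), (c.2 + e)[%classic).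

Lemma boxE c e : box c e = itvbox c e.
Proof.
have E (a b : R) : `|a - b| < e <-> a \in `](b - e), (b + e)[.
  by rewrite in_itv/= ltr_distl.
apply/seteqP; split=> [[[[x1 x2] x3] x4] H|[[[x1 x2] x3] x4] [[[/E H1 /E H2] /E H3] /E H4]].
  have := H (@Ordinal 4 0 isT); have := H (@Ordinal 4 1 isT).
  have := H (@Ordinal 4 2 isT); have := H (@Ordinal 4 3 isT).
  by rewrite !coord4E/= => /E H4 /E H3 /E H2 /E H1.
by apply: ord4P; rewrite !coord4E.
Qed.

Lemma measurable_box c e : measurable (box c e : set (T4 R)).
Proof. by rewrite boxE; do ![apply: measurableX]. Qed.

Lemma mu4_box c e : 0 <= e -> mu4 (box c e : set (T4 R)) = ((2 * e) ^+ 4)%:E.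
Proof.
move=> e0; rewrite boxE /itvbox mu4X//; last by do ![apply: measurableX].
rewrite mu3X//; last exact: measurableX.
rewrite mu2X//.
have E (b : R) : (lebesgue_measure (`](b - e)%R, (b + e)%R[%classic : set R) = (2 * e)%:E)%E.
  rewrite lebesgue_measure_itv/= lte_fin -EFinB.
  case: ifPn => [_|]; first by congr EFin; ring.
  rewrite -leNgt => H; have -> : e = 0 by lra.
  by rewrite mulr0.
rewrite !E -!EFinM; congr EFin; ring.
Qed.

(** The sigma-algebra is generated by products and the topology by a norm. They meet because an open
    set is the union of the countably many boxes with rational centre and rational half-side that it
    contains. A half-side below [d / 2] keeps such a box, once it contains [x], inside the box of
    half-side [d] at [x]. *)
Lemma open_measurable4 (A : set (R4 R)) : open A -> measurable (A : set (T4 R)).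
Proof.
move=> oA.
pose Q := (rat * rat * rat * rat * rat)%type.
pose C (q : Q) : R4 R := (ratr q.1.1.1.1, ratr q.1.1.1.2, ratr q.1.1.2, ratr q.1.2).
pose B (q : Q) := if `[< box (C q) (ratr q.2) `<=` A >] then box (C q) (ratr q.2) else set0.
have -> : A = \bigcup_n (if @unpickle Q n is Some q then B q else set0).
  apply/seteqP; split => [x Ax|x [n _]].
    have [d d0 dA] := open_box oA Ax.
    have [e] : exists e : rat, ratr e \in `]0%R, (d / 2)[.
      by apply: rat_in_itvoo; rewrite divr_gt0.
    rewrite in_itv/= => /andP[e0 ed].
    have /choice[q Hq] : forall i : 'I_4, exists q : rat, `|ratr q - coord4 i x| < ratr e.
      move=> i; have [|q] := @rat_in_itvoo R (coord4 i x - ratr e) (coord4 i x + ratr e).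
        by lra.
      by rewrite in_itv/= -ltr_distl => ?; exists q.
    pose qq : Q := (q (@Ordinal 4 0 isT), q (@Ordinal 4 1 isT),
      q (@Ordinal 4 2 isT), q (@Ordinal 4 3 isT), e).
    have Cq i : coord4 i (C qq) = ratr (q i) by move: i; apply: ord4P.
    have [n qn] : exists n, @unpickle Q n = Some qq.
      by exists (@pickle Q qq); exact: (@pickleK Q).
    exists n; first by []; rewrite qn /B ifT.
      by move=> i; rewrite Cq distrC.
    apply/asboolP => y Hy; apply: dA => i.
    have := Hy i; rewrite Cq => yq; have := Hq i => qx.
    rewrite -(subrK (ratr (q i)) (coord4 i y)) -addrA.
    rewrite (le_lt_trans (ler_normD _ _))//.
    apply: lt_le_trans (ltrD yq qx) _; move: ed; rewrite /=.
    move: (ratr e : R) => a; lra.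
  by case: unpickle => // q; rewrite /B; case: asboolP => // qA /qA.
apply: bigcup_measurable => n _; case: unpickle => // q.
by rewrite /B; case: ifPn => // _; exact: measurable_box.
Qed.

Lemma continuous_measurable4 (f : R4 R -> R) : continuous f ->
  measurable_fun setT (f : T4 R -> measurableTypeR R).
Proof.
move=> cf; apply: (measurability _ (RGenOpens.measurableE R)).
move=> _ [_ [a [b ->]] <-]; rewrite setTI; apply: open_measurable4.
apply: open_comp; last exact: interval_open.
by move=> x _; exact: cf.
Qed.

End coordinates.

(** * Fubini's theorem on slices *)

Section product_integrals.
Context d1 d2 (T1 : measurableType d1) (T2 : measurableType d2) (R : realType).
Variables (m1 : {sigma_finite_measure set T1 -> \bar R})
  (m2 : {sigma_finite_measure set T2 -> \bar R}).
Local Open Scope ereal_scope.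

(** Only integrable slices are tested, and by Fubini almost all slices are. With the hypothesis in
    this form the lemma can be applied again inside a slice, peeling off one factor at a time. *)
Lemma prod_integral_eq0_r (f : T1 * T2 -> \bar R) :
  (m1 \x m2).-integrable setT f ->
  (forall x, m2.-integrable setT (fun y => f (x, y)) -> \int[m2]_y f (x, y) = 0) ->
  \int[m1 \x m2]_z f z = 0.
Proof.
move=> intf f0; rewrite -integral12_prod_meas1//.
rewrite (ae_eq_integral (cst 0))//.
- by rewrite integral_cst// mul0e.
- exact: measurable_int (integrable_fubini_F intf).
- by apply: filterS (ae_integrable1 intf) => x /f0 ? _.
Qed.

Lemma prod_integral_eq0_l (f : T1 * T2 -> \bar R) :
  (m1 \x m2).-integrable setT f ->
  (forall y, m1.-integrable setT (fun x => f (x, y)) -> \int[m1]_x f (x, y) = 0) ->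
  \int[m1 \x m2]_z f z = 0.
Proof.
move=> intf f0; rewrite -integral21_prod_meas1//.
rewrite (ae_eq_integral (cst 0))//.
- by rewrite integral_cst// mul0e.
- exact: (measurable_fubini_G intf).
- by apply: filterS (ae_integrable2 intf) => x /f0 ? _.
Qed.

Lemma prod_integralM (f : T1 -> R) (g : T2 -> R) :
  measurable_fun setT f -> measurable_fun setT g ->
  (forall x, 0 <= f x)%R -> (forall y, 0 <= g y)%R ->
  \int[m1 \x m2]_z (f z.1 * g z.2)%:E = (\int[m1]_x (f x)%:E) * (\int[m2]_y (g y)%:E).
Proof.
move=> mf mg f0 g0; rewrite fubini_tonelli1//=; last first.
- by move=> z; rewrite lee_fin mulr_ge0.
- apply/measurable_EFinP; apply: measurable_funM; first exact: measurableT_comp mf _.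
  exact: measurableT_comp mg _.
rewrite /fubini_F/=; under eq_integral => x _.
  under eq_integral do rewrite EFinM.
  rewrite ge0_integralZl_EFin//; last 2 first.
  - by move=> y _; rewrite lee_fin.
  - exact/measurable_EFinP.
  over.
rewrite ge0_integralZr//.
- exact/measurable_EFinP.
- by move=> x _; rewrite lee_fin.
- by apply: integral_ge0 => y _; rewrite lee_fin.
Qed.

End product_integrals.

Section lebesgue4_integrals.
Variable R : realType.
Local Open Scope ereal_scope.

(** Serves as the divergence theorem: it is applied to an [i]-th partial derivative of a function
    that vanishes at both ends of the relevant segment on each line parallel to the [i]-th axis. *)
Lemma integral_slice_eq0 (i : 'I_4) (F : R4 R -> R) :
  (@mu4 R).-integrable setT (EFin \o F) ->
  (forall x, \int[@lebesgue_measure R]_t (F (upd4 i t x))%:E = 0) ->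
  \int[@mu4 R]_x (F x)%:E = 0.
Proof.
move=> intF; move: i; apply: ord4P => H.
- apply: prod_integral_eq0_l => // d intd; apply: prod_integral_eq0_l => // c intc.
  by apply: prod_integral_eq0_l => // b intb; have := H (0, b, c, d)%R.
- apply: prod_integral_eq0_l => // d intd; apply: prod_integral_eq0_l => // c intc.
  by apply: prod_integral_eq0_r => // a inta; have := H (a, 0, c, d)%R.
- apply: prod_integral_eq0_l => // d intd; apply: prod_integral_eq0_r => // -[a b] intc.
  by have := H (a, b, 0, d)%R.
- by apply: prod_integral_eq0_r => // -[[a b] c] intc; have := H (a, b, c, 0)%R.
Qed.

Lemma integral_prod4 (a : 'I_4 -> R -> R) :
  (forall i, measurable_fun setT (a i : measurableTypeR R -> measurableTypeR R)) ->
  (forall i t, 0 <= a i t)%R ->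
  (forall i, \int[@lebesgue_measure R]_t (a i t)%:E = 1) ->
  \int[@mu4 R]_x (\prod_i a i (coord4 i x))%:E = 1.
Proof.
move=> ma a0 a1; under eq_integral do rewrite prod4E !coord4E.
set i0 := @Ordinal 4 0 isT; set i1 := @Ordinal 4 1 isT.
set i2 := @Ordinal 4 2 isT; set i3 := @Ordinal 4 3 isT.
have m2 : measurable_fun setT (fun x : T2 R => a i0 x.1 * a i1 x.2)%R.
  apply: measurable_funM; first exact: measurableT_comp (ma _) _.
  exact: measurableT_comp (ma _) _.
have m3 : measurable_fun setT (fun x : T3 R => a i0 x.1.1 * a i1 x.1.2 * a i2 x.2)%R.
  apply: measurable_funM; last exact: measurableT_comp (ma _) _.
  exact: (measurableT_comp (f := fun x : T2 R => a i0 x.1 * a i1 x.2)%R).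
have p3 (x : T3 R) : (0 <= a i0 x.1.1 * a i1 x.1.2 * a i2 x.2)%R by rewrite !mulr_ge0.
have p2 (x : T2 R) : (0 <= a i0 x.1 * a i1 x.2)%R by rewrite !mulr_ge0.
have := @prod_integralM _ _ _ _ _ (@mu3 R) (@lebesgue_measure R) _ _ m3 (ma i3) p3 (a0 i3).
rewrite a1 mule1 => E3; apply: etrans E3 _.
have := @prod_integralM _ _ _ _ _ (@mu2 R) (@lebesgue_measure R) _ _ m2 (ma i2) p2 (a0 i2).
rewrite a1 mule1 => E2; apply: etrans E2 _.
have := @prod_integralM _ _ _ _ _ (@lebesgue_measure R) (@lebesgue_measure R)
  _ _ (ma i0) (ma i1) (a0 i0) (a0 i1).
by rewrite !a1 mule1.
Qed.

End lebesgue4_integrals.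

(** * Euclidean balls compared with cubes *)

Section euclidean_balls.
Variable R : realType.
Implicit Types (x y c : R4 R) (r s : R).

Definition sqd c x : R := \sum_i (coord4 i x - coord4 i c) ^+ 2.

Lemma sqd_ge0 c x : 0 <= sqd c x.
Proof. by apply: sumr_ge0 => i _; exact: sqr_ge0. Qed.

Lemma enormB x c : enorm (x - c) = Num.sqrt (sqd c x).
Proof. by congr Num.sqrt; apply: eq_bigr => i _; rewrite coord4B. Qed.

Lemma eballE c r x : 0 < r -> eball c r x <-> sqd c x < r ^+ 2.
Proof.
move=> r0; rewrite /eball/= enormB -[X in _ < X <-> _]ger0_norm ?ltW// -sqrtr_sqr.
by rewrite ltr_sqrt// exprn_gt0.
Qed.

Lemma enorm_triangle x y : enorm (x + y) <= enorm x + enorm y.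
Proof.
have S0 (z : R4 R) : 0 <= \sum_i coord4 i z ^+ 2 by apply: sumr_ge0 => i _; exact: sqr_ge0.
have E0 (z : R4 R) : 0 <= enorm z by exact: sqrtr_ge0.
rewrite -(@ler_pXn2r _ 2)// ?nnegrE ?addr_ge0// sqrrD !sqr_sqrtr//.
suff H : \sum_i coord4 i x * coord4 i y <= enorm x * enorm y.
  rewrite !sum4E !coord4D; move: H; rewrite sum4E; lra.
rewrite /enorm -sqrtrM//; apply: le_trans (ler_norm _) _.
rewrite -sqrtr_sqr; apply: ler_wsqrtr.
rewrite !sum4E -subr_ge0.
set a := coord4 _ x; set b := coord4 _ x; set c := coord4 _ x; set d := coord4 _ x.
set a' := coord4 _ y; set b' := coord4 _ y; set c' := coord4 _ y; set d' := coord4 _ y.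
(* Lagrange's identity, which gives the Cauchy-Schwarz inequality as a sum of squares. *)
suff -> : (a ^+ 2 + b ^+ 2 + c ^+ 2 + d ^+ 2) *
  (a' ^+ 2 + b' ^+ 2 + c' ^+ 2 + d' ^+ 2) -
  (a * a' + b * b' + c * c' + d * d') ^+ 2 =
  (a * b' - b * a') ^+ 2 + (a * c' - c * a') ^+ 2 + (a * d' - d * a') ^+ 2 +
  (b * c' - c * b') ^+ 2 + (b * d' - d * b') ^+ 2 + (c * d' - d * c') ^+ 2.
  by rewrite !addr_ge0// sqr_ge0.
ring.
Qed.

Lemma eballS c x s r : enorm (x - c) + s <= r -> eball x s `<=` eball c r.
Proof.
move=> xcs y; rewrite /eball/= => yx; apply: lt_le_trans xcs.
have -> : y - c = (x - c) + (y - x).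
  by apply: coord4_ext => i; rewrite !(coord4D, coord4N); ring.
by rewrite (le_lt_trans (enorm_triangle _ _))// ltrD2l.
Qed.

(** In dimension four a cube of half-side [r / 2] has half-diagonal exactly [r]. *)
Lemma box_eball c r : 0 < r -> box c (r / 2) `<=` eball c r.
Proof.
move=> r0 x H; apply/eballE => //; rewrite /sqd sum4E.
have K i : (coord4 i x - coord4 i c) ^+ 2 < (r / 2) ^+ 2.
  rewrite -[ltLHS](real_normK (num_real _)) ltr_pXn2r ?nnegrE ?normr_ge0 ?divr_ge0 ?(ltW r0)//; exact: H.
have := K (@Ordinal 4 0 isT); have := K (@Ordinal 4 1 isT).
have := K (@Ordinal 4 2 isT); have := K (@Ordinal 4 3 isT).
have -> : (r / 2) ^+ 2 = r ^+ 2 / 4 by field.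
lra.
Qed.

Lemma sqr_le_sqd i c x : (coord4 i x - coord4 i c) ^+ 2 <= sqd c x.
Proof. by rewrite /sqd (bigD1 i)//= lerDl; apply: sumr_ge0 => j _; exact: sqr_ge0. Qed.

Lemma eball_box c r : 0 < r -> eball c r `<=` box c r.
Proof.
move=> r0 x /eballE => /(_ r0) H i.
rewrite -(@ltr_pXn2r _ 2)// ?nnegrE ?ltW// (real_normK (num_real _)).
exact: le_lt_trans (sqr_le_sqd _ _ _) H.
Qed.

Lemma continuous_sqd c : continuous (sqd c).
Proof.
under [sqd c]funext => x do rewrite /sqd sum4E.
have H i : continuous (fun x : R4 R => (coord4 i x - coord4 i c) ^+ 2).
  have K : continuous (fun x : R4 R => coord4 i x - coord4 i c).
    by move=> x; apply: cvgB; [exact: continuous_coord4|exact: cvg_cst].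
  have -> : (fun x : R4 R => (coord4 i x - coord4 i c) ^+ 2) =
            (fun x => (coord4 i x - coord4 i c) * (coord4 i x - coord4 i c)).
    by apply/funext => x; rewrite expr2.
  by move=> x; exact: (cvgM (K x) (K x)).
by move=> x; do 3?[apply: cvgD; last exact: H]; exact: H.
Qed.

Lemma open_eball c r : open (eball c r).
Proof.
have [r0|r0] := ltP 0 r; last first.
  suff -> : eball c r = set0 by exact: open0.
  apply/seteqP; split => // x; rewrite /eball/= => xr; have := lt_le_trans xr r0.
  by rewrite ltNge sqrtr_ge0.
have -> : eball c r = sqd c @^-1` [set t | t < r ^+ 2].
  by apply/seteqP; split => x /eballE => /(_ r0).
apply: open_comp; last exact: open_lt.
by move=> x _; exact: (@continuous_sqd c x).
Qed.

Lemma measurable_eball c r : measurable (eball c r : set (T4 R)).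
Proof. by apply: open_measurable4; exact: open_eball. Qed.

(** Volumes of balls are needed only up to constants, so the circumscribed cube here and the
    inscribed cube in [mu4_eball_ge] replace the exact value. *)
Lemma mu4_eball_le c r : 0 < r -> (mu4 (eball c r : set (T4 R)) <= (16 * r ^+ 4)%:E)%E.
Proof.
move=> r0; have -> : 16 * r ^+ 4 = (2 * r) ^+ 4 by ring.
rewrite -(mu4_box c (ltW r0)); apply: (@le_measure _ _ _ (@mu4 R)); rewrite ?inE.
- exact: measurable_eball.
- exact: measurable_box.
- exact: eball_box.
Qed.

Lemma mu4_eball_ge c r : 0 < r -> ((r ^+ 4)%:E <= mu4 (eball c r : set (T4 R)))%E.
Proof.
move=> r0; have -> : r ^+ 4 = (2 * (r / 2)) ^+ 4 by field.
have r20 : 0 <= r / 2 by rewrite divr_ge0// ltW.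
rewrite -(mu4_box c r20); apply: (@le_measure _ _ _ (@mu4 R)); rewrite ?inE.
- exact: measurable_box.
- exact: measurable_eball.
- exact: box_eball.
Qed.

End euclidean_balls.

(** * Mean value inequalities for superharmonic functions *)

Section continuous_fun.
Variables (T : topologicalType) (R : realType).
Implicit Types f g : T -> R.

Lemma continuousD_fun f g : continuous f -> continuous g -> continuous (fun x => f x + g x).
Proof. by move=> cf cg x; exact: (cvgD (cf x) (cg x)). Qed.

Lemma continuousB_fun f g : continuous f -> continuous g -> continuous (fun x => f x - g x).
Proof. by move=> cf cg x; exact: (cvgB (cf x) (cg x)). Qed.

Lemma continuousN_fun f : continuous f -> continuous (fun x => - f x).
Proof. by move=> cf x; exact: (cvgN (cf x)). Qed.

Lemma continuousM_fun f g : continuous f -> continuous g -> continuous (fun x => f x * g x).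
Proof. by move=> cf cg x; exact: (cvgM (cf x) (cg x)). Qed.

Lemma continuous_cst_fun (c : R) : continuous (fun _ : T => c).
Proof. by move=> x; exact: cvg_cst. Qed.

Lemma continuousX_fun f n : continuous f -> continuous (fun x => f x ^+ n).
Proof.
move=> cf; elim: n => [|n IH].
  by under eq_fun do rewrite expr0; exact: continuous_cst_fun.
by under eq_fun do rewrite exprS; exact: continuousM_fun.
Qed.

Lemma continuousV_fun f : (forall x, f x != 0) -> continuous f ->
  continuous (fun x => (f x)^-1).
Proof. by move=> f0 cf x; exact: (cvgV (f0 x) (cf x)). Qed.

Lemma continuous_sum_fun n (F : 'I_n -> T -> R) : (forall i, continuous (F i)) ->
  continuous (fun x => \sum_i F i x).
Proof.
elim: n F => [|n IH] F cF.
  by under eq_fun do rewrite big_ord0; exact: continuous_cst_fun.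
under eq_fun do rewrite big_ord_recl; apply: continuousD_fun; first exact: cF.
by apply: IH => i; exact: cF.
Qed.

End continuous_fun.

Ltac cts :=
  lazymatch goal with
  | |- forall x, continuous_at x (fun _ => ?a) => exact: continuous_cst_fun
  | |- forall x, continuous_at x (coord4 _) => exact: continuous_coord4
  | |- forall x, continuous_at x (sqd _) => exact: continuous_sqd
  | |- forall x, continuous_at x (fun y => coord4 _ y) => exact: continuous_coord4
  | |- forall x, continuous_at x (fun y => sqd _ y) => exact: continuous_sqd
  | |- forall x, continuous_at x (fun y => @?f y + - @?g y) => apply: continuousB_fun; cts
  | |- forall x, continuous_at x (fun y => @?f y + @?g y) => apply: continuousD_fun; cts
  | |- forall x, continuous_at x (fun y => - @?f y) => apply: continuousN_fun; cts
  | |- forall x, continuous_at x (fun y => @?f y * @?g y) => apply: continuousM_fun; cts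
  | |- forall x, continuous_at x (fun y => @?f y ^+ ?n) => apply: continuousX_fun; cts
  | |- _ => try solve [by []|match goal with H : _ |- _ => exact: H end]
  end.

Section ball_integrals.
Variable R : realType.
Implicit Types (f h : R4 R -> R) (c x : R4 R) (r s q : R) (i : 'I_4).

Lemma continuous_bounded_box f c r : continuous f ->
  exists2 M, 0 < M & forall x, box c r x -> `|f x| <= M.
Proof.
move=> cf.
pose K : set (R4 R) :=
  ((`[c.1.1.1 - r, c.1.1.1 + r] `*` `[c.1.1.2 - r, c.1.1.2 + r])
   `*` `[c.1.2 - r, c.1.2 + r]) `*` `[c.2 - r, c.2 + r].
have cK : compact K.
  by do 3?[apply: compact_setX; last exact: segment_compact]; exact: segment_compact.
have /compact_bounded[M [Mr HM]] : compact (f @` K).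
  by apply: continuous_compact => //; exact: continuous_subspaceT.
exists (`|M| + 1); first by rewrite ltr_wpDl.
move=> x xr; apply: HM; first by rewrite (le_lt_trans (ler_norm _))// ltrDl.
exists x => //.
have E (a b : R) : `|a - b| < r -> a \in `[b - r, b + r].
  by rewrite in_itv/= ltr_distl => /andP[/ltW -> /ltW ->].
move: x xr => [[[x1 x2] x3] x4] H.
have := H (@Ordinal 4 0 isT); have := H (@Ordinal 4 1 isT).
have := H (@Ordinal 4 2 isT); have := H (@Ordinal 4 3 isT).
by rewrite !coord4E/= => /E H4 /E H3 /E H2 /E H1.
Qed.

Lemma mu4_eball_lty c r : (mu4 (eball c r : set (T4 R)) < +oo)%E.
Proof.
have [r0|r0] := ltP 0 r; first by rewrite (le_lt_trans (mu4_eball_le c r0))// ltry.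
rewrite [X in mu4 X](_ : _ = set0) ?measure0//.
apply/seteqP; split => // x; rewrite /eball/= => xr; have := lt_le_trans xr r0.
by rewrite ltNge sqrtr_ge0.
Qed.

Lemma eball_le0 c r : r <= 0 -> eball c r = set0.
Proof.
move=> r0; apply/seteqP; split => // x; rewrite /eball/= => xr; have := lt_le_trans xr r0.
by rewrite ltNge sqrtr_ge0.
Qed.

Lemma integrable_eball f c r : continuous f ->
  (@mu4 R).-integrable (eball c r) (EFin \o f).
Proof.
move=> cf; apply: (@measurable_bounded_integrable _ (T4 R) R (@mu4 R)).
- exact: measurable_eball.
- exact: mu4_eball_lty.
- by apply: measurable_funTS; exact: continuous_measurable4.
- have [r0|r0] := ltP 0 r.
    have [M M0 HM] := continuous_bounded_box c r cf.
    exists M; split; first exact: num_real.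
    by move=> M' MM' x /= xr; rewrite (le_trans (HM _ _)) ?ltW//; exact: eball_box xr.
  by exists 0; split => // M' _ x /=; rewrite eball_le0.
Qed.

(* [h1 i] and [h2 i] are the first and the pure second partial derivatives of [h]
   in the direction [i]. *)
Definition slice_C2 h (h1 h2 : 'I_4 -> R4 R -> R) :=
  [/\ continuous h, forall i, continuous (h1 i), forall i, continuous (h2 i),
   forall i x (t : R), is_derive t 1 (fun s : R => h (upd4 i s x)) (h1 i (upd4 i t x)) &
   forall i x (t : R), is_derive t 1 (fun s : R => h1 i (upd4 i s x)) (h2 i (upd4 i t x))].

Lemma continuous_upd4 i x : continuous (fun t : R => upd4 i t x).
Proof.
have -> : (fun t : R => upd4 i t x) = (fun t : R => x + (t - coord4 i x) *: evec R i).
  by apply/funext => t; rewrite add_evec addrC subrK.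
move=> t; apply: cvgD; first exact: cvg_cst.
by apply: cvgZr_tmp; apply: cvgB; [exact: cvg_id|exact: cvg_cst].
Qed.

Lemma sqd_upd4 c i t x :
  sqd c (upd4 i t x) = (t - coord4 i c) ^+ 2 + (sqd c x - (coord4 i x - coord4 i c) ^+ 2).
Proof.
rewrite /sqd (bigD1 i)//= [X in _ = _ + (X - _)](bigD1 i)//= [X in _ = _ + X]addrAC subrr add0r.
rewrite coord4_upd4 eqxx; congr (_ + _); apply: eq_bigr => j ji.
by rewrite coord4_upd4 (negbTE ji).
Qed.

End ball_integrals.

Lemma Rintegral_sum4 (R : realType) (F : 'I_4 -> R4 R -> R) (A : set (T4 R)) :
  measurable A -> (forall i, (@mu4 R).-integrable A (EFin \o F i)) ->
  \int[@mu4 R]_(x in A) (\sum_i F i x) = \sum_i \int[@mu4 R]_(x in A) F i x.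
Proof.
move=> mA I; under eq_Rintegral do rewrite sum4E.
rewrite sum4E !RintegralD//.
- exact: (integrableD mA (I _) (I _)).
- exact: (integrableD mA (integrableD mA (I _) (I _)) (I _)).
Qed.

Section green.
Variables (R : realType) (c : R4 R) (s q : R).
Hypotheses (s0 : 0 < s) (q0 : 0 < q).
Implicit Types (x : R4 R) (i : 'I_4).

Let S : R := s ^+ 2.
Let a x := S - sqd c x.
Let D x := sqd c x + q.
Let u i x := coord4 i x - coord4 i c.

(* This choice makes [psi] and its gradient vanish on the sphere, and its
   Laplacian the constant 8 up to a multiple of the kernel [q / (sqd c x + q)^3],
   which concentrates at [c] as [q] tends to 0. *)
Definition psi x := a x ^+ 2 / D x.
Definition psi1 i x := - 4 * a x * u i x / D x - 2 * a x ^+ 2 * u i x / D x ^+ 2.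
Definition psi2 i x := 8 * u i x ^+ 2 / D x - 4 * a x / D x +
  16 * a x * u i x ^+ 2 / D x ^+ 2 - 2 * a x ^+ 2 / D x ^+ 2 +
  8 * a x ^+ 2 * u i x ^+ 2 / D x ^+ 3.

Lemma D_gt0 x : 0 < D x.
Proof. by rewrite ltr_wpDl// sqd_ge0. Qed.

Lemma D_neq0 x : D x != 0.
Proof. by rewrite gt_eqF// D_gt0. Qed.

Lemma psi_ge0 x : 0 <= psi x.
Proof. by rewrite divr_ge0 ?sqr_ge0// ltW// D_gt0. Qed.

(** Writing [S - sqd c x = S + q - D] turns [psi] into [(S + q) ^ 2 / D - 2 * (S + q) + D]. Here [D]
    has Laplacian 8, and [1 / D], the Newtonian kernel of dimension four regularised at its pole,
    has Laplacian [- 8 * q / D ^ 3]. *)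
Lemma sum_psi2 x :
  \sum_i psi2 i x = 8 - 8 * (S + q) ^+ 2 * q / (sqd c x + q) ^+ 3.
Proof.
have Du : \sum_i u i x ^+ 2 = D x - q by rewrite /D addrK.
have aD : a x = S + q - D x by rewrite /a /D; ring.
rewrite -/(D x); have := D_neq0 x; move: Du; rewrite !sum4E /psi2 aD.
move: (D x) (u _ x) (u _ x) (u _ x) (u _ x) => d u0 u1 u2 u3 E d0.
have -> : u3 ^+ 2 = d - q - u0 ^+ 2 - u1 ^+ 2 - u2 ^+ 2 by rewrite -E; ring.
by field.
Qed.

Lemma is_derive_psi i x (t : R) :
  is_derive t 1 (fun t : R => psi (upd4 i t x)) (psi1 i (upd4 i t x)) /\
  is_derive t 1 (fun t : R => psi1 i (upd4 i t x)) (psi2 i (upd4 i t x)).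
Proof.
pose A := sqd c x - (coord4 i x - coord4 i c) ^+ 2.
pose k := coord4 i c.
have du : is_derive t 1 (fun t : R => u i (upd4 i t x)) 1.
  rewrite /u; under eq_fun do rewrite coord4_upd4 eqxx.
  by have := is_derive1B (is_derive1_id t) (is_derive1_cst t k); rewrite subr0.
have ds : is_derive t 1 (fun t : R => sqd c (upd4 i t x)) (2 * u i (upd4 i t x)).
  have -> : (fun t : R => sqd c (upd4 i t x)) =
      (fun t : R => u i (upd4 i t x) * u i (upd4 i t x) + A).
    by apply/funext => v; rewrite sqd_upd4 /u coord4_upd4 eqxx expr2.
  apply: is_derive_eq (is_derive1D (is_derive1M du du) (is_derive1_cst t A)) _.
  ring.
have da : is_derive t 1 (fun t : R => a (upd4 i t x)) (- (2 * u i (upd4 i t x))).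
  by have := is_derive1B (is_derive1_cst t S) ds; rewrite sub0r.
have dD : is_derive t 1 (fun t : R => D (upd4 i t x)) (2 * u i (upd4 i t x)).
  by have := is_derive1D ds (is_derive1_cst t q); rewrite addr0.
have D0 := D_neq0 (upd4 i t x).
have dV := @is_derive1V R t (fun t : R => D (upd4 i t x)) _ D0 dD.
have daa := is_derive1M da da.
split.
- rewrite /psi; under eq_fun do rewrite expr2.
  apply: is_derive_eq (is_derive1M daa dV) _.
  by rewrite /psi1; field.
- have -> : (fun t : R => psi1 i (upd4 i t x)) = (fun t : R =>
      -4 * ((a (upd4 i t x) * u i (upd4 i t x)) * (D (upd4 i t x))^-1) -
      2 * ((a (upd4 i t x) * a (upd4 i t x)) * u i (upd4 i t x) *
            ((D (upd4 i t x))^-1 * (D (upd4 i t x))^-1))).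
    by apply/funext => v; rewrite /psi1; field; exact: D_neq0.
  apply: is_derive_eq (is_derive1B
    (is_derive1Zl (-4) (is_derive1M (is_derive1M da du) dV))
    (is_derive1Zl 2 (is_derive1M (is_derive1M daa du) (is_derive1M dV dV)))) _.
  by rewrite /psi2; field.
Qed.

Lemma continuous_psi : [/\ continuous psi, forall i, continuous (psi1 i) &
  forall i, continuous (psi2 i)].
Proof.
have ca : continuous a by rewrite /a; cts.
have cV : continuous (fun x => (D x)^-1).
  by apply: continuousV_fun D_neq0 _; rewrite /D; cts.
have cu i : continuous (u i) by rewrite /u; cts.
have cVn n : continuous (fun x => (D x ^+ n)^-1).
  by under eq_fun do rewrite -exprVn; exact: continuousX_fun.
by split; [rewrite /psi; cts|move=> i; rewrite /psi1; cts|move=> i; rewrite /psi2; cts].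
Qed.

Variables (h : R4 R -> R) (h1 h2 : 'I_4 -> R4 R -> R).
Hypothesis hC2 : slice_C2 h h1 h2.

Let B := eball c s.

(** On each chord of the ball parallel to the [i]-th axis the integrand is the derivative of
    [h * psi1 i - psi * h1 i], and this vanishes at both ends of the chord because [psi] and
    [psi1 i] vanish on the sphere. *)
Lemma green_slice i :
  \int[@mu4 R]_(x in B) (h x * psi2 i x - psi x * h2 i x) = 0.
Proof.
have [ch ch1 ch2 dh dh1] := hC2; have [cp cp1 cp2] := continuous_psi.
pose F x := h x * psi2 i x - psi x * h2 i x.
pose G x := h x * psi1 i x - psi x * h1 i x.
have cF : continuous F by rewrite /F; cts.
have dG x (t : R) : is_derive t 1 (fun t : R => G (upd4 i t x)) (F (upd4 i t x)).
  have [dp dp1] := is_derive_psi i x t.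
  apply: is_derive_eq (is_derive1B (is_derive1M (dh i x t) dp1) (is_derive1M dp (dh1 i x t))) _.
  by rewrite /F; ring.
rewrite Rintegral_mkcond /Rintegral (@integral_slice_eq0 _ i (F \_ B))//.
  rewrite -restrict_EFin; apply/integrable_restrict; rewrite ?setTI//.
    exact: measurable_eball.
  exact: integrable_eball.
move=> x; pose A := sqd c x - (coord4 i x - coord4 i c) ^+ 2.
pose k := coord4 i c.
have Bt t : B (upd4 i t x) <-> (t - k) ^+ 2 < S - A.
  by rewrite /B eballE// sqd_upd4 -/A -/k -/S ltrBrDr.
(* [A] is the squared distance from [c] to the line through [x] parallel to the [i]-th axis. The
   line misses the ball if [S <= A], and otherwise meets it in an open chord of half-length [l]. *)
have [SA|SA] := leP (S - A) 0.
  rewrite integral0_eq// => t _; rewrite patchE; case: ifPn => //.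
  rewrite inE => /Bt; move=> /lt_le_trans => /(_ _ SA).
  by rewrite ltNge sqr_ge0.
pose l := Num.sqrt (S - A).
have l0 : 0 < l by rewrite sqrtr_gt0.
have l2 : l ^+ 2 = S - A by rewrite sqr_sqrtr// ltW.
transitivity (\int[@lebesgue_measure R]_(t in `](k - l)%R, (k + l)%R[) (F (upd4 i t x))%:E)%E.
  rewrite [RHS]integral_mkcond; apply: eq_integral => t _.
  have E : (upd4 i t x \in B) = (t \in `]k - l, k + l[%classic).
    apply/idP/idP; rewrite !inE/= in_itv/= -ltr_distl.
      move=> /Bt; rewrite -l2 => H; rewrite -(@ltr_pXn2r _ 2)// ?nnegrE ?(ltW l0)//.
      by rewrite real_normK// num_real.
    move=> H; apply/Bt; rewrite -l2 -(real_normK (num_real (t - k))).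
    by rewrite ltr_pXn2r// ?nnegrE ?(ltW l0).
  by rewrite !patchE E; case: ifP.
have cFt : continuous (fun t : R => F (upd4 i t x)).
  move=> t; apply: (@continuous_comp _ _ _ (fun t : R => upd4 i t x) F).
    exact: continuous_upd4.
  exact: cF.
rewrite integral_itv_bndo_bndc; last first.
  by apply/measurable_EFinP; apply: measurable_funTS; apply: continuous_measurable_fun.
rewrite integral_itv_obnd_cbnd; last first.
  by apply/measurable_EFinP; apply: measurable_funTS; apply: continuous_measurable_fun.
have lr : k - l < k + l by lra.
apply: etrans (@FTC2_C1 R (fun t => G (upd4 i t x)) _ _ _ lr cFt (fun t _ => dG x t)) _.
have G0 t : (t - k) ^+ 2 = S - A -> G (upd4 i t x) = 0.
  move=> tS; have a0 : a (upd4 i t x) = 0.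
    by rewrite /a sqd_upd4 -/A -/k tS subrK subrr.
  rewrite /G /psi /psi1 a0; ring.
rewrite !G0 ?subrr//; rewrite -l2; ring.
Qed.

Lemma green_ball :
  \int[@mu4 R]_(x in B) (h x * (8 - 8 * (S + q) ^+ 2 * q / (sqd c x + q) ^+ 3)) =
  \int[@mu4 R]_(x in B) (psi x * \sum_i h2 i x).
Proof.
have [ch ch1 ch2 dh dh1] := hC2; have [cp cp1 cp2] := continuous_psi.
have mB : measurable (B : set (T4 R)) by exact: measurable_eball.
under eq_Rintegral do rewrite -sum_psi2.
apply/eqP; rewrite -subr_eq0 -RintegralB//; last 2 first.
- apply: (@integrable_eball R (fun x => h x * \sum_i psi2 i x)).
  by apply: continuousM_fun => //; exact: continuous_sum_fun.
- apply: (@integrable_eball R (fun x => psi x * \sum_i h2 i x)).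
  by apply: continuousM_fun => //; exact: continuous_sum_fun.
under eq_Rintegral do rewrite !mulr_sumr -sumrB.
rewrite (@Rintegral_sum4 _ (fun i x => h x * psi2 i x - psi x * h2 i x)).
- by rewrite big1// => i _; exact: green_slice.
- by [].
- by move=> i; apply: integrable_eball; cts.
Qed.

End green.

Section mean_value.
Variables (R : realType) (c : R4 R) (s : R).
Hypothesis s0 : 0 < s.
Implicit Types (x : R4 R) (i : 'I_4) (q : R).

Let S : R := s ^+ 2.
Let B := eball c s.
Let mB : measurable (B : set (T4 R)) := measurable_eball c s.

(** By [sum_psi2], the Laplacian of [psi] is [8 - 8 * ball_kernel q]. *)
Definition ball_kernel q x := (S + q) ^+ 2 * q / (sqd c x + q) ^+ 3.

Lemma ball_kernel_ge0 q x : 0 < q -> 0 <= ball_kernel q x.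
Proof.
move=> q0; apply: divr_ge0.
  by apply: mulr_ge0; [exact: sqr_ge0|exact: ltW].
by apply: exprn_ge0; apply: addr_ge0; [exact: sqd_ge0|exact: ltW].
Qed.

Lemma continuous_ball_kernel q : 0 < q -> continuous (ball_kernel q).
Proof.
move=> q0; rewrite /ball_kernel; apply: continuousM_fun; first exact: continuous_cst_fun.
apply: continuousV_fun; last by cts.
by move=> x; rewrite expf_neq0// gt_eqF// ltr_wpDl// sqd_ge0.
Qed.

Variables (h : R4 R -> R) (h1 h2 : 'I_4 -> R4 R -> R).
Hypothesis hC2 : slice_C2 h h1 h2.

Lemma ball_kernel_green q : 0 < q ->
  8 * \int[@mu4 R]_(x in B) h x - 8 * \int[@mu4 R]_(x in B) (h x * ball_kernel q x) =
  \int[@mu4 R]_(x in B) (psi c s q x * \sum_i h2 i x).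
Proof.
move=> q0; have ck := continuous_ball_kernel q0.
have [ch _ _ _ _] := hC2; rewrite -(green_ball c s0 q0 hC2).
rewrite -!RintegralZl//; last 2 first.
- by apply: integrable_eball; apply: continuousM_fun => //; exact: continuous_ball_kernel.
- exact: integrable_eball.
rewrite -RintegralB//; last 2 first.
- by apply: integrable_eball; cts.
- by apply: integrable_eball; cts.
by apply: eq_Rintegral => x _; rewrite /ball_kernel -/S; ring.
Qed.

Hypothesis h_super : forall x, B x -> \sum_i h2 i x <= 0.

Lemma superharmonic_kernel q : 0 < q ->
  \int[@mu4 R]_(x in B) h x <= \int[@mu4 R]_(x in B) (h x * ball_kernel q x).
Proof.
move=> q0; rewrite -subr_le0 -(pmulr_rle0 _ (ltr0n _ 8)) mulrBr ball_kernel_green//.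
rewrite -oppr_ge0; have [ch _ ch2 _ _] := hC2; have [cp _ _] := continuous_psi c s q0.
rewrite -mulN1r -RintegralZl//; last first.
  apply: integrable_eball; apply: continuousM_fun => //; exact: continuous_sum_fun.
apply: Rintegral_ge0 => x Bx.
by rewrite mulN1r -mulrN mulr_ge0 ?psi_ge0// oppr_ge0 h_super.
Qed.

End mean_value.

Section mean_value_limit.
Variables (R : realType) (c : R4 R) (s : R).
Hypothesis s0 : 0 < s.
Implicit Types (x : R4 R) (i : 'I_4) (q : R).

Let S : R := s ^+ 2.
Let B := eball c s.
Let mB : measurable (B : set (T4 R)) := measurable_eball c s.

(* The mass of the kernel is computed by Green's identity for [h = 1]. *)
Lemma ball_kernel_mass q : 0 < q ->
  \int[@mu4 R]_(x in B) ball_kernel c s q x = fine (mu4 (B : set (T4 R))).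
Proof.
move=> q0.
have C1 : slice_C2 (fun _ : R4 R => 1) (fun _ _ => 0) (fun _ _ => 0).
  by split => *; try exact: continuous_cst_fun; exact: is_derive1_cst.
have := ball_kernel_green c s0 C1 q0.
under [in RHS]eq_Rintegral do rewrite sum4E !addr0 mulr0.
rewrite !Rintegral_cst// mul0r mul1r => /eqP; rewrite subr_eq0 => /eqP.
under eq_Rintegral do rewrite mul1r.
by move/(mulfI (lt0r_neq0 (ltr0n _ 8))) => ->.
Qed.

(** The limit [q -> 0] in [superharmonic_kernel]: the kernel keeps the mass of the ball while
    concentrating at [c], where [h] is continuous. *)
Lemma mean_value_superharmonic h h1 h2 : slice_C2 h h1 h2 ->
  (forall x, B x -> \sum_i h2 i x <= 0) ->
  \int[@mu4 R]_(x in B) h x <= fine (mu4 (B : set (T4 R))) * h c.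
Proof.
move=> hC2 h_super; have [ch _ _ _ _] := hC2.
set m := fine (mu4 _).
have m0 : 0 <= m by exact: fine_ge0.
have chc : continuous (fun x => h x - h c) by cts.
have [M M0 HM] := continuous_bounded_box c s chc.
apply/ler_addgt0Pr => e e0.
pose e' := e / (m + 1) / 2.
have e'0 : 0 < e' by rewrite !divr_gt0// ltr_wpDl.
have [d d0 Hd] : exists2 d, 0 < d & box c d `<=` [set x | `|h x - h c| < e'].
  apply: nbhs_box; have /cvgrPdist_lt/(_ _ e'0) := ch c.
  by apply: filterS => x; rewrite distrC.
(* At distance at least [d] from [c] the kernel is at most [(S + 1) ^ 2 * q / d ^ 6], which this [q]
   makes at most [e' / M]. The errors near [c] and away from it then integrate to at most [e' * m]
   each. *)
pose q := Num.min 1 (e' * d ^+ 6 / (M * (S + 1) ^+ 2)).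
have S0 : 0 < S by rewrite exprn_gt0.
have MS : 0 < M * (S + 1) ^+ 2 by apply: mulr_gt0 => //; apply: exprn_gt0; exact: addr_gt0.
have q0 : 0 < q.
  rewrite /q lt_min ltr01/=; apply: divr_gt0 => //; apply: mulr_gt0 => //.
  exact: exprn_gt0.
have q1 : q <= 1 by rewrite /q ge_min lexx.
have qM : M * (S + 1) ^+ 2 * q <= e' * d ^+ 6.
  by rewrite mulrC -ler_pdivlMr// /q ge_min lexx orbT.
have bound x : B x -> (h x - h c) * ball_kernel c s q x <= e' * ball_kernel c s q x + e'.
  move=> Bx; have k0 := ball_kernel_ge0 c s x q0.
  have [xd|xd] := ltP (sqd c x) (d ^+ 2).
    rewrite ler_wpDr ?(ltW e'0)// ler_wpM2r// ltW//.
    apply: le_lt_trans (ler_norm _) _; apply: (Hd x) => i.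
    rewrite -(@ltr_pXn2r _ 2)// ?nnegrE ?(ltW d0)// (real_normK (num_real _)).
    exact: le_lt_trans (sqr_le_sqd _ _ _) xd.
  apply: (@le_trans _ _ e'); last by rewrite lerDr mulr_ge0// ltW.
  have hM : h x - h c <= M.
    by apply: le_trans (ler_norm _) _; apply: HM; exact: eball_box Bx.
  apply: le_trans (ler_wpM2r k0 hM) _.
  rewrite /ball_kernel -/S mulrA mulrA ler_pdivrMr; last first.
    by rewrite exprn_gt0// ltr_wpDl// sqd_ge0.
  apply: (@le_trans _ _ (e' * d ^+ 6)).
    apply: le_trans qM; apply: ler_wpM2r; first exact: ltW.
    apply: ler_wpM2l; first exact: ltW.
    apply: lerXn2r; rewrite ?nnegrE ?addr_ge0 ?(ltW q0) ?(ltW S0)//.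
    by rewrite lerD2l.
  rewrite (_ : d ^+ 6 = (d ^+ 2) ^+ 3); last by rewrite -exprM.
  apply: ler_wpM2l; first exact: ltW.
  apply: lerXn2r; rewrite ?nnegrE ?sqr_ge0 ?addr_ge0 ?sqd_ge0 ?(ltW q0)//.
  by apply: ler_wpDr => //; exact: ltW.
have ck : continuous (ball_kernel c s q) by exact: continuous_ball_kernel.
apply: le_trans (superharmonic_kernel s0 hC2 h_super q0) _.
have -> : \int[@mu4 R]_(x in B) (h x * ball_kernel c s q x) =
    \int[@mu4 R]_(x in B) ((h x - h c) * ball_kernel c s q x) + h c * m.
  rewrite /m -(ball_kernel_mass q0) -RintegralZl//; last exact: integrable_eball.
  rewrite -RintegralD//; last 2 first.
  - by apply: integrable_eball; cts.
  - by apply: integrable_eball; cts.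
  by apply: eq_Rintegral => x _; ring.
rewrite addrC mulrC lerD2l.
apply: (@le_trans _ _ (\int[@mu4 R]_(x in B) (e' * ball_kernel c s q x + e'))).
  apply: le_Rintegral => //.
  - by apply: integrable_eball; cts.
  - by apply: integrable_eball; cts.
rewrite RintegralD//; last 2 first.
- by apply: integrable_eball; cts.
- by apply: integrable_eball; cts.
rewrite RintegralZl//; last exact: integrable_eball.
rewrite ball_kernel_mass// Rintegral_cst// -/m /e'.
have -> : e / (m + 1) / 2 * m + e / (m + 1) / 2 * m = e * (m / (m + 1)).
  by field; rewrite gt_eqF// ltr_wpDl.
by rewrite ger_pMr// ler_pdivrMr ?mul1r ?lerDl// ltr_wpDl.
Qed.

(** With [t = doubling_scale] and [q = t * s ^ 2], the kernel is at most [(1 + 1 / t) ^ 2]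
    everywhere. Outside the ball of radius [s / 4] it is at most [(1 + t) ^ 2 * t * 16 ^ 3 = (1 + t)
    ^ 2 / 4], which is below [1 / 2]. *)
Definition doubling_scale : R := 16^-1 ^+ 3 / 4.
Definition doubling_const : R := 2 * (1 + doubling_scale^-1) ^+ 2.

(** Here [q] is kept comparable to [s ^ 2] in [superharmonic_kernel] instead of tending to 0.
    Outside the quarter ball the kernel is at most [1 / 2] and [h] is nonnegative, so this part of
    the right-hand side is absorbed by the left-hand side at the cost of a factor 2. *)
Lemma superharmonic_doubling h h1 h2 : slice_C2 h h1 h2 ->
  (forall x, B x -> 0 <= h x) -> (forall x, B x -> \sum_i h2 i x <= 0) ->
  \int[@mu4 R]_(x in B) h x <=
  doubling_const * \int[@mu4 R]_(x in eball c (s / 4)) h x.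
Proof.
move=> hC2 h0 h_super; have [ch _ _ _ _] := hC2.
have [t [tE t0 t4 tt]] : exists t, [/\ doubling_scale = t, 0 < t, t <= 1 / 4 &
    4 * t = 16^-1 ^+ 3].
  have i0 : 0 < (16^-1 : R) by rewrite invr_gt0 ltr0n.
  have i1 : (16^-1 : R) <= 1 by rewrite invf_le1 ?ltr0n// ler1n.
  exists doubling_scale; rewrite /doubling_scale; split.
  - by [].
  - by apply: divr_gt0; [exact: exprn_gt0|rewrite ltr0n].
  - rewrite ler_pM2r; last by rewrite invr_gt0 ltr0n.
    by apply: exprn_ile1; [exact: ltW|].
  - by field.
pose q := S * t; have S0 : 0 < S by rewrite exprn_gt0.
have q0 : 0 < q by rewrite mulr_gt0.
have ck : continuous (ball_kernel c s q) by exact: continuous_ball_kernel.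
have s40 : 0 < s / 4 by rewrite divr_gt0.
pose B' := eball c (s / 4).
have mB' : measurable (B' : set (T4 R)) := measurable_eball c (s / 4).
have B'B : B' `<=` B.
  by apply: eballS; rewrite enormB /sqd sum4E !subrr expr0n !addr0 sqrtr0 add0r; lra.
have sg x := sqd_ge0 c x.
have t1 : t^-1 * t = 1 by rewrite mulVf// gt_eqF.
have k_in x : ball_kernel c s q x <= (1 + t^-1) ^+ 2.
  rewrite /ball_kernel -/S ler_pdivrMr; last by rewrite exprn_gt0// ltr_wpDl.
  apply: (@le_trans _ _ ((1 + t^-1) ^+ 2 * q ^+ 3)).
    rewrite le_eqVlt; apply/orP; left; apply/eqP; rewrite /q; field.
    by rewrite gt_eqF.
  apply: ler_wpM2l; first exact: sqr_ge0.
  by apply: lerXn2r; rewrite ?nnegrE ?addr_ge0 ?(ltW q0)// lerDr.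
have k_out x : ~ B' x -> ball_kernel c s q x <= 1 / 2.
  rewrite /B' eballE// => /negP; rewrite -leNgt => xS.
  rewrite /ball_kernel -/S ler_pdivrMr; last by rewrite exprn_gt0// ltr_wpDl.
  apply: (@le_trans _ _ (1 / 2 * (S / 16) ^+ 3)).
    have -> : (S + q) ^+ 2 * q = S ^+ 3 * ((1 + t) ^+ 2 * t) by rewrite /q; ring.
    have -> : 1 / 2 * (S / 16) ^+ 3 = S ^+ 3 * (1 / 2 * 16^-1 ^+ 3) by ring.
    apply: ler_wpM2l; first exact: exprn_ge0 (ltW S0).
    by rewrite -tt; nra.
  apply: ler_wpM2l; first by rewrite divr_ge0.
  apply: lerXn2r; rewrite ?nnegrE ?addr_ge0 ?divr_ge0 ?(ltW q0) ?(ltW S0)//.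
  apply: ler_wpDr; first exact: ltW.
  have -> : S / 16 = (s / 4) ^+ 2 by rewrite /S; field.
  exact: xS.
have I1 (f : R4 R -> R) : continuous f -> (@mu4 R).-integrable B (EFin \o f).
  exact: integrable_eball.
have IB' : (@mu4 R).-integrable B (EFin \o (h \_ B')).
  rewrite -restrict_EFin; apply/integrable_restrict => //.
  by rewrite setIidr//; exact: integrable_eball.
have -> : \int[@mu4 R]_(x in eball c (s / 4)) h x = \int[@mu4 R]_(x in B) (h \_ B') x.
  by rewrite -Rintegral_mkcondr setIidr.
have := superharmonic_kernel s0 hC2 h_super q0.
rewrite -/B => /le_trans H.
have {}H : \int[@mu4 R]_(x in B) h x <=
  \int[@mu4 R]_(x in B) (1 / 2 * h x) + \int[@mu4 R]_(x in B) ((1 + t^-1) ^+ 2 * (h \_ B') x).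
  apply: H; rewrite -RintegralD//; last 2 first.
  - by apply: (I1 (fun x => 1 / 2 * h x)); cts.
  - rewrite (_ : _ \o _ = fun x => ((1 + t^-1) ^+ 2)%:E * (EFin \o (h \_ B')) x)%E//.
    exact: integrableZl.
  apply: le_Rintegral => //.
  - by apply: (I1 (fun x => h x * ball_kernel c s q x)); cts.
  - rewrite (_ : _ \o _ = (fun x => (EFin \o (fun x => 1 / 2 * h x)%R) x +
       ((1 + t^-1) ^+ 2)%:E * (EFin \o (h \_ B')) x)%E)//.
    apply: integrableD => //; first by apply: (I1 (fun x => 1 / 2 * h x)); cts.
    exact: integrableZl.
  - move=> x Bx; rewrite patchE; case: ifPn => [xB'|].
      rewrite [_ * h x in leRHS]mulrC [h x * _]mulrC.
      apply: (@le_trans _ _ ((1 + t^-1) ^+ 2 * h x)).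
        by apply: ler_wpM2r; [exact: h0|exact: k_in].
      by rewrite lerDr mulr_ge0// h0.
    rewrite notin_setE => /k_out xk; rewrite mulr0 addr0 mulrC.
    by apply: ler_wpM2r => //; exact: h0.
move: H; rewrite !RintegralZl//; last exact: I1.
rewrite /doubling_const tE.
set X := \int[mu4]_(x in B) h x; set Y := \int[mu4]_(x in B) _ x.
clearbody X Y; rewrite -[2 * _ * Y]mulrA; move: (_ * Y) => z; lra.
Qed.

End mean_value_limit.

(** * Mollification of supersolutions *)

Section bumplike.
Variable R : realType.
Implicit Types a : R -> R.

(** Unlike [normalized_bump], this class is closed under derivation, so it also contains the factors
    of the differentiated kernels. *)
Definition bumplike a :=
  (forall k, C1k k a) /\ exists e, forall t, e <= `|t| -> a t = 0.

Lemma bumplike_derive a (t : R) : bumplike a -> is_derive t 1 a (derive1 a t).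
Proof.
move=> [/(_ 1%N)[g ag _] _]; rewrite derive1E.
by have ? := ag t; rewrite derive_val.
Qed.

Lemma bumplike_derive1 a : bumplike a -> bumplike (derive1 a).
Proof.
move=> ba; have [Ca [e a0]] := ba; split.
  move=> k; have [g ag Cg] := Ca k.+1.
  suff -> : (derive1 a) = g by [].
  by apply/funext => t; rewrite derive1E; have ? := ag t; rewrite derive_val.
exists (e + 1) => t et; rewrite derive1E.
have H : is_derive t 1 a 0.
  apply: (@near_eq_is_derive R R^o R^o (fun _ : R => 0)).
  near=> s; rewrite a0//.
  have : `|t - s| < 1 by near: s; apply: nbhsx_ballx; exact: ltr01.
  move=> ts; have : `|t| <= `|s| + `|t - s| by rewrite -{1}(subrKC s t) ler_normD.
  by move: ts et; lra.
by rewrite derive_val.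
Unshelve. all: end_near.
Qed.

Lemma bumplike_continuous a : bumplike a -> continuous a.
Proof. by move=> [/(_ 0%N)]. Qed.

Lemma bumplike_bounded a : bumplike a -> exists2 M, 1 <= M & forall t, `|a t| <= M.
Proof.
move=> ba; have [_ [e a0]] := ba; have ca := bumplike_continuous ba.
have /compact_bounded[M [Mr HM]] : compact (a @` `[- e, e]).
  by apply: continuous_compact; [exact: continuous_subspaceT|exact: segment_compact].
exists (`|M| + 1); first by rewrite lerDr.
move=> t; have [te|te] := leP e `|t|; first by rewrite a0// normr0 addr_ge0.
apply: HM; first by rewrite (le_lt_trans (ler_norm _))// ltrDl.
by exists t => //=; rewrite in_itv/= -ler_norml ltW.
Qed.

Lemma bumplike_lipschitz a : bumplike a ->
  exists2 L, 1 <= L & forall s t, `|a s - a t| <= L * `|s - t|.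
Proof.
move=> ba; have [L L1 HL] := bumplike_bounded (bumplike_derive1 ba).
exists L => // s t; wlog st : s t / t <= s.
  by move=> H; have [/H//|/ltW/H] := leP t s; rewrite distrC [`|t - s|]distrC.
have [|| c _ ->] := @MVT_segment R a (derive1 a) t s st.
- by move=> z _; exact: bumplike_derive.
- exact/continuous_subspaceT/bumplike_continuous.
by rewrite normrM ler_wpM2r.
Qed.

Lemma normalized_bumplike (e : R) a : normalized_bump e a -> bumplike a.
Proof. by move=> [Ca _ a0 _ _]; split => //; exists e. Qed.

End bumplike.

(** * Product kernels and convolution with them *)

Section product_kernel.
Variable R : realType.
Implicit Types (a : 'I_4 -> R -> R) (x y : R4 R) (i j : 'I_4).

(** The factors may differ from one coordinate to another so that partial derivatives keep this
    form: [deriv_factor i] differentiates the [i]-th factor only. A derivative in the centre [x]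
    brings a sign, one in [y] does not. *)
Definition tensor_ker a x y := \prod_j a j (coord4 j y - coord4 j x).

Definition deriv_factor i a : 'I_4 -> R -> R := fun j => if j == i then derive1 (a j) else a j.

Lemma bumplike_deriv_factor i a : (forall j, bumplike (a j)) -> forall j, bumplike (deriv_factor i a j).
Proof. by move=> ba j; rewrite /deriv_factor; case: ifP => // _; exact: bumplike_derive1. Qed.

Lemma tensor_ker_upd4_r i a x y (t : R) : tensor_ker a x (upd4 i t y) =
  a i (t - coord4 i x) * \prod_(j | j != i) a j (coord4 j y - coord4 j x).
Proof.
rewrite /tensor_ker (bigD1 i)//= coord4_upd4 eqxx; congr (_ * _).
by apply: eq_bigr => j ji; rewrite coord4_upd4 (negbTE ji).
Qed.

Lemma tensor_ker_upd4_l i a x y (t : R) : tensor_ker a (upd4 i t x) y =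
  a i (coord4 i y - t) * \prod_(j | j != i) a j (coord4 j y - coord4 j x).
Proof.
rewrite /tensor_ker (bigD1 i)//= coord4_upd4 eqxx; congr (_ * _).
by apply: eq_bigr => j ji; rewrite coord4_upd4 (negbTE ji).
Qed.

Lemma deriv_factorE i a : deriv_factor i a i = derive1 (a i).
Proof. by rewrite /deriv_factor eqxx. Qed.

Lemma prod_deriv_factor i a (F : 'I_4 -> R) :
  \prod_(j | j != i) deriv_factor i a j (F j) = \prod_(j | j != i) a j (F j).
Proof. by apply: eq_bigr => j ji; rewrite /deriv_factor (negbTE ji). Qed.

Lemma is_derive_tensor_ker_r i a x y (t : R) : (forall j, bumplike (a j)) ->
  is_derive t 1 (fun t : R => tensor_ker a x (upd4 i t y))
    (tensor_ker (deriv_factor i a) x (upd4 i t y)).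
Proof.
move=> ba; under eq_fun do rewrite tensor_ker_upd4_r.
rewrite tensor_ker_upd4_r prod_deriv_factor deriv_factorE; set p := \prod_(j | _) _.
have d1 : is_derive t 1 (fun t : R => t - coord4 i x) 1.
  by have := is_derive1B (is_derive1_id t) (is_derive1_cst t (coord4 i x)); rewrite subr0.
have d2 := @is_derive1_comp_ext R t (a i) (fun t : R => t - coord4 i x) _ _
  (bumplike_derive _ (ba i)) d1.
apply: is_derive_eq (is_derive1M d2 (is_derive1_cst t p)) _.
by rewrite mulr0 addr0 mulr1.
Qed.

Lemma is_derive_tensor_ker_l i a x y (t : R) : (forall j, bumplike (a j)) ->
  is_derive t 1 (fun t : R => tensor_ker a (upd4 i t x) y)
    (- tensor_ker (deriv_factor i a) (upd4 i t x) y).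
Proof.
move=> ba; under eq_fun do rewrite tensor_ker_upd4_l.
rewrite tensor_ker_upd4_l prod_deriv_factor deriv_factorE; set p := \prod_(j | _) _.
have d1 : is_derive t 1 (fun t : R => coord4 i y - t) (- 1).
  by have := is_derive1B (is_derive1_cst t (coord4 i y)) (is_derive1_id t); rewrite sub0r.
have d2 := @is_derive1_comp_ext R t (a i) (fun t : R => coord4 i y - t) _ _
  (bumplike_derive _ (ba i)) d1.
apply: is_derive_eq (is_derive1M d2 (is_derive1_cst t p)) _.
by rewrite mulr0 addr0 mulrN1 mulNr.
Qed.

Lemma is_derive_slice i (phi : R4 R -> R) y d :
  is_derive (coord4 i y) 1 (fun t : R => phi (upd4 i t y)) d ->
  is_derive y (evec R i) phi d.
Proof.
move=> H.
have E : (fun h : R => h^-1 *: ((phi \o shift y) (h *: evec R i) - phi y)) =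
   (fun h : R => h^-1 *: (((fun t : R => phi (upd4 i t y)) \o shift (coord4 i y)) (h *: 1)
     - phi (upd4 i (coord4 i y) y))).
  apply/funext => h; rewrite /= upd4_id; congr (_ *: (phi _ - _)).
  by rewrite addrC add_evec addrC; congr upd4; rewrite /GRing.scale/= mulr1.
have [D1 D2] := H.
apply: DeriveDef; first by move: D1; rewrite /derivable E.
by move: D2; rewrite /derive E.
Qed.

Lemma continuous_prod_fun (T : topologicalType) (F : 'I_4 -> T -> R) :
  (forall i, continuous (F i)) -> continuous (fun z => \prod_i F i z).
Proof.
move=> cF; under eq_fun do rewrite prod4E.
by do 3?[apply: continuousM_fun; last exact: cF]; exact: cF.
Qed.

Lemma continuous_tensor_ker_r a x : (forall j, bumplike (a j)) -> continuous (tensor_ker a x).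
Proof.
move=> ba; apply: continuous_prod_fun => j y.
apply: (@continuous_comp _ _ _ (fun y => coord4 j y - coord4 j x) (a j)).
  by have H : continuous (fun y : R4 R => coord4 j y - coord4 j x); [cts|exact: H].
exact: bumplike_continuous.
Qed.

Lemma smooth_tensor_ker a x : (forall j, bumplike (a j)) -> smooth (tensor_ker a x).
Proof.
move=> ba k; elim: k a ba => [|k IH] a ba; first exact: continuous_tensor_ker_r.
move=> i.
have H y : is_derive y (evec R i) (tensor_ker a x) (tensor_ker (deriv_factor i a) x y).
  by apply: is_derive_slice; have := is_derive_tensor_ker_r i x y (coord4 i y) ba; rewrite upd4_id.
split; first by move=> y; exact: ex_derive.
suff -> : (fun y => 'D_(evec R i) (tensor_ker a x) y) = tensor_ker (deriv_factor i a) x.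
  by apply: IH; exact: bumplike_deriv_factor.
by apply/funext => y; have ? := H y; rewrite derive_val.
Qed.

Lemma derive_tensor_ker i a x y : (forall j, bumplike (a j)) ->
  'D_(evec R i) (tensor_ker a x) y = tensor_ker (deriv_factor i a) x y.
Proof.
move=> ba; have ? : is_derive y (evec R i) (tensor_ker a x) (tensor_ker (deriv_factor i a) x y).
  by apply: is_derive_slice; have := is_derive_tensor_ker_r i x y (coord4 i y) ba; rewrite upd4_id.
by rewrite derive_val.
Qed.

Definition cbox x (e : R) : set (R4 R) := [set y | forall i, `|coord4 i y - coord4 i x| <= e].

Lemma compact_cbox x (e : R) : compact (cbox x e).
Proof.
have -> : cbox x e = ((`[x.1.1.1 - e, x.1.1.1 + e] `*` `[x.1.1.2 - e, x.1.1.2 + e])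
   `*` `[x.1.2 - e, x.1.2 + e]) `*` `[x.2 - e, x.2 + e].
  have E (u v : R) : `|u - v| <= e <-> u \in `[v - e, v + e] by rewrite in_itv/= ler_distl.
  apply/seteqP; split=> [[[[x1 x2] x3] x4] H|[[[x1 x2] x3] x4] [[[/E H1 /E H2] /E H3] /E H4]].
    have := H (@Ordinal 4 0 isT); have := H (@Ordinal 4 1 isT).
    have := H (@Ordinal 4 2 isT); have := H (@Ordinal 4 3 isT).
    by rewrite !coord4E/= => /E H4 /E H3 /E H2 /E H1.
  by apply: ord4P; rewrite !coord4E.
by do 3?[apply: compact_setX; last exact: segment_compact]; exact: segment_compact.
Qed.

Lemma closed_cbox x (e : R) : closed (cbox x e).
Proof.
have -> : cbox x e = \bigcap_i [set y | `|coord4 i y - coord4 i x| <= e].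
  by apply/seteqP; split => y H i; [move=> _|]; exact: H.
apply: closed_bigI => i _.
have -> : [set y | `|coord4 i y - coord4 i x| <= e] =
  (fun y => `|coord4 i y - coord4 i x|) @^-1` [set t | t <= e] by [].
apply: closed_comp; last exact: closed_le.
move=> y _; apply: (@continuous_comp _ _ _ (fun y => coord4 i y - coord4 i x) (fun t : R => `|t|)).
  by have H : continuous (fun y : R4 R => coord4 i y - coord4 i x); [cts|exact: H].
exact: norm_continuous.
Qed.

Lemma tensor_ker_eq0 a (e : R) x y : (forall j t, e <= `|t| -> a j t = 0) -> ~ box x e y ->
  tensor_ker a x y = 0.
Proof.
move=> a0 /existsNP[i /negP]; rewrite -leNgt => H.
by rewrite /tensor_ker (bigD1 i)//= a0// mul0r.
Qed.

Lemma test_function_tensor_ker (U : set (R4 R)) a (e : R) x : (forall j, bumplike (a j)) ->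
  (forall j t, e <= `|t| -> a j t = 0) -> cbox x e `<=` U ->
  test_function U (tensor_ker a x).
Proof.
move=> ba a0 xU.
have sub : closure [set y | tensor_ker a x y != 0] `<=` cbox x e.
  rewrite [X in _ `<=` X](closure_id (cbox x e)).1; last exact: closed_cbox.
  apply: closureS => y /= /eqP yx i; apply: ltW; move: i.
  by apply: contra_notP yx; exact: tensor_ker_eq0.
split; [exact: smooth_tensor_ker| |exact: subset_trans xU].
by apply: subclosed_compact sub; [exact: closed_closure|exact: compact_cbox].
Qed.

End product_kernel.

Section integrable_fun.
Context d (T : measurableType d) (R : realType) (mu : {measure set T -> \bar R}).
Variables (D : set T) (mD : measurable D).
Implicit Types f g : T -> R.

Lemma integrableD_fun f g : mu.-integrable D (EFin \o f) ->
  mu.-integrable D (EFin \o g) -> mu.-integrable D (EFin \o (fun x => f x + g x)).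
Proof. by move=> If Ig; exact: (integrableD mD If Ig). Qed.

Lemma integrableB_fun f g : mu.-integrable D (EFin \o f) ->
  mu.-integrable D (EFin \o g) -> mu.-integrable D (EFin \o (fun x => f x - g x)).
Proof. by move=> If Ig; exact: (integrableB mD If Ig). Qed.

Lemma integrableZl_fun k f : mu.-integrable D (EFin \o f) ->
  mu.-integrable D (EFin \o (fun x => k * f x)).
Proof. by move=> If; exact: (integrableZl mD k If). Qed.

End integrable_fun.

Section kernel_integrals.
Variable R : realType.
Implicit Types (a : 'I_4 -> R -> R) (x y : R4 R) (i j : 'I_4).

Lemma bumplike_family_bound a : (forall j, bumplike (a j)) -> exists2 N : R, 1 <= N &
  forall j, (forall t, `|a j t| <= N) /\ (forall s t, `|a j s - a j t| <= N * `|s - t|).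
Proof.
move=> ba.
have /choice[M HM] : forall j, exists M : R, 1 <= M /\ forall t, `|a j t| <= M.
  by move=> j; have [M ? ?] := bumplike_bounded (ba j); exists M.
have /choice[L HL] : forall j, exists L : R, 1 <= L /\
    forall s t, `|a j s - a j t| <= L * `|s - t|.
  by move=> j; have [L ? ?] := bumplike_lipschitz (ba j); exists L.
have ML0 j : 0 <= M j + L j.
  by rewrite addr_ge0// (le_trans ler01)//; [have [] := HM j|have [] := HL j].
have le_sum j : M j + L j <= \sum_k (M k + L k).
  by rewrite (bigD1 j)//= lerDl sumr_ge0.
have M0 j : 0 <= M j by rewrite (le_trans ler01)//; have [] := HM j.
have L0 j : 0 <= L j by rewrite (le_trans ler01)//; have [] := HL j.
exists (\sum_k (M k + L k)).
  apply: le_trans (le_sum ord0); apply: le_trans (_ : M ord0 <= _); first by have [] := HM ord0.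
  by rewrite lerDl.
move=> j; split => [t|s t].
  have [_ /(_ t) H] := HM j; rewrite (le_trans H)// (le_trans _ (le_sum j))//.
  by rewrite lerDl.
have [_ /(_ s t) H] := HL j; rewrite (le_trans H)// ler_wpM2r// (le_trans _ (le_sum j))//.
by rewrite lerDr.
Qed.

Lemma tensor_ker_bounded a : (forall j, bumplike (a j)) ->
  exists2 M, 0 < M & forall x y, `|tensor_ker a x y| <= M.
Proof.
move=> /bumplike_family_bound[N N1 HN]; exists (N ^+ 4).
  by rewrite exprn_gt0// (lt_le_trans ltr01).
move=> x y; rewrite /tensor_ker normr_prod -[4%N in X in _ <= X](card_ord 4) -prodr_const.
by apply: ler_prod => j _; rewrite normr_ge0/=; exact: (HN j).1.
Qed.

Lemma tensor_ker_lipschitz a : (forall j, bumplike (a j)) -> exists2 L, 0 < L &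
  forall x x' y, `|tensor_ker a x y - tensor_ker a x' y| <= L * \sum_j `|coord4 j x - coord4 j x'|.
Proof.
move=> /bumplike_family_bound[N N1 HN]; exists (N ^+ 4).
  by rewrite exprn_gt0// (lt_le_trans ltr01).
move=> x x' y; have N0 : 0 <= N by rewrite (le_trans ler01).
pose p j := a j (coord4 j y - coord4 j x); pose q j := a j (coord4 j y - coord4 j x').
have pN j : `|p j| <= N by exact: (HN j).1.
have qN j : `|q j| <= N by exact: (HN j).1.
have pq j : `|p j - q j| <= N * `|coord4 j x - coord4 j x'|.
  have [_ H] := HN j; apply: le_trans (H _ _) _.
  by rewrite (_ : _ - _ - _ = - (coord4 j x - coord4 j x')) ?normrN//; ring.
have B3 (u v w : R) : `|u| <= N -> `|v| <= N -> `|w| <= N -> `|u * v * w| <= N ^+ 3.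
  move=> uN vN wN; rewrite !normrM exprSr ler_pM ?mulr_ge0//.
  by rewrite expr2 ler_pM.
have B4 j (u v w : R) : `|u| <= N -> `|v| <= N -> `|w| <= N ->
    `|(p j - q j) * (u * v * w)| <= N ^+ 4 * `|coord4 j x - coord4 j x'|.
  move=> uN vN wN; rewrite normrM [N ^+ 4]exprS [leRHS]mulrAC.
  by apply: ler_pM => //; exact: B3.
set j0 := @Ordinal 4 0 isT; set j1 := @Ordinal 4 1 isT.
set j2 := @Ordinal 4 2 isT; set j3 := @Ordinal 4 3 isT.
rewrite /tensor_ker !prod4E sum4E -/j0 -/j1 -/j2 -/j3 -/(p _) -/(p _) -/(p _) -/(p _).
rewrite -/(q _) -/(q _) -/(q _) -/(q _) !mulrDr.
have -> : p j0 * p j1 * p j2 * p j3 - q j0 * q j1 * q j2 * q j3 =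
  (p j0 - q j0) * (p j1 * p j2 * p j3) + (p j1 - q j1) * (q j0 * p j2 * p j3) +
  (p j2 - q j2) * (q j0 * q j1 * p j3) + (p j3 - q j3) * (q j0 * q j1 * q j2) by ring.
do 3?[apply: le_trans (ler_normD _ _) _; apply: lerD; last exact: B4].
exact: B4.
Qed.

Variable V : R4 R -> R.
Hypothesis intV : (@mu4 R).-integrable setT (EFin \o V).

(** [V] is integrable on the whole space, so that its mollification is smooth at every point. Only
    the differential inequality is restricted to points away from the boundary of the domain. *)
Definition ker_int a x := \int[@mu4 R]_y (V y * tensor_ker a x y).

Lemma integrable_Vtensor_ker a x : (forall j, bumplike (a j)) ->
  (@mu4 R).-integrable setT (EFin \o (fun y => V y * tensor_ker a x y)).
Proof.
move=> ba; have [M M0 HM] := tensor_ker_bounded ba.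
apply: (@le_integrable _ _ _ (@mu4 R) setT _ _ (EFin \o (fun y => M * V y))) => //.
- apply/measurable_EFinP; apply: measurable_funM.
    by apply/measurable_EFinP; case/integrableP: intV.
  by apply: continuous_measurable4; exact: continuous_tensor_ker_r.
- move=> y _; rewrite lee_fin/= normrM [leRHS]normrM mulrC.
  by rewrite ler_wpM2r// (le_trans (HM x y))// ler_norm.
- exact: integrableZl_fun.
Qed.

Lemma continuous_ker_int a : (forall j, bumplike (a j)) -> continuous (ker_int a).
Proof.
move=> ba; have [L L0 HL] := tensor_ker_lipschitz ba.
pose m := \int[@mu4 R]_y `|V y|.
have m0 : 0 <= m by exact: Rintegral_ge0.
have absV : (@mu4 R).-integrable setT (EFin \o (fun y => `|V y|)) by exact: integrable_norm.
have key x x' : `|ker_int a x - ker_int a x'| <= m * L * \sum_j `|coord4 j x - coord4 j x'|.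
  rewrite /ker_int -RintegralB//; try exact: integrable_Vtensor_ker.
  have I2 : (@mu4 R).-integrable setT
      (EFin \o (fun y => V y * tensor_ker a x y - V y * tensor_ker a x' y)).
    by apply: integrableB_fun => //; exact: integrable_Vtensor_ker.
  apply: le_trans (le_normr_Rintegral _ I2) _ => //.
  rewrite -mulrA mulrC -RintegralZl//; apply: le_Rintegral => //.
  - exact: integrable_norm.
  - exact: integrableZl_fun.
  - by move=> y _; rewrite -mulrBr normrM mulrC ler_wpM2r.
move=> x; apply/cvgrPdist_lt => e e0.
pose d := e / (m * L * 4 + 1).
have mL : 0 <= m * L by rewrite mulr_ge0// ltW.
have d0 : 0 < d by rewrite divr_gt0// ltr_wpDl// mulr_ge0.
have H i : \forall y \near x, `|coord4 i x - coord4 i y| < d.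
  by have /cvgrPdist_lt/(_ _ d0) := @continuous_coord4 R i x.
near=> y; apply: le_lt_trans (key _ _) _.
have Hi i : `|coord4 i x - coord4 i y| <= d.
  apply: ltW; move: i; apply: ord4P; near: y; exact: H.
apply: (@le_lt_trans _ _ (m * L * (d * 4))).
  rewrite ler_wpM2l// sum4E.
  by rewrite (_ : d * 4 = d + d + d + d); [rewrite !lerD|ring].
have A1 : 0 < m * L * 4 + 1 by rewrite ltr_wpDl// mulr_ge0.
have -> : m * L * (d * 4) = e * (m * L * 4 / (m * L * 4 + 1)).
  by rewrite /d; field; rewrite gt_eqF.
by rewrite gtr_pMr// ltr_pdivrMr// mul1r ltrDl.
Unshelve. all: end_near.
Qed.

Lemma is_derive_ker_int i a x (t : R) : (forall j, bumplike (a j)) ->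
  is_derive t 1 (fun t : R => ker_int a (upd4 i t x)) (- ker_int (deriv_factor i a) (upd4 i t x)).
Proof.
move=> ba; have bd := bumplike_deriv_factor i ba.
have [M M0 HM] := tensor_ker_bounded bd.
pose f (t : R) (y : T4 R) := V y * tensor_ker a (upd4 i t x) y.
have df y (s : R) : is_derive s 1 (f ^~ y) (- (V y * tensor_ker (deriv_factor i a) (upd4 i s x) y)).
  by have := is_derive1Zl (V y) (is_derive_tensor_ker_l i x y s ba); rewrite mulrN.
have d1E s y : partial1of2 f s y = - (V y * tensor_ker (deriv_factor i a) (upd4 i s x) y).
  by rewrite partial1of2E; have ? := df y s; rewrite derive_val.
have intf s : `]t - 1, t + 1[%classic s -> (@mu4 R).-integrable setT (EFin \o f s).
  by move=> _; exact: integrable_Vtensor_ker.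
have It : `]t - 1, t + 1[%classic t by rewrite /= in_itv/= ltrBlDr !ltrDl ltr01.
have derf s y : `]t - 1, t + 1[%classic s -> [set: T4 R] y -> derivable (f ^~ y) s 1.
  by move=> _ _; apply: ex_derive; exact: df.
have G0 y : 0 <= `|V y| * M by rewrite mulr_ge0// ltW.
have intG : (@mu4 R).-integrable setT (EFin \o (fun y => `|V y| * M)).
  under [_ \o _]eq_fun do rewrite /= mulrC EFinM.
  by apply: integrableZl => //; exact: integrable_norm.
have G_ub s y : `]t - 1, t + 1[%classic s -> [set: T4 R] y ->
    `|partial1of2 f s y| <= `|V y| * M.
  by move=> _ _; rewrite d1E normrN normrM ler_wpM2l.
have D := derivable_under_integral measurableT It intf derf G0 intG G_ub.
have E := differentiation_under_integral measurableT It intf derf G0 intG G_ub.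
apply: DeriveDef => //; rewrite -derive1E.
apply: etrans E _; rewrite /ker_int.
under eq_Rintegral do rewrite d1E -mulN1r.
by rewrite RintegralZl ?mulN1r//; exact: integrable_Vtensor_ker.
Qed.

Lemma slice_C2_ker_int a : (forall j, bumplike (a j)) ->
  slice_C2 (ker_int a) (fun i x => - ker_int (deriv_factor i a) x)
    (fun i x => ker_int (deriv_factor i (deriv_factor i a)) x).
Proof.
move=> ba; have bd i := bumplike_deriv_factor i ba; split.
- exact: continuous_ker_int.
- by move=> i; apply: continuousN_fun; exact: continuous_ker_int.
- by move=> i; apply: continuous_ker_int; exact: bumplike_deriv_factor.
- by move=> i x t; exact: is_derive_ker_int.
- move=> i x t; rewrite -[ker_int _ _]opprK; apply: is_derive1N.
  exact: is_derive_ker_int.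
Qed.

End kernel_integrals.

Section ae.
Variables (R : realType).
Implicit Types (P Q : R4 R -> Prop).

Lemma ae4S P Q : (forall x, P x -> Q x) ->
  {ae (@mu4 R), forall x, P x} -> {ae (@mu4 R), forall x, Q x}.
Proof.
by move=> PQ; apply: (@filterS _ _ (ae_filter_ringOfSetsType (@mu4 R)) _ _ PQ).
Qed.

Lemma ae4I P Q : {ae (@mu4 R), forall x, P x} -> {ae (@mu4 R), forall x, Q x} ->
  {ae (@mu4 R), forall x, P x /\ Q x}.
Proof.
by move=> aP aQ; apply: (@filterI _ _ (ae_filter_ringOfSetsType (@mu4 R)) _ _ aP aQ).
Qed.

End ae.

Section square_integrable.
Variables (R : realType) (U : set (R4 R)).
Hypotheses (mU : measurable (U : set (T4 R))) (Uoo : (mu4 (U : set (T4 R)) < +oo)%E).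

Lemma in_Lp2_integrable_sqr (g : R4 R -> R) : in_Lp U 2 g ->
  (@mu4 R).-integrable U (EFin \o (fun x => g x ^+ 2)).
Proof.
move=> [mg Loo]; apply/integrableP; split.
  by apply/measurable_EFinP; apply: measurable_funX.
have : ((Lp_norm U 2 g) `^ 2 < +oo)%E.
  have : (0 <= Lp_norm U 2 g)%E by exact: Lnorm_ge0.
  by move: Loo; case: Lp_norm => // r _ _; rewrite poweR_EFin ltry.
rewrite /Lp_norm poweR_Lnorm ?pnatr_eq0//; apply: le_lt_trans.
rewrite le_eqVlt [X in X == _]integral_mkcond; apply/orP; left; apply/eqP.
apply: eq_integral => x _; rewrite /= !patchE; case: ifP => xU /=.
  by rewrite powR_mulrn// normrX.
by rewrite normr0 powR0// pnatr_eq0.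
Qed.

Lemma integrable_sqr_integrable (g : R4 R -> R) : measurable_fun U (g : T4 R -> measurableTypeR R) ->
  (@mu4 R).-integrable U (EFin \o (fun x => g x ^+ 2)) ->
  (@mu4 R).-integrable U (EFin \o g).
Proof.
move=> mg ig; apply: (@le_integrable _ _ _ (@mu4 R) U mU _ (EFin \o (fun x => 1 + g x ^+ 2))).
- exact/measurable_EFinP.
- move=> x _; rewrite lee_fin [leRHS]ger0_norm ?addr_ge0 ?sqr_ge0//.
  by rewrite -(real_normK (num_real (g x))); nra.
- apply: integrableD_fun => //; apply/integrableP; split; first exact: measurable_cst.
  by rewrite integral_cst//= normr1 mul1e.
Qed.

End square_integrable.

Section mollified.
Variables (R : realType) (U : set (R4 R)).
Hypotheses (mU : measurable (U : set (T4 R))) (Uoo : (mu4 (U : set (T4 R)) < +oo)%E).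
Variables (e : R) (rho : R -> R).
Hypotheses (e0 : 0 < e) (hrho : normalized_bump e rho).
Implicit Types (x y : R4 R) (i : 'I_4).

(** The strict inequality leaves room for a neighbourhood on which [a] vanishes. This is why the
    derivatives of a bump of radius [e] are later handled with boxes of half-side [2 * e]. *)
Lemma derive1_support (a : R -> R) (b : R) : (forall t, b < `|t| -> a t = 0) ->
  forall t, b < `|t| -> derive1 a t = 0.
Proof.
move=> a0 t bt; rewrite derive1E.
have H : is_derive t 1 a 0.
  apply: (@near_eq_is_derive R R^o R^o (fun _ : R => 0)).
  near=> s; rewrite a0//.
  have : `|t - s| < `|t| - b by near: s; apply: nbhsx_ballx; rewrite subr_gt0.
  move=> ts; have : `|t| <= `|s| + `|t - s| by rewrite -{1}(subrKC s t) ler_normD.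
  by move: ts; lra.
by rewrite derive_val.
Unshelve. all: end_near.
Qed.

Lemma deriv_factor_support i (a : 'I_4 -> R -> R) (b : R) :
  (forall j t, b < `|t| -> a j t = 0) -> forall j t, b < `|t| -> deriv_factor i a j t = 0.
Proof.
move=> ab j t bt; rewrite /deriv_factor; case: ifP => _; last exact: ab.
exact: (derive1_support (ab j) bt).
Qed.

Definition rhos : 'I_4 -> R -> R := fun=> rho.

Lemma bumplike_rhos i : bumplike (rhos i).
Proof. exact: normalized_bumplike hrho. Qed.

Lemma rhos_support i t : e <= `|t| -> rhos i t = 0.
Proof. by have [_ _ H _ _] := hrho; exact: H. Qed.

Lemma rhos_support_lt i t : e < `|t| -> rhos i t = 0.
Proof. by move=> et; apply: rhos_support; exact: ltW. Qed.

Lemma lt2e (t : R) : 2 * e <= `|t| -> e < `|t|.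
Proof. by move: e0; lra. Qed.

Lemma integrable_tensor_ker a x : (forall j, bumplike (a j)) ->
  (@mu4 R).-integrable setT (EFin \o tensor_ker a x).
Proof.
move=> ba.
have /choice[E HE] : forall j, exists E : R, forall t, E <= `|t| -> a j t = 0.
  by move=> j; have [_] := ba j.
pose F := \sum_j `|E j| + 1.
have aF j t : F <= `|t| -> a j t = 0.
  move=> Ft; apply: HE; apply: le_trans Ft; rewrite /F (bigD1 j)//=.
  by rewrite -addrA (le_trans (ler_norm _))// lerDl addr_ge0// sumr_ge0.
have F0 : 0 < F by rewrite ltr_wpDl// sumr_ge0.
have -> : EFin \o tensor_ker a x = (EFin \o tensor_ker a x) \_ (eball x (2 * F)).
  apply/funext => y; rewrite patchE; case: ifPn => //.
  rewrite notin_setE => yF; rewrite /= (tensor_ker_eq0 aF)//.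
  by apply: contra_not yF => yF; apply: box_eball; rewrite ?mulr_gt0// mulrAC divff ?mul1r.
apply/integrable_restrict; [exact: measurable_eball|exact: measurableT|].
by rewrite setTI; apply: integrable_eball; exact: continuous_tensor_ker_r.
Qed.

(** The integrand is the [i]-th partial derivative in [y] of the compactly supported function
    [tensor_ker a x]. *)
Lemma integral_tensor_ker_deriv_factor i a x : (forall j, bumplike (a j)) ->
  \int[@mu4 R]_y tensor_ker (deriv_factor i a) x y = 0.
Proof.
move=> ba; have bd := bumplike_deriv_factor i ba.
rewrite /Rintegral (@integral_slice_eq0 _ i)//; first exact: integrable_tensor_ker.
move=> y; have [_ [E aE]] := ba i.
pose E1 := `|E| + 1; pose k := coord4 i x.
have E10 : 0 < E1 by rewrite ltr_wpDl.
have EE1 : E < E1 by rewrite (le_lt_trans (ler_norm _))// ltrDl.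
have dK (t : R) := is_derive_tensor_ker_r i x y t ba.
have cK : continuous (fun t : R => tensor_ker (deriv_factor i a) x (upd4 i t y)).
  move=> t; apply: (@continuous_comp _ _ _ (fun t : R => upd4 i t y) (tensor_ker (deriv_factor i a) x)).
    exact: continuous_upd4.
  exact: continuous_tensor_ker_r.
have z t : E1 <= `|t - k| -> tensor_ker a x (upd4 i t y) = 0.
  by move=> tE; rewrite tensor_ker_upd4_r aE ?mul0r// (le_trans (ltW EE1)).
transitivity (\int[@lebesgue_measure R]_(t in `[(k - E1)%R, (k + E1)%R])
    (tensor_ker (deriv_factor i a) x (upd4 i t y))%:E)%E.
  rewrite [RHS]integral_mkcond; apply: eq_integral => t _.
  rewrite patchE; case: ifPn => //; rewrite notin_setE/= in_itv/= -ler_distl.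
  move=> /negP; rewrite -ltNge => tE.
  rewrite tensor_ker_upd4_r deriv_factorE (@derive1_support _ E1) ?mul0r// => u uE.
  by apply: aE; rewrite (le_trans (ltW EE1))// ltW.
have lr : k - E1 < k + E1 by lra.
apply: etrans (FTC2_C1 lr cK (fun t _ => dK t)) _.
have n1 : E1 <= `|k + E1 - k| by rewrite addrAC subrr add0r ger0_norm// ltW.
have n2 : E1 <= `|k - E1 - k| by rewrite addrAC subrr add0r normrN ger0_norm// ltW.
by rewrite !z// subrr.
Qed.

Lemma tensor_ker_rhos_ge0 x y : 0 <= tensor_ker rhos x y.
Proof. by apply: prodr_ge0 => j _; have [_ H _ _ _] := hrho; exact: H. Qed.

Lemma integral_tensor_ker_rhos x : (\int[@mu4 R]_y (tensor_ker rhos x y)%:E = 1)%E.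
Proof.
have [Cr r0 _ _ r1] := hrho.
apply: (@integral_prod4 R (fun j t => rho (t - coord4 j x))) => // j.
apply: continuous_measurable_fun.
have := C1k_comp_affine 1 (- coord4 j x) (Cr 0%N) => /=.
by under eq_fun do rewrite mul1r.
Qed.

Lemma integral_tensor_ker_rhos_l y : (\int[@mu4 R]_x (tensor_ker rhos x y)%:E = 1)%E.
Proof.
rewrite -[RHS](integral_tensor_ker_rhos y); apply: eq_integral => x _; congr (_%:E).
by apply: eq_bigr => j _; rewrite /rhos -[LHS](let: And5 _ _ _ H _ := hrho in H _) opprB.
Qed.

Lemma Rintegral_support x (a : 'I_4 -> R -> R) (b : R) (g : R4 R -> R) :
  (forall j t, b <= `|t| -> a j t = 0) -> box x b `<=` U ->
  \int[@mu4 R]_(y in U) (g y * tensor_ker a x y) = \int[@mu4 R]_y (g y * tensor_ker a x y).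
Proof.
move=> ab bU; rewrite Rintegral_mkcond; apply: eq_Rintegral => y _.
rewrite patchE; case: ifPn => // /negP yU; rewrite (tensor_ker_eq0 ab) ?mulr0//.
by move=> /bU yx; apply: yU; rewrite inE.
Qed.

Variables (w : R4 R -> R) (Dw : R4 R -> 'rV[R]_4) (D2w : R4 R -> 'M[R]_4).
Hypothesis hW : W22 U w Dw D2w.
Hypothesis super : {ae (@mu4 R), forall y, U y ->
  \sum_i D2w y i i + \sum_i (Dw y 0 i) ^+ 2 <= 0}.
Variables (k : R) (V : R4 R -> R).
Hypothesis intV : (@mu4 R).-integrable setT (EFin \o V).
Hypothesis Vw : {ae (@mu4 R), forall y, U y -> V y = w y - k}.

Variable x : R4 R.
Hypothesis xU : cbox x (2 * e) `<=` U.

Let boxU b : b <= 2 * e -> box x b `<=` U.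
Proof. by move=> be y yb; apply: xU => i; rewrite (le_trans _ be)// ltW//; exact: yb. Qed.

Let brho := bumplike_rhos.
Let bdrho i := bumplike_deriv_factor i brho.

Let integrable_gK (g : R4 R -> R) a : (forall j, bumplike (a j)) ->
  (@mu4 R).-integrable U (EFin \o g) ->
  (@mu4 R).-integrable U (EFin \o (fun y => g y * tensor_ker a x y)).
Proof.
move=> ba ig; have [M M0 HM] := tensor_ker_bounded ba.
apply: (@le_integrable _ _ _ (@mu4 R) U mU _ (EFin \o (fun y => M * g y))).
- apply/measurable_EFinP; apply: measurable_funM.
    by apply/measurable_EFinP; case/integrableP: ig.
  by apply: measurable_funTS; apply: continuous_measurable4; exact: continuous_tensor_ker_r.
- move=> y _; rewrite lee_fin/= normrM [leRHS]normrM mulrC.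
  by rewrite ler_wpM2r// (le_trans (HM x y))// ler_norm.
- exact: integrableZl_fun.
Qed.

(** The kernel is supported in [U], so only the values of [V] there matter, and it has mean zero, so
    the constant [k] drops out. *)
Let ker_intE i a b : (forall j, bumplike (a j)) -> b <= 2 * e ->
  (forall j t, b <= `|t| -> deriv_factor i a j t = 0) ->
  ker_int V (deriv_factor i a) x = \int[@mu4 R]_(y in U) (w y * tensor_ker (deriv_factor i a) x y).
Proof.
move=> ba be ab; have bd := bumplike_deriv_factor i ba.
have [iw _ _] := hW.
have mw : measurable_fun U (w : T4 R -> measurableTypeR R) by case: iw.
have Iw : (@mu4 R).-integrable U (EFin \o w).
  by apply: integrable_sqr_integrable => //; exact: in_Lp2_integrable_sqr.
have Ik : (@mu4 R).-integrable U (EFin \o (fun _ => k)).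
  by apply/integrableP; split; [exact: measurable_cst|rewrite integral_cst//= lte_mul_pinfty].
rewrite /ker_int -(Rintegral_support _ ab (boxU be)).
transitivity (\int[@mu4 R]_(y in U) ((w y - k) * tensor_ker (deriv_factor i a) x y)).
  congr fine; apply: ae_eq_integral => //.
  - apply: (measurable_int (@mu4 R)); apply: integrable_gK => //.
    exact: integrableS intV.
  - apply: (measurable_int (@mu4 R)); apply: (@integrable_gK (fun y => w y - k)) => //.
    exact: integrableB_fun.
  - by apply: ae4S Vw => y H Uy; rewrite /= H.
under eq_Rintegral do rewrite mulrBl.
rewrite RintegralB//; try exact: integrable_gK.
rewrite (Rintegral_support (fun=> k) ab (boxU be)) RintegralZl//.
  by rewrite integral_tensor_ker_deriv_factor// mulr0 subr0.
exact: integrable_tensor_ker.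
Qed.

Let test0 : test_function U (tensor_ker rhos x).
Proof.
apply: (test_function_tensor_ker (e := e)) => //; first exact: rhos_support.
by move=> y yx; apply: xU => i; rewrite (le_trans (yx i))//; move: e0; lra.
Qed.

Let s1 i j t : 2 * e <= `|t| -> deriv_factor i rhos j t = 0.
Proof. by move=> /lt2e; apply: deriv_factor_support; exact: rhos_support_lt. Qed.

Let s2 i j t : 2 * e <= `|t| -> deriv_factor i (deriv_factor i rhos) j t = 0.
Proof. by move=> /lt2e; do 2 apply: deriv_factor_support; exact: rhos_support_lt. Qed.

Let test1 i : test_function U (tensor_ker (deriv_factor i rhos) x).
Proof. by apply: (test_function_tensor_ker (e := 2 * e)) => //; exact: s1. Qed.

Let grad_ker_int i : - ker_int V (deriv_factor i rhos) x =
  \int[@mu4 R]_(y in U) (Dw y 0 i * tensor_ker rhos x y).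
Proof.
have [_ hDw _] := hW; have [_ /(_ _ test0)] := hDw i.
rewrite (ker_intE (b := 2 * e))//; last exact: s1.
move=> H; apply/eqP; rewrite eqr_oppLR; apply/eqP; rewrite -H.
by apply: eq_Rintegral => y _; rewrite derive_tensor_ker.
Qed.

Let hess_ker_int i : ker_int V (deriv_factor i (deriv_factor i rhos)) x =
  \int[@mu4 R]_(y in U) (D2w y i i * tensor_ker rhos x y).
Proof.
have [_ hDw hD2w] := hW; have [_ /(_ _ (test1 i)) H1] := hDw i.
have [_ /(_ _ test0) H2] := hD2w i i.
rewrite (ker_intE (b := 2 * e))//; last exact: s2.
have E1 : \int[@mu4 R]_(y in U) (w y * tensor_ker (deriv_factor i (deriv_factor i rhos)) x y) =
   - \int[@mu4 R]_(y in U) (Dw y 0 i * tensor_ker (deriv_factor i rhos) x y).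
  by rewrite -H1; apply: eq_Rintegral => y _; rewrite derive_tensor_ker.
rewrite E1; apply/eqP; rewrite eqr_oppLR; apply/eqP; rewrite -H2.
by apply: eq_Rintegral => y _; rewrite derive_tensor_ker.
Qed.

Let RintK : \int[@mu4 R]_(y in U) (tensor_ker rhos x y) = 1.
Proof.
under eq_Rintegral do rewrite -[tensor_ker _ _ _]mul1r.
rewrite (Rintegral_support (fun=> 1) rhos_support); last by apply: boxU; move: e0; lra.
by under eq_Rintegral do rewrite mul1r; rewrite /Rintegral integral_tensor_ker_rhos.
Qed.

(** The kernel centred at [x] and its first derivatives are test functions of [U], so the gradient
    and the pure second derivatives of the mollification are the averages of [Dw] and [D2w] against
    a probability density. Squaring an average gives at most the average of the square. *)
Lemma mollified_supersolution :
  \sum_i ker_int V (deriv_factor i (deriv_factor i rhos)) x +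
    \sum_i (- ker_int V (deriv_factor i rhos) x) ^+ 2 <= 0.
Proof.
have [_ hDw hD2w] := hW.
have IDw2 i : (@mu4 R).-integrable U (EFin \o (fun y => Dw y 0 i ^+ 2)).
  by apply: in_Lp2_integrable_sqr => //; exact: (hDw i).1.
have IDw i : (@mu4 R).-integrable U (EFin \o (fun y => Dw y 0 i)).
  by apply: integrable_sqr_integrable => //; exact: (hDw i).1.1.
have ID2w i : (@mu4 R).-integrable U (EFin \o (fun y => D2w y i i)).
  have [[mD LD] _] := hD2w i i.
  by apply: integrable_sqr_integrable => //; exact: in_Lp2_integrable_sqr.
have I1 : (@mu4 R).-integrable U (EFin \o (fun _ => 1)).
  by apply/integrableP; split; [exact: measurable_cst|rewrite integral_cst//= normr1 mul1e].
pose K := tensor_ker rhos x.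
have IK g : (@mu4 R).-integrable U (EFin \o g) ->
    (@mu4 R).-integrable U (EFin \o (fun y => g y * K y)).
  exact: integrable_gK.
have IK1 : (@mu4 R).-integrable U (EFin \o K).
  by apply: (integrableS _ _ _ (integrable_tensor_ker x brho)).
have jensen i : (- ker_int V (deriv_factor i rhos) x) ^+ 2 <=
    \int[@mu4 R]_(y in U) (Dw y 0 i ^+ 2 * K y).
  rewrite grad_ker_int -/K; set g := Rintegral _ _ _.
  have : 0 <= \int[@mu4 R]_(y in U) ((Dw y 0 i - g) ^+ 2 * K y).
    by apply: Rintegral_ge0 => y _; rewrite mulr_ge0 ?sqr_ge0 ?tensor_ker_rhos_ge0.
  have -> : \int[@mu4 R]_(y in U) ((Dw y 0 i - g) ^+ 2 * K y) =
     \int[@mu4 R]_(y in U) (Dw y 0 i ^+ 2 * K y + (- (2 * g) * (Dw y 0 i * K y) +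
        g ^+ 2 * K y)).
    by apply: eq_Rintegral => y _; ring.
  have J1 : (@mu4 R).-integrable U (EFin \o (fun y => - (2 * g) * (Dw y 0 i * K y))).
    by apply: integrableZl_fun => //; exact: IK.
  have J2 : (@mu4 R).-integrable U (EFin \o (fun y => g ^+ 2 * K y)).
    exact: integrableZl_fun.
  rewrite RintegralD//; first [exact: IK|exact: integrableD_fun|idtac].
  rewrite RintegralD// !RintegralZl//; first [exact: IK|exact: IK1|idtac].
  by rewrite RintK -/g; move: (\int[_]_(_ in _) _) => z; lra.
apply: (@le_trans _ _ (\sum_i \int[@mu4 R]_(y in U) (D2w y i i * K y) +
   \sum_i \int[@mu4 R]_(y in U) (Dw y 0 i ^+ 2 * K y))).
  apply: lerD; last by apply: ler_sum => i _; exact: jensen.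
  by apply: ler_sum => i _; rewrite hess_ker_int.
rewrite -big_split/=.
have IS i : (@mu4 R).-integrable U (EFin \o (fun y => D2w y i i * K y + Dw y 0 i ^+ 2 * K y)).
  by apply: integrableD_fun => //; apply: IK.
under eq_bigr => i _.
  rewrite -RintegralD//; first [exact: IK|over].
rewrite -(@Rintegral_sum4 _ (fun i y => D2w y i i * K y + Dw y 0 i ^+ 2 * K y))//.
pose G y := (\sum_i D2w y i i + \sum_i Dw y 0 i ^+ 2) * K y.
have FG y : \sum_i (D2w y i i * K y + Dw y 0 i ^+ 2 * K y) = G y.
  by rewrite /G mulrDl !mulr_suml -big_split.
under eq_Rintegral do rewrite FG.
have IG : (@mu4 R).-integrable U (EFin \o G).
  pose S i y := D2w y i i * K y + Dw y 0 i ^+ 2 * K y.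
  have -> : G = fun y => S (@Ordinal 4 0 isT) y + S (@Ordinal 4 1 isT) y +
      S (@Ordinal 4 2 isT) y + S (@Ordinal 4 3 isT) y.
    by apply/funext => y; rewrite -FG sum4E.
  exact: (integrableD_fun mU (integrableD_fun mU
    (integrableD_fun mU (IS _) (IS _)) (IS _)) (IS _)).
rewrite /Rintegral; apply: fine_le0.
(* The inequality [G <= 0] holds only almost everywhere, whereas the truncation of [G] at 0 has this
   sign everywhere. *)
rewrite (@ae_eq_integral _ _ _ (@mu4 R) U (fun y => (Num.min (G y) 0)%:E))//.
- under eq_integral do rewrite -[_%:E]oppeK.
  rewrite integral_ge0N ?oppe_le0 ?integral_ge0// => y _;
    by rewrite oppe_ge0 lee_fin ge_min lexx orbT.
- by case/integrableP: IG.
- apply/measurable_EFinP; apply: measurable_minr; last exact: measurable_cst.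
  by apply/measurable_EFinP; case/integrableP: IG.
- apply: ae4S super => y H Uy; congr EFin; apply/esym/min_idPl.
  by rewrite /G mulr_le0_ge0 ?tensor_ker_rhos_ge0 ?H.
Qed.

End mollified.

(** * Convergence in mean of the mollifications *)

Section oscillation.
Variables (R : realType) (Q : set (R4 R)).
Hypotheses (mQ : measurable (Q : set (T4 R))) (Qoo : (mu4 (Q : set (T4 R)) < +oo)%E).
Variable rho : nat -> R -> R.
Hypothesis hrho : forall n, normalized_bump (n.+1%:R^-1) (rho n).
Implicit Types (f g h : R4 R -> R) (x y : R4 R) (i : 'I_4).
Local Notation mfun4 f := (measurable_fun setT (f : T4 R -> measurableTypeR R)).

Let K n x y := tensor_ker (rhos (rho n)) x y.

Let K_ge0 n x y : 0 <= K n x y.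
Proof. exact: tensor_ker_rhos_ge0 (hrho n) _ _. Qed.

Lemma measurable_K2 n : measurable_fun setT
  ((fun z => K n z.1 z.2) : T4 R * T4 R -> measurableTypeR R).
Proof.
rewrite /K /tensor_ker; under eq_fun do rewrite prod4E.
have H j : measurable_fun setT
    ((fun z => rho n (coord4 j z.2 - coord4 j z.1)) : T4 R * T4 R -> measurableTypeR R).
  apply: (measurableT_comp (f := rho n : measurableTypeR R -> measurableTypeR R)).
    apply: continuous_measurable_fun; have [/(_ 0%N)] := hrho n; exact.
  apply: measurable_funB; exact: (measurableT_comp (measurable_coord4 _)).
by do 3?[apply: measurable_funM; last exact: H]; exact: H.
Qed.

(* The kernel is a probability density in each variable, so the integral of [osc]
   bounds the L^1 distance on [Q] between [f] and its mollification. *)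
Definition osc n f (z : R4 R * R4 R) : R :=
  `|f z.1 - f z.2| * K n z.1 z.2 * (\1_Q z.1 * \1_Q z.2).

Lemma osc_ge0 n f z : 0 <= osc n f z.
Proof. by rewrite !mulr_ge0. Qed.

Definition mean_osc n f : \bar R := (\int[@mu4 R \x @mu4 R]_z (osc n f z)%:E)%E.

Lemma measurable_indicQ : mfun4 (\1_Q : R4 R -> R).
Proof. exact: measurable_indic. Qed.

Lemma measurable_osc n f : mfun4 f ->
  measurable_fun setT (osc n f : T4 R * T4 R -> measurableTypeR R).
Proof.
move=> mf; rewrite /osc; apply: measurable_funM; first apply: measurable_funM.
- apply: measurableT_comp => //; apply: measurable_funB.
    exact: (measurableT_comp mf).
  exact: (measurableT_comp mf).
- exact: measurable_K2.
- apply: measurable_funM; exact: (measurableT_comp measurable_indicQ).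
Qed.

(** Comparing increments rather than functions covers, besides sums, the indicators of complements
    and unions. *)
Lemma mean_osc_le_add n f g h : mfun4 f -> mfun4 g -> mfun4 h ->
  (forall x y, `|f x - f y| <= `|g x - g y| + `|h x - h y|) ->
  (mean_osc n f <= mean_osc n g + mean_osc n h)%E.
Proof.
move=> mf mg mh fgh; rewrite /mean_osc -ge0_integralD//.
- apply: ge0_le_integral => //.
  + by move=> z _; rewrite lee_fin osc_ge0.
  + by apply/measurable_EFinP; exact: measurable_osc.
  + by apply: emeasurable_funD; apply/measurable_EFinP; exact: measurable_osc.
  + move=> z _; rewrite -EFinD lee_fin /osc -!mulrA -mulrDl ler_wpM2r//.
    by rewrite !mulr_ge0.
- by move=> z _; rewrite lee_fin osc_ge0.
- by apply/measurable_EFinP; exact: measurable_osc.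
- by move=> z _; rewrite lee_fin osc_ge0.
- by apply/measurable_EFinP; exact: measurable_osc.
Qed.

Lemma mean_osc_le_norm n (c : R) f g : mfun4 f -> mfun4 g -> 0 <= c ->
  (forall x y, `|f x - f y| <= c * `|g x - g y|) -> (mean_osc n f <= c%:E * mean_osc n g)%E.
Proof.
move=> mf mg c0 fg; rewrite /mean_osc -ge0_integralZl_EFin//; last 2 first.
- by move=> z _; rewrite lee_fin osc_ge0.
- by apply/measurable_EFinP; exact: measurable_osc.
apply: ge0_le_integral => //.
- by move=> z _; rewrite lee_fin osc_ge0.
- by apply/measurable_EFinP; exact: measurable_osc.
- by apply: measurable_funeM; apply/measurable_EFinP; exact: measurable_osc.
- move=> z _; rewrite -EFinM lee_fin /osc -!mulrA [leRHS]mulrA ler_wpM2r//.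
  by rewrite !mulr_ge0.
Qed.

Lemma K_integral1 n g : mfun4 g -> (forall x, 0 <= g x) ->
  (\int[@mu4 R \x @mu4 R]_z (g z.1 * K n z.1 z.2 * (\1_Q z.1 * \1_Q z.2))%:E <=
   \int[@mu4 R]_(x in Q) (g x)%:E)%E.
Proof.
move=> mg g0.
have m1 : measurable_fun setT
    ((fun z => g z.1 * \1_Q z.1 * K n z.1 z.2) : T4 R * T4 R -> measurableTypeR R).
  apply: measurable_funM; last exact: measurable_K2.
  apply: measurable_funM; first exact: (measurableT_comp mg).
  exact: (measurableT_comp measurable_indicQ).
apply: (@le_trans _ _ (\int[@mu4 R \x @mu4 R]_z (g z.1 * \1_Q z.1 * K n z.1 z.2)%:E)%E).
  apply: ge0_le_integral => //.
  - by move=> z _; rewrite lee_fin !mulr_ge0.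
  - apply/measurable_EFinP; apply: measurable_funM.
      apply: measurable_funM; first exact: (measurableT_comp mg).
      exact: measurable_K2.
    apply: measurable_funM; exact: (measurableT_comp measurable_indicQ).
  - exact/measurable_EFinP.
  - move=> z _; rewrite lee_fin -!mulrA ler_wpM2l// mulrCA ler_wpM2l//.
    by rewrite mulrC ler_piMl//= indicE; case: (_ \in _).
rewrite fubini_tonelli1//=; last 2 first.
- exact/measurable_EFinP.
- by move=> z; rewrite lee_fin !mulr_ge0.
rewrite le_eqVlt [X in _ == X]integral_mkcond; apply/orP; left; apply/eqP.
apply: eq_integral => x _; rewrite /fubini_F/=.
under eq_integral do rewrite EFinM.
rewrite ge0_integralZl_EFin//.
- rewrite (integral_tensor_ker_rhos (hrho n)) mule1 patchE indicE.
  by case: ifP => _; rewrite ?mulr1// mulr0.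
- by move=> y _; rewrite lee_fin.
- apply/measurable_EFinP; apply: continuous_measurable4; apply: continuous_tensor_ker_r.
  exact: bumplike_rhos (hrho n).
- by rewrite mulr_ge0.
Qed.

Lemma K_integral2 n g : mfun4 g -> (forall x, 0 <= g x) ->
  (\int[@mu4 R \x @mu4 R]_z (g z.2 * K n z.1 z.2 * (\1_Q z.1 * \1_Q z.2))%:E <=
   \int[@mu4 R]_(x in Q) (g x)%:E)%E.
Proof.
move=> mg g0.
have m1 : measurable_fun setT
    ((fun z => g z.2 * \1_Q z.2 * K n z.1 z.2) : T4 R * T4 R -> measurableTypeR R).
  apply: measurable_funM; last exact: measurable_K2.
  apply: measurable_funM; first exact: (measurableT_comp mg).
  exact: (measurableT_comp measurable_indicQ).
apply: (@le_trans _ _ (\int[@mu4 R \x @mu4 R]_z (g z.2 * \1_Q z.2 * K n z.1 z.2)%:E)%E).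
  apply: ge0_le_integral => //.
  - by move=> z _; rewrite lee_fin !mulr_ge0.
  - apply/measurable_EFinP; apply: measurable_funM.
      apply: measurable_funM; first exact: (measurableT_comp mg).
      exact: measurable_K2.
    apply: measurable_funM; exact: (measurableT_comp measurable_indicQ).
  - exact/measurable_EFinP.
  - move=> z _; rewrite lee_fin -!mulrA ler_wpM2l// [leLHS]mulrC -mulrA.
    by rewrite ler_piMl ?mulr_ge0//= indicE; case: (_ \in _).
rewrite fubini_tonelli2//=; last 2 first.
- exact/measurable_EFinP.
- by move=> z; rewrite lee_fin !mulr_ge0.
rewrite le_eqVlt [X in _ == X]integral_mkcond; apply/orP; left; apply/eqP.
apply: eq_integral => y _; rewrite /fubini_G/=.
under eq_integral do rewrite EFinM.
rewrite ge0_integralZl_EFin//.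
- rewrite (integral_tensor_ker_rhos_l (hrho n)) mule1 patchE indicE.
  by case: ifP => _; rewrite ?mulr1// mulr0.
- by move=> x _; rewrite lee_fin.
- apply/measurable_EFinP.
  have : measurable_fun setT ((fun x => K n x y) : T4 R -> measurableTypeR R).
    exact: (measurableT_comp (measurable_K2 n) (measurable_pair2 y)).
  exact.
- by rewrite mulr_ge0.
Qed.

(** Each of [|f x|] and [|f y|] is integrated against a kernel of mass one in the other variable.
    The bound is uniform in [n], so the functions with vanishing limit oscillation are closed under
    L^1 approximation on [Q]. *)
Lemma mean_osc_le_integral n f : mfun4 f ->
  (mean_osc n f <= 2%:E * \int[@mu4 R]_(x in Q) `|f x|%:E)%E.
Proof.
move=> mf; have mnf : mfun4 (fun x => `|f x|) by exact: measurableT_comp.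
have nf0 x : 0 <= `|f x| by [].
have mm1 : measurable_fun setT
    ((fun z => `|f z.1| * K n z.1 z.2 * (\1_Q z.1 * \1_Q z.2)) : T4 R * T4 R -> measurableTypeR R).
  apply: measurable_funM.
    by apply: measurable_funM; [exact: (measurableT_comp mnf)|exact: measurable_K2].
  apply: measurable_funM; exact: (measurableT_comp measurable_indicQ).
have mm2 : measurable_fun setT
    ((fun z => `|f z.2| * K n z.1 z.2 * (\1_Q z.1 * \1_Q z.2)) : T4 R * T4 R -> measurableTypeR R).
  apply: measurable_funM.
    by apply: measurable_funM; [exact: (measurableT_comp mnf)|exact: measurable_K2].
  apply: measurable_funM; exact: (measurableT_comp measurable_indicQ).
rewrite (_ : 2%:E = 1 + 1)%E; last by rewrite -EFinD; congr EFin; ring.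
rewrite ge0_muleDl// mul1e; apply: le_trans (leeD (K_integral1 n mnf nf0) (K_integral2 n mnf nf0)).
rewrite /mean_osc -ge0_integralD//.
- apply: ge0_le_integral => //.
  + by move=> z _; rewrite lee_fin osc_ge0.
  + by apply/measurable_EFinP; exact: measurable_osc.
  + by apply: emeasurable_funD; exact/measurable_EFinP.
  + move=> z _; rewrite -EFinD lee_fin /osc -!mulrA -mulrDl ler_wpM2r//.
      by rewrite !mulr_ge0.
    by rewrite (le_trans (ler_normB _ _)).
- by move=> z _; rewrite lee_fin !mulr_ge0.
- exact/measurable_EFinP.
- by move=> z _; rewrite lee_fin !mulr_ge0.
- exact/measurable_EFinP.
Qed.

End oscillation.

Section oscillation_limit.
Variables (R : realType) (Q : set (R4 R)).
Hypotheses (mQ : measurable (Q : set (T4 R))) (Qoo : (mu4 (Q : set (T4 R)) < +oo)%E).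
Variable rho : nat -> R -> R.
Hypothesis hrho : forall n, normalized_bump (n.+1%:R^-1) (rho n).
Implicit Types (f g h : R4 R -> R) (x y : R4 R) (i : 'I_4) (A B : set (R4 R)).
Local Notation mfun4 f := (measurable_fun setT (f : T4 R -> measurableTypeR R)).
Local Notation J := (mean_osc Q rho).

Definition mean_osc_to0 f := mfun4 f /\
  forall e : R, 0 < e -> exists N, forall n, (N <= n)%N -> (J n f <= e%:E)%E.

Lemma mean_osc_to0_add f g h : mean_osc_to0 g -> mean_osc_to0 h -> mfun4 f ->
  (forall x y, `|f x - f y| <= `|g x - g y| + `|h x - h y|) -> mean_osc_to0 f.
Proof.
move=> [mg Jg] [mh Jh] mf fgh; split=> // e e0.
have e20 : 0 < e / 2 by rewrite divr_gt0.
have [N1 H1] := Jg _ e20; have [N2 H2] := Jh _ e20.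
exists (maxn N1 N2) => n; rewrite geq_max => /andP[/H1 A1 /H2 A2].
apply: le_trans (mean_osc_le_add mQ hrho n mf mg mh fgh) _.
by rewrite [e in leRHS]splitr EFinD leeD.
Qed.

Lemma mean_osc_to0_scale (c : R) g : mean_osc_to0 g -> mean_osc_to0 (fun x => c * g x).
Proof.
move=> [mg Jg]; have mf : mfun4 (fun x => c * g x) by exact: measurable_funM.
split => // e e0.
have c10 : 0 < `|c| + 1 by rewrite ltr_wpDl.
have [N H] := Jg _ (divr_gt0 e0 c10); exists N => n /H Hn.
apply: (@le_trans _ _ ((`|c| + 1)%:E * J n g)%E).
  apply: (mean_osc_le_norm mQ hrho n mf mg (ltW c10)) => x y.
  by rewrite -mulrBr normrM ler_wpM2r// lerDl.
apply: le_trans (lee_wpmul2l _ Hn) _; first by rewrite lee_fin ltW.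
by rewrite -EFinM lee_fin mulrC divfK// gt_eqF.
Qed.

Lemma mean_osc_to0_cst (c : R) : mean_osc_to0 (fun=> c).
Proof.
split; first exact: measurable_cst.
move=> e e0; exists 0%N => n _; rewrite /mean_osc integral0_eq ?lee_fin ?ltW// => z _.
by rewrite /osc subrr normr0 !mul0r.
Qed.

Lemma measurable_halfspace i (a : R) :
  measurable ([set x | a < coord4 i x] : set (T4 R)).
Proof.
rewrite (_ : [set x | _] = @coord4 R i @^-1` `]a, +oo[%classic).
  by rewrite -[X in measurable X]setTI; apply: measurable_coord4.
by apply/seteqP; split => x /=; rewrite in_itv/= andbT.
Qed.

Lemma measurable_slab i (a e : R) :
  measurable ([set x | `|coord4 i x - a| < e] : set (T4 R)).
Proof.
rewrite (_ : [set x | _] = @coord4 R i @^-1` `]a - e, a + e[%classic).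
  by rewrite -[X in measurable X]setTI; apply: measurable_coord4.
by apply/seteqP; split => x /=; rewrite in_itv/= ltr_distl.
Qed.

(** A line parallel to the [i]-th axis meets the hyperplane in one point. The intersection with [Q]
    makes the indicator integrable, as [integral_slice_eq0] requires. *)
Lemma mu4_hyperplane i (a : R) : mu4 (Q `&` [set x | coord4 i x = a] : set (T4 R)) = 0%E.
Proof.
set H := [set x | _].
have mH : measurable (H : set (T4 R)).
  rewrite (_ : H = @coord4 R i @^-1` [set a])//.
  by rewrite -[X in measurable X]setTI; apply: measurable_coord4.
have mQH : measurable (Q `&` H : set (T4 R)) by exact: measurableI.
rewrite -[Q `&` H]setIT -integral_indic//.
apply: (@integral_slice_eq0 R i (\1_(Q `&` H))).
  apply/integrableP; split; first exact/measurable_EFinP/measurable_indic.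
  under eq_integral do rewrite /= ger0_norm//.
  rewrite integral_indic// setIT; apply: le_lt_trans Qoo.
  by apply: (@le_measure _ _ _ (@mu4 R)); rewrite ?inE//; exact: subIsetl.
move=> x; rewrite (_ : (fun t => _) = (fun t => (\1_(Q `&` H) (upd4 i t x))%:E) \_ [set a]).
  by rewrite -integral_mkcond integral_set1.
apply/funext => t; rewrite patchE; case: ifPn => // ta.
rewrite indicE memNset// => -[_]; rewrite /H/= coord4_upd4 eqxx => tE.
by move: ta; rewrite tE mem_set.
Qed.

(** For [x] and [y] within the reach of the kernel the two values of the indicator differ only if
    [x] lies in the slab of half-width [1 / (n + 1)] around the bounding hyperplane. Inside [Q],
    which has finite measure, these slabs decrease to a null set. *)
Lemma mean_osc_to0_halfspace i (a : R) : mean_osc_to0 (\1_[set x | a < coord4 i x]).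
Proof.
set A := [set x | _]; pose S n := [set x | `|coord4 i x - a| < n.+1%:R^-1].
have mA : measurable (A : set (T4 R)) by exact: measurable_halfspace.
have mS n : measurable (S n : set (T4 R)) by exact: measurable_slab.
split; first exact: measurable_indic.
have bound n : (J n (\1_A) <= mu4 (S n `&` Q : set (T4 R)))%E.
  rewrite -integral_indic//.
  have S0 x : 0 <= \1_(S n) x :> R by rewrite indicE.
  have mS1 : mfun4 (\1_(S n) : R4 R -> R) by exact: measurable_indic.
  apply: le_trans (K_integral1 mQ hrho n mS1 S0).
  apply: ge0_le_integral => //.
  - by move=> z _; rewrite lee_fin osc_ge0.
  - by apply/measurable_EFinP; apply: measurable_osc => //; exact: measurable_indic.
  - apply/measurable_EFinP; apply: measurable_funM; first apply: measurable_funM.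
    + exact: (measurableT_comp (measurable_indic (mS n))).
    + exact: measurable_K2.
    + by apply: measurable_funM; exact: (measurableT_comp (measurable_indicQ mQ)).
  - move=> [x y] _; rewrite lee_fin /osc/= ler_wpM2r ?mulr_ge0//.
    have [xy|xy] := eqVneq (tensor_ker (rhos (rho n)) x y) 0; first by rewrite xy !mulr0.
    have yx : box x (n.+1%:R^-1) y.
      by apply: contra_notP (elimN eqP xy); apply: tensor_ker_eq0; exact: rhos_support (hrho n).
    apply: ler_wpM2r; first exact: tensor_ker_rhos_ge0 (hrho n) _ _.
    rewrite !indicE; have [Ax|Ax] := boolP (x \in A); have [Ay|Ay] := boolP (y \in A);
      rewrite ?subrr ?normr0 ?subr0 ?sub0r ?normrN ?normr1//.
    + suff Sx : S n x by rewrite (mem_set Sx).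
      move: Ax Ay; rewrite inE notin_setE /A/= => Ax /negP.
      rewrite -leNgt => Ay; have := yx i; rewrite distrC ltr_norml => /andP[_].
      by rewrite /S/=; move: (n.+1%:R^-1) => e yxi; rewrite ger0_norm; lra.
    + suff Sx : S n x by rewrite (mem_set Sx).
      move: Ax Ay; rewrite inE notin_setE /A/= => /negP.
      rewrite -leNgt => Ax Ay; have := yx i; rewrite ltr_norml => /andP[_].
      by rewrite /S/=; move: (n.+1%:R^-1) => e yxi; rewrite ler0_norm; lra.
have SQ : (fun n => mu4 (S n `&` Q : set (T4 R))) @ \oo --> 0%E.
  have SE : \bigcap_n (S n `&` Q) = Q `&` [set x | coord4 i x = a].
    apply/seteqP; split => [x H|x [Qx xa] n _].
      split; first by have [] := H 0%N.
      apply/eqP; rewrite -subr_eq0 -normr_eq0; apply/eqP.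
      apply/eqP; rewrite eq_le normr_ge0 andbT; apply/ler_addgt0Pr => e e0; rewrite add0r.
      have [n ne] : exists n : nat, n.+1%:R^-1 < e.
        by have [n] := ltr_add_invr e0; rewrite add0r => ?; exists n.
      by have [Sx _] := H n I; rewrite ltW// (lt_trans Sx).
    by split => //; rewrite /S/= xa subrr normr0 invr_gt0.
  rewrite -(mu4_hyperplane i a) -SE.
  apply: (@nonincreasing_cvg_mu _ _ _ (@mu4 R)) => //.
  - apply: le_lt_trans Qoo; apply: (@le_measure _ _ _ (@mu4 R)); rewrite ?inE//.
      exact: measurableI.
  - by move=> n; exact: measurableI.
  - by apply: bigcap_measurable => // n _; exact: measurableI.
  - move=> m n mn; apply/subsetPset => x [Sx Qx]; split => //; rewrite /S/=.
    by apply: lt_le_trans Sx _; rewrite lef_pV2 ?posrE// ler_nat.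
move=> e e0; move/fine_cvgP : SQ => [SQfin /cvgrPdist_lt/(_ _ e0) SQ0].
have [N _ HN] := filterI SQfin SQ0; exists N => n Nn.
have [fn dn] := HN n Nn; apply: le_trans (bound n) _.
rewrite -[leLHS]fineK// lee_fin ltW//; apply: le_lt_trans dn.
by rewrite sub0r normrN ler_norm.
Qed.

End oscillation_limit.

Section oscillation_integrable.
Variables (R : realType) (Q : set (R4 R)).
Hypotheses (mQ : measurable (Q : set (T4 R))) (Qoo : (mu4 (Q : set (T4 R)) < +oo)%E).
Variable rho : nat -> R -> R.
Hypothesis hrho : forall n, normalized_bump (n.+1%:R^-1) (rho n).
Implicit Types (f g h : R4 R -> R) (x y : R4 R) (i : 'I_4) (A B : set (T4 R)).
Local Notation mfun4 f := (measurable_fun setT (f : T4 R -> measurableTypeR R)).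
Local Notation J := (mean_osc Q rho).
Local Notation mean_osc_to0 := (mean_osc_to0 Q rho).

(** These sets turn out to be all measurable sets: they form a sigma-algebra that contains the
    half-spaces. A countable union is reached because the part missed by a finite union has small
    measure in [Q]. This takes the place of the density of continuous functions in L^1. *)
Definition mean_osc_null : set (set (T4 R)) := [set A | measurable A /\ mean_osc_to0 (\1_A)].

Lemma mean_osc_nullC A : mean_osc_null A -> mean_osc_null (~` A).
Proof.
move=> [mA JA]; have mC : measurable (~` A) by exact: measurableC.
split => //; have := mean_osc_to0_add mQ hrho JA (mean_osc_to0_cst Q rho 0).
apply; first exact: measurable_indic.
move=> x y; rewrite subrr normr0 addr0 !indicE !in_setC.
by case: (x \in A); case: (y \in A); rewrite /= ?subrr ?subr0 ?sub0r ?normrN.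
Qed.

Lemma mean_osc_nullU A B : mean_osc_null A -> mean_osc_null B -> mean_osc_null (A `|` B).
Proof.
move=> [mA JA] [mB JB]; have mU : measurable (A `|` B) by exact: measurableU.
split => //; apply: (mean_osc_to0_add mQ hrho JA JB); first exact: measurable_indic.
move=> x y; rewrite !indicE !in_setU.
by case: (x \in A); case: (y \in A); case: (x \in B); case: (y \in B);
  rewrite /= ?subrr ?subr0 ?sub0r ?normrN ?normr1 ?normr0 ?addr0 ?add0r ?lerDl.
Qed.

Lemma mean_osc_null_bigcup (F : (set (T4 R))^nat) : (forall n, mean_osc_null (F n)) ->
  mean_osc_null (\bigcup_n F n).
Proof.
move=> JF; have mF n : measurable (F n) by have [] := JF n.
have mU : measurable (\bigcup_n F n) by exact: bigcup_measurable.
split => //; split; first exact: measurable_indic.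
pose B m := \big[setU/set0]_(k < m) F k.
have JB m : mean_osc_null (B m).
  elim: m => [|m IH]; rewrite /B.
    rewrite big_ord0; split => //.
    by rewrite indic0; exact: mean_osc_to0_cst.
  by rewrite big_ord_recr; exact: mean_osc_nullU.
have mB m : measurable (B m) by have [] := JB m.
pose D m := \bigcup_n F n `\` B m.
have mD m : measurable (D m) by exact: measurableD.
have DQ : (fun m => mu4 (D m `&` Q)) @ \oo --> 0%E.
  have DE : \bigcap_m (D m `&` Q) = set0.
    rewrite -subset0 => x H; have [[[n _ Fx] _] _] := H 0%N I.
    have [[_ nB] _] := H n.+1 I; apply: nB.
    by rewrite /B -bigcup_mkord; exists n => /=.
  rewrite -(measure0 (@mu4 R)) -DE.
  apply: (@nonincreasing_cvg_mu _ _ _ (@mu4 R)).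
  - apply: le_lt_trans Qoo; apply: (@le_measure _ _ _ (@mu4 R)); rewrite ?inE//.
      exact: measurableI.
  - by move=> n; exact: measurableI.
  - by apply: bigcap_measurable => // n _; exact: measurableI.
  - move=> m n mn; apply/subsetPset => x [[Fx nB] Qx]; split => //; split => //.
    apply: contra_not nB; rewrite /B -!bigcup_mkord => -[k /= km Fk].
    by exists k => //=; exact: leq_trans km mn.
move=> e e0; have e40 : 0 < e / 4 by rewrite divr_gt0.
have e20 : 0 < e / 2 by rewrite divr_gt0.
move/fine_cvgP : DQ => [DQfin /cvgrPdist_lt/(_ _ e40) DQ0].
have [m _ Hm] := filterI DQfin DQ0.
have [fm dm] := Hm m (leqnn m).
have mDm : (mu4 (D m `&` Q) <= (e / 4)%:E)%E.
  rewrite -[leLHS]fineK// lee_fin ltW//; apply: le_lt_trans dm.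
  by rewrite sub0r normrN ler_norm.
have [_ [_ /(_ _ e20)[N HN]]] := JB m.
exists N => n /HN Hn.
have mi A : measurable A -> mfun4 (\1_A : R4 R -> R) by move=> ?; exact: measurable_indic.
apply: (@le_trans _ _ (J n (\1_(B m)) + J n (\1_(D m)))%E).
  apply: (mean_osc_le_add mQ hrho n (mi _ mU) (mi _ (mB m)) (mi _ (mD m))).
  have E x : \1_(\bigcup_n F n) x = \1_(B m) x + \1_(D m) x :> R.
    rewrite /D !indicE in_setD; have [xB|xB] := boolP (x \in B m); last first.
      by rewrite andbT add0r.
    rewrite andbF addr0 mem_set//; move: xB; rewrite inE /B -bigcup_mkord => -[k _ Fk].
    by exists k.
  move=> x y; rewrite !E (_ : _ + _ - _ = (\1_(B m) x - \1_(B m) y) +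
    (\1_(D m) x - \1_(D m) y)); last by ring.
  exact: ler_normD.
rewrite [e in leRHS]splitr EFinD; apply: leeD => //.
apply: le_trans (mean_osc_le_integral mQ hrho n (mi _ (mD m))) _.
under eq_integral do rewrite ger0_norm ?indicE//.
rewrite -[X in (_ * X)%E](_ : mu4 (D m `&` Q) = _); last by rewrite -integral_indic.
apply: le_trans (lee_wpmul2l _ mDm) _; first by rewrite lee_fin.
by rewrite -EFinM lee_fin; move: (e) => t; lra.
Qed.

Lemma mean_osc_null_sigma_algebra : sigma_algebra setT mean_osc_null.
Proof.
split.
- by split => //; rewrite indic0; exact: mean_osc_to0_cst.
- by move=> A JA; rewrite setTD; exact: mean_osc_nullC.
- exact: mean_osc_null_bigcup.
Qed.

(* The coordinates are measurable from [mean_osc_null], hence so is the identity. *)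
Lemma measurable_mean_osc_null A : measurable A -> mean_osc_null A.
Proof.
move=> mA; pose T' := g_sigma_algebraType mean_osc_null.
have mT' (B : set T') : measurable B <-> mean_osc_null B.
  by rewrite /measurable/= (sigma_algebra_id mean_osc_null_sigma_algebra).
have mc i : measurable_fun setT (@coord4 R i : T' -> measurableTypeR R).
  apply: (measurability _ (RGenOInfty.measurableE R)) => _ [_ [a ->] <-].
  rewrite setTI; apply/mT'.
  have -> : @coord4 R i @^-1` `]a, +oo[%classic = [set x | a < coord4 i x].
    by apply/seteqP; split => x /=; rewrite in_itv/= andbT.
  split; first exact: measurable_halfspace.
  exact: mean_osc_to0_halfspace.
have mid : measurable_fun setT (id : T' -> T4 R).
  have -> : id = (fun x : T' => (coord4 (@Ordinal 4 0 isT) x, coord4 (@Ordinal 4 1 isT) x,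
    coord4 (@Ordinal 4 2 isT) x, coord4 (@Ordinal 4 3 isT) x) : T4 R).
    by apply/funext => -[[[a b] c] d].
  by do 3?[apply: measurable_fun_pair; last exact: mc]; exact: mc.
by apply/mT'; have := mid measurableT A mA; rewrite setTI.
Qed.

Lemma mean_osc_to0_sum (I : Type) (s : seq I) (F : I -> R4 R -> R) :
  (forall k, mean_osc_to0 (F k)) -> mean_osc_to0 (fun x => \sum_(k <- s) F k x).
Proof.
move=> JF; elim: s => [|k s IH].
  by under eq_fun do rewrite big_nil; exact: mean_osc_to0_cst.
under eq_fun do rewrite big_cons.
apply: (mean_osc_to0_add mQ hrho (JF k) IH).
  by apply: measurable_funD; [have [] := JF k|have [] := IH].
move=> x y; rewrite (_ : _ + _ - _ = (F k x - F k y) +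
   (\sum_(k <- s) F k x - \sum_(k <- s) F k y)); last by ring.
exact: ler_normD.
Qed.

Import HBSimple.

(** Simple functions are finite combinations of indicators, and they approximate [f] in L^1 on [Q],
    where [mean_osc_le_integral] controls the remainder uniformly in [n]. *)
Lemma mean_osc_to0_integrable f : mfun4 f -> (@mu4 R).-integrable Q (EFin \o f) -> mean_osc_to0 f.
Proof.
move=> mf If; split => // e e0.
have [g [Ig _ fg]] := approximation_sfun_integrable mQ If.
have e40 : 0 < e / 4 by rewrite divr_gt0.
have e20 : 0 < e / 2 by rewrite divr_gt0.
move/fine_cvgP : fg => [fgfin /cvgrPdist_lt/(_ _ e40) fg0].
have [m _ Hm] := filterI fgfin fg0.
have [fm dm] := Hm m (leqnn m).
pose G : R4 R -> R := fun x => g m x.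
have mg : mfun4 G by exact: (@measurable_funPT _ _ _ _ (g m)).
have Jg : mean_osc_to0 G.
  have E : G = _ := funext (fimfunEord (g m)).
  rewrite E; apply: mean_osc_to0_sum => k; apply: (mean_osc_to0_scale mQ hrho).
  suff [] : mean_osc_null (g m @^-1` [set (finmap.enum_fset (fset_set (range (g m))))`_k]) by [].
  apply: measurable_mean_osc_null; rewrite -[X in measurable X]setTI; exact: mg.
have [_ /(_ _ e20)[N HN]] := Jg.
exists N => n /HN Hn.
have md : mfun4 (fun x => f x - G x) by exact: measurable_funB.
apply: (@le_trans _ _ (J n G + J n (fun x => f x - G x)%R)%E).
  apply: (mean_osc_le_add mQ hrho n mf mg md) => x y.
  rewrite (_ : f x - f y = (G x - G y) + ((f x - G x) - (f y - G y))); last by ring.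
  exact: ler_normD.
rewrite [e in leRHS]splitr EFinD; apply: leeD => //.
apply: le_trans (mean_osc_le_integral mQ hrho n md) _.
apply: (@le_trans _ _ (2%:E * (e / 4)%:E)%E).
  apply: lee_wpmul2l; first by rewrite lee_fin.
  have -> : (\int[@mu4 R]_(x in Q) `|(f x - G x)%R|%:E =
     \int[@mu4 R]_(x in Q) `|(f x)%:E - (g m x)%:E|)%E by [].
  rewrite -[leLHS]fineK// lee_fin ltW//; apply: le_lt_trans dm.
  by rewrite sub0r normrN ler_norm.
by rewrite -EFinM lee_fin; move: (e) => t; lra.
Qed.

End oscillation_integrable.

Section mollification_limit.
Variables (R : realType) (Q : set (R4 R)).
Hypotheses (mQ : measurable (Q : set (T4 R))) (Qoo : (mu4 (Q : set (T4 R)) < +oo)%E).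
Variable rho : nat -> R -> R.
Hypothesis hrho : forall n, normalized_bump (n.+1%:R^-1) (rho n).
Variable V : R4 R -> R.
Hypothesis mV : measurable_fun setT (V : T4 R -> measurableTypeR R).
Hypothesis IV : (@mu4 R).-integrable setT (EFin \o V).
Implicit Types (x y : R4 R) (n : nat).

Definition moll n x := ker_int V (rhos (rho n)) x.

Definition oscx n x : \bar R := (\int[@mu4 R]_y (osc Q rho n V (x, y))%:E)%E.

Let mosc n : measurable_fun setT (EFin \o osc Q rho n V).
Proof. by apply/measurable_EFinP; exact: measurable_osc. Qed.

Lemma oscx_ge0 n x : (0 <= oscx n x)%E.
Proof. by apply: integral_ge0 => y _; rewrite lee_fin osc_ge0. Qed.

Lemma measurable_oscx n : measurable_fun setT (oscx n : T4 R -> \bar R).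
Proof.
have o0 z : (0 <= (EFin \o osc Q rho n V) z)%E by rewrite lee_fin osc_ge0.
exact: (measurable_fun_fubini_tonelli_F (m2 := @mu4 R) _ (mosc n) o0).
Qed.

Lemma mean_osc_oscx n : mean_osc Q rho n V = (\int[@mu4 R]_x oscx n x)%E.
Proof.
have o0 z : (0 <= (EFin \o osc Q rho n V) z)%E by rewrite lee_fin osc_ge0.
exact: (fubini_tonelli1 (m1 := @mu4 R) (m2 := @mu4 R) _ (mosc n) o0).
Qed.

Lemma mean_osc_V_to0 (e : R) : 0 < e -> exists N, forall n, (N <= n)%N -> (mean_osc Q rho n V <= e%:E)%E.
Proof.
have [_] : mean_osc_to0 Q rho V; last exact.
by apply: mean_osc_to0_integrable => //; exact: integrableS IV.
Qed.

(** As the kernel has mass one, [moll n x - V x] is the average of [V y - V x]. The indicators in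
    [osc] equal 1 here, since the support of the kernel stays in [Q]. *)
Lemma moll_sub_le n x : Q x -> box x (n.+1%:R^-1) `<=` Q ->
  (`|moll n x - V x|%:E <= oscx n x)%E.
Proof.
move=> Qx xQ; have br := bumplike_rhos (hrho n).
have I1 := integrable_Vtensor_ker IV x br.
have IK := integrable_tensor_ker x br.
have I2 : (@mu4 R).-integrable setT (EFin \o (fun y => V x * tensor_ker (rhos (rho n)) x y)).
  exact: integrableZl_fun.
have -> : moll n x - V x =
    \int[@mu4 R]_y (V y * tensor_ker (rhos (rho n)) x y - V x * tensor_ker (rhos (rho n)) x y).
  rewrite RintegralB// RintegralZl// /moll /ker_int; congr (_ - _).
  by rewrite /Rintegral (integral_tensor_ker_rhos (hrho n)) mulr1.
have I3 := integrableB_fun measurableT I1 I2.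
apply: (@le_trans _ _ (\int[@mu4 R]_y `|V y * tensor_ker (rhos (rho n)) x y -
    V x * tensor_ker (rhos (rho n)) x y|)%:E).
  by rewrite lee_fin le_normr_Rintegral.
have I4 := integrable_norm I3.
rewrite /Rintegral fineK; last exact: integrable_fin_num I4.
rewrite le_eqVlt; apply/orP; left; apply/eqP; apply: eq_integral => y _.
congr EFin; rewrite /osc/= -mulrBl normrM distrC -mulrA; congr (_ * _).
rewrite ger0_norm; last exact: tensor_ker_rhos_ge0 (hrho n) _ _.
rewrite !indicE mem_set// mul1r.
have [->|Ky] := eqVneq (tensor_ker (rhos (rho n)) x y) 0; first by rewrite mul0r.
rewrite mem_set ?mulr1//; apply: xQ; apply: contra_notP (elimN eqP Ky).
by apply: tensor_ker_eq0; exact: rhos_support (hrho n).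
Qed.

(** The exceptional points are those where [oscx n x] stays above some [1 / (k + 1)] for all
    [n >= N]. For each [k] and [N] they form a null set by Markov's inequality, because the integral
    of [oscx n] tends to 0. The indices obtained depend on [x], which is enough for inequalities
    stated at a fixed point. *)
Lemma ae_moll_frequently : {ae (@mu4 R), forall x, Q x ->
  forall (d : R) N, 0 < d -> exists2 n, (N <= n)%N & (oscx n x < d%:E)%E}.
Proof.
pose E (k N : nat) := \bigcap_(n in [set n | (N <= n)%N]) [set x | (k.+1%:R^-1%:E <= oscx n x)%E].
have mS (k n : nat) : measurable ([set x | (k.+1%:R^-1%:E <= oscx n x)%E] : set (T4 R)).
  have -> : [set x | (k.+1%:R^-1%:E <= oscx n x)%E] = oscx n @^-1` `[k.+1%:R^-1%:E, +oo[%classic.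
    by apply/seteqP; split => x /=; rewrite in_itv/= andbT.
  rewrite -[X in measurable X]setTI; apply: measurable_oscx => //.
  exact: emeasurable_itv.
have mE k N : measurable (E k N : set (T4 R)).
  by apply: bigcap_measurable => [|n _]; [exists N; exact: leqnn|exact: mS].
have E0 k N : mu4 (E k N : set (T4 R)) = 0%E.
  apply/eqP; rewrite eq_le measure_ge0 andbT; apply/lee_addgt0Pr => e e0; rewrite add0e.
  have ek0 : 0 < k.+1%:R^-1 * e by rewrite mulr_gt0.
  have [M HM] := mean_osc_V_to0 ek0.
  have /HM : (M <= maxn M N)%N by rewrite leq_maxl.
  set n := maxn M N; rewrite mean_osc_oscx => Hn.
  rewrite -(@lee_pmul2l _ k.+1%:R^-1%:E) ?lte_fin//.
  rewrite -EFinM; apply: le_trans Hn.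
  rewrite -integral_cst//.
  apply: (@le_trans _ _ (\int[@mu4 R]_(x in E k N) oscx n x)%E).
    apply: ge0_le_integral => //.
    - by move=> x _; rewrite lee_fin.
    - by apply: measurable_funTS; exact: measurable_oscx.
    - by move=> x; apply; rewrite /= leq_maxr.
  apply: ge0_subset_integral => //; first exact: measurable_oscx.
  by move=> x _; exact: oscx_ge0.
have nE : (@mu4 R).-negligible (\bigcup_k \bigcup_N (E k N : set (T4 R))).
  apply: negligible_bigcup => k; apply: negligible_bigcup => N.
  by exists (E k N); split; [exact: mE|exact: E0|].
apply: negligibleS nE => x /= /not_implyP[Qx].
move=> /existsNP[d /existsNP[N /not_implyP[d0 H]]].
have [k] := ltr_add_invr d0; rewrite add0r => kd.
exists k => //; exists N => // n /= Nn; rewrite leNgt; apply/negP => nk.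
by apply: H; exists n => //; apply: lt_trans nk _; rewrite lte_fin.
Qed.

Lemma integral_moll_sub n (A : set (R4 R)) : measurable (A : set (T4 R)) -> A `<=` Q ->
  (forall x, A x -> box x (n.+1%:R^-1) `<=` Q) ->
  (\int[@mu4 R]_(x in A) `|moll n x - V x|%:E <= mean_osc Q rho n V)%E.
Proof.
move=> mA AQ bA; rewrite mean_osc_oscx.
apply: (@le_trans _ _ (\int[@mu4 R]_(x in A) oscx n x)%E).
  apply: ge0_le_integral => //.
  - apply/measurable_EFinP; apply: measurableT_comp => //; apply: measurable_funTS.
    apply: measurable_funB => //; apply: continuous_measurable4.
    by apply: continuous_ker_int => //; exact: bumplike_rhos (hrho n).
  - by apply: measurable_funTS; exact: measurable_oscx.
  - by move=> x Ax; apply: moll_sub_le; [exact: AQ|exact: bA].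
apply: ge0_subset_integral => //; first exact: measurable_oscx.
by move=> x _; exact: oscx_ge0.
Qed.

End mollification_limit.

(** * The trace of the Schouten tensor *)

Section trace.
Variable R : realType.

Lemma elem_sym1 (F : comNzRingType) (s : seq F) : elem_sym 1 s = \sum_(z <- s) z.
Proof.
rewrite /elem_sym (big_nth 0) big_mkord.
transitivity (\sum_(J in [set [set i]%SET | i : 'I_(size s)]%SET) \prod_(j in J) s`_j).
  apply: eq_bigl => J; apply/cards1P/imsetP => [[i ->]|[i _ ->]]; by exists i.
rewrite big_imset/=; last by move=> i j _ _; exact: finset.set1_inj.
by apply: eq_big => [i|i _]; rewrite ?inE// finset.big_set1.
Qed.

(** Both sides are, up to sign, the subleading coefficient of the characteristic polynomial. *)
Lemma sigma1_trace (n : nat) (L : 'M[R]_n.+1) : sigma 1 L = \tr L.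
Proof.
rewrite /sigma elem_sym1 /eigenvalues; case: closed_field_poly_normal => s /= Hs.
set A := map_mx _ _ in Hs.
have mA := char_poly_monic A; move: Hs; rewrite (monicP mA) scale1r => Hs.
have ss : size s = n.+1.
  by have := size_char_poly A; rewrite Hs size_prod_XsubC => -[].
have := @char_poly_trace _ n.+1 A isT.
rewrite Hs -{1}ss coefPn_prod_XsubC ?ss// => /oppr_inj ->.
by rewrite /A trace_map_mx.
Qed.

Lemma conformal_raise (w : R) (A : 'M[R]_4) :
  raise (conformal_metric w) A = expR (- (2 * w)) *: A.
Proof.
rewrite /raise /conformal_metric /flat_metric scalemx1 invmx_scalar expRN.
by rewrite mul_scalar_mx.
Qed.

(** Dimension four decides the sign of the gradient term: the rank-one part contributes [- |dw|^2]
    and the metric part [4 * |dw|^2 / 2], which together leave [+ |dw|^2]. *)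
Lemma schouten_trace (dw : 'rV[R]_4) (d2w : 'M[R]_4) :
  \tr (schouten dw d2w) = - (\sum_i d2w i i + \sum_i dw 0 i ^+ 2).
Proof.
rewrite /schouten raddfN/=; congr (- _).
rewrite !raddfD/= linearN/= linearZ/= /flat_metric mxtrace1 mxtrace_mulC.
rewrite {1}/mxtrace; set S := \sum_(i < 4) dw 0 i ^+ 2.
have -> : \tr (dw *m dw^T) = S.
  rewrite /mxtrace big_ord1 mxE; apply: eq_bigr => i _.
  by rewrite !mxE expr2.
by rewrite /=; set T := \sum_i d2w i i; clearbody T S; field.
Qed.

Lemma Gamma2_super (w : R) (dw : 'rV[R]_4) (d2w : 'M[R]_4) :
  Gamma2_plus (conformal_metric w) (schouten dw d2w) ->
  \sum_i d2w i i + \sum_i dw 0 i ^+ 2 <= 0.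
Proof.
move=> [+ _]; rewrite conformal_raise sigma1_trace mxtraceZ schouten_trace.
by rewrite pmulr_rgt0 ?expR_gt0// oppr_gt0 => /ltW.
Qed.

End trace.

(** * The supersolution as a limit of its mollifications *)

Section weak_harnack_C2.
Variable R : realType.
Implicit Types (c x y : R4 R) (r s : R) (h : R4 R -> R).

Lemma Rintegral_subset (A B : set (R4 R)) h :
  measurable (A : set (T4 R)) -> measurable (B : set (T4 R)) -> A `<=` B ->
  (@mu4 R).-integrable B (EFin \o h) -> (forall x, B x -> 0 <= h x) ->
  \int[@mu4 R]_(x in A) h x <= \int[@mu4 R]_(x in B) h x.
Proof.
move=> mA mB AB IB h0.
have IA : (@mu4 R).-integrable A (EFin \o h) by exact: integrableS IB.
apply: fine_le.
- exact: integrable_fin_num IA.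
- exact: integrable_fin_num IB.
- by apply: ge0_subset_integral => //; case/integrableP: IB.
Qed.

Lemma enorm_half x c : enorm (2^-1 *: (x - c)) = enorm (x - c) / 2.
Proof.
rewrite /enorm; have -> : \sum_(i < 4) coord4 i (2^-1 *: (x - c)) ^+ 2 =
    2^-1 ^+ 2 * \sum_(i < 4) coord4 i (x - c) ^+ 2.
  by rewrite mulr_sumr; apply: eq_bigr => i _; rewrite coord4Z exprMn.
by rewrite sqrtrM ?sqr_ge0// sqrtr_sqr ger0_norm ?invr_ge0// mulrC.
Qed.

Lemma enormN x : enorm (- x) = enorm x.
Proof. by congr Num.sqrt; apply: eq_bigr => i _; rewrite coord4N sqrrN. Qed.

(* Doubling at [c], then at the midpoint of [c] and [x], then the mean value
   inequality at [x]: each quarter ball lies in the next ball of the chain, and all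
   balls lie in [eball c s]. *)
Lemma superharmonic_harnack c r s h (h1 h2 : 'I_4 -> R4 R -> R) :
  0 < r -> 29 / 16 * r <= s -> s <= 2 * r ->
  slice_C2 h h1 h2 ->
  (forall x, eball c s x -> 0 <= h x) -> (forall x, eball c s x -> \sum_i h2 i x <= 0) ->
  forall x, eball c r x -> \int[@mu4 R]_(z in eball c s) h z <=
    16 * doubling_const R ^+ 2 * r ^+ 4 * h x.
Proof.
move=> r0 rs s2r hC2 h0 hs x xr.
have [ch _ _ _ _] := hC2.
set D := doubling_const R.
have D0 : 0 <= D by rewrite /D /doubling_const mulr_ge0// sqr_ge0.
pose y : R4 R := c + 2^-1 *: (x - c).
have yc : enorm (y - c) < r / 2.
  have -> : y - c = 2^-1 *: (x - c) by rewrite /y addrC addrA addNr add0r.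
  by rewrite enorm_half ltr_pM2r ?invr_gt0.
have cy : enorm (c - y) < r / 2 by rewrite -enormN opprB.
have yx : enorm (y - x) < r / 2.
  have -> : y - x = - (2^-1 *: (x - c)).
    by apply: coord4_ext => i; rewrite !(coord4D, coord4N, coord4Z); field.
  by rewrite enormN enorm_half ltr_pM2r ?invr_gt0.
move: xr; rewrite /eball/= => xr.
(* The radii are chosen so that [13 / 16 = 1 / 2 + 5 / 16], the last term being a quarter of
   [5 / 4], and so that [29 / 16 = 1 + 13 / 16] keeps the ball around [x] inside [eball c s]. *)
have B1 : eball c (s / 4) `<=` eball y (5 / 4 * r) by apply: eballS; lra.
have B2 : eball y (5 / 4 * r) `<=` eball c s by apply: eballS; lra.
have B3 : eball y (5 / 4 * r / 4) `<=` eball x (13 / 16 * r) by apply: eballS; lra.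
have B4 : eball x (13 / 16 * r) `<=` eball c s by apply: eballS; lra.
have s0 : 0 < s by lra.
have r1 : 0 < 5 / 4 * r by lra.
have r2 : 0 < 13 / 16 * r by lra.
have m (z : R4 R) t := measurable_eball z t.
have I (z : R4 R) t := @integrable_eball R h z t ch.
apply: le_trans (superharmonic_doubling s0 hC2 h0 hs) _.
apply: (@le_trans _ _ (D * \int[@mu4 R]_(z in eball y (5 / 4 * r)) h z)).
  by apply: ler_wpM2l => //; apply: Rintegral_subset => // z /B2; exact: h0.
apply: (@le_trans _ _ (D * (D * \int[@mu4 R]_(z in eball y (5 / 4 * r / 4)) h z))).
  apply: ler_wpM2l => //; apply: (superharmonic_doubling r1 hC2) => z /B2; [exact: h0|exact: hs].
apply: (@le_trans _ _ (D * (D * \int[@mu4 R]_(z in eball x (13 / 16 * r)) h z))).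
  do 2 apply: ler_wpM2l => //; apply: Rintegral_subset => // z /B4; exact: h0.
have hx0 : 0 <= h x.
  by apply: h0; apply: B4; rewrite /eball/= enormB /sqd sum4E !subrr expr0n !addr0 sqrtr0.
have H := mean_value_superharmonic r2 hC2 (fun z zx => hs z (B4 z zx)).
have muB : fine (mu4 (eball x (13 / 16 * r) : set (T4 R))) <= 16 * r ^+ 4.
  rewrite -lee_fin fineK; last by rewrite ge0_fin_numE// mu4_eball_lty.
  apply: le_trans (mu4_eball_le x r2) _; rewrite lee_fin ler_pM2l//.
  by apply: lerXn2r; rewrite ?nnegrE; lra.
rewrite [leRHS](_ : _ = D * (D * (16 * r ^+ 4 * h x))); last by ring.
do 2 apply: ler_wpM2l => //; apply: le_trans H _; exact: ler_wpM2r.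
Qed.

Lemma slice_C2N h (h1 h2 : 'I_4 -> R4 R -> R) : slice_C2 h h1 h2 ->
  slice_C2 (fun x => - h x) (fun i x => - h1 i x) (fun i x => - h2 i x).
Proof.
move=> [ch ch1 ch2 dh dh1]; split; first exact: continuousN_fun.
- by move=> i; exact: continuousN_fun.
- by move=> i; exact: continuousN_fun.
- by move=> i x t; exact: is_derive1N.
- by move=> i x t; exact: is_derive1N.
Qed.

Lemma mean_value_subharmonic c s h (h1 h2 : 'I_4 -> R4 R -> R) : 0 < s -> slice_C2 h h1 h2 ->
  (forall x, eball c s x -> 0 <= \sum_i h2 i x) ->
  fine (mu4 (eball c s : set (T4 R))) * h c <= \int[@mu4 R]_(x in eball c s) h x.
Proof.
move=> s0 hC2 hs; have [ch _ _ _ _] := hC2.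
have hC2' := slice_C2N hC2.
have hs' x : eball c s x -> \sum_i - h2 i x <= 0 by move=> /hs; rewrite sumrN oppr_le0.
have := mean_value_superharmonic s0 hC2' hs'.
rewrite mulrN; under eq_Rintegral do rewrite -mulN1r.
rewrite RintegralZl//; [|exact: measurable_eball|exact: integrable_eball].
by rewrite mulN1r lerN2.
Qed.

Lemma slice_C2_comp (v : R4 R -> R) (v1 v2 : 'I_4 -> R4 R -> R) (F F1 F2 : R -> R) :
  slice_C2 v v1 v2 ->
  (forall x, is_derive (v x) 1 F (F1 (v x))) -> (forall x, is_derive (v x) 1 F1 (F2 (v x))) ->
  (forall x, {for v x, continuous F2}) ->
  slice_C2 (fun x => F (v x)) (fun i x => F1 (v x) * v1 i x)
    (fun i x => F2 (v x) * v1 i x ^+ 2 + F1 (v x) * v2 i x).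
Proof.
move=> [cv cv1 cv2 dv dv1] dF dF1 cF2.
have c0 : continuous (fun x => F (v x)).
  by move=> x; apply: (@continuous_comp _ _ _ v F); [exact: cv|exact: is_derive1_cvg (dF x)].
have c1 : continuous (fun x => F1 (v x)).
  by move=> x; apply: (@continuous_comp _ _ _ v F1); [exact: cv|exact: is_derive1_cvg (dF1 x)].
have c2 : continuous (fun x => F2 (v x)).
  by move=> x; apply: (@continuous_comp _ _ _ v F2); [exact: cv|exact: cF2].
split => //.
- by move=> i; exact: continuousM_fun.
- move=> i; apply: continuousD_fun; apply: continuousM_fun => //.
  exact: continuousX_fun.
- move=> i x t; exact: is_derive1_comp_ext (dF _) (dv i x t).
- move=> i x t.
  have d1 := @is_derive1_comp_ext R t F1 (fun s : R => v (upd4 i s x)) _ _ (dF1 _) (dv i x t).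
  apply: is_derive_eq (is_derive1M d1 (dv1 i x t)) _.
  by rewrite expr2 mulrA.
Qed.

End weak_harnack_C2.

Section mollification_range.
Variables (R : realType) (rho : nat -> R -> R).
Hypothesis hrho : forall n, normalized_bump (n.+1%:R^-1) (rho n).
Variable V : R4 R -> R.
Hypothesis IV : (@mu4 R).-integrable setT (EFin \o V).
Implicit Types (x y : R4 R) (n : nat) (l : R).

Let mollB n x l : moll rho V n x - l =
  \int[@mu4 R]_y ((V y - l) * tensor_ker (rhos (rho n)) x y).
Proof.
have br := bumplike_rhos (hrho n).
under eq_Rintegral do rewrite mulrBl.
rewrite RintegralB//; last 2 first.
- exact: integrable_Vtensor_ker.
- by apply: integrableZl_fun => //; exact: integrable_tensor_ker.
rewrite RintegralZl//; last exact: integrable_tensor_ker.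
by rewrite [X in _ - l * X](congr1 fine (integral_tensor_ker_rhos (hrho n) x)) mulr1.
Qed.

Lemma moll_ge n x l : (forall y, l <= V y) -> l <= moll rho V n x.
Proof.
move=> lV; rewrite -subr_ge0 mollB; apply: Rintegral_ge0 => y _.
by rewrite mulr_ge0 ?subr_ge0// (tensor_ker_rhos_ge0 (hrho n)).
Qed.

Lemma moll_le n x l : (forall y, V y <= l) -> moll rho V n x <= l.
Proof.
move=> lV; rewrite -subr_ge0 -opprB oppr_ge0 mollB.
rewrite -oppr_ge0 -mulN1r -RintegralZl//; last first.
  have I := integrable_Vtensor_ker IV x (bumplike_rhos (hrho n)).
  under [_ \o _]eq_fun do rewrite /= mulrBl.
  apply: integrableB_fun => //; apply: integrableZl_fun => //.
  by apply: integrable_tensor_ker; exact: bumplike_rhos (hrho n).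
apply: Rintegral_ge0 => y _.
by rewrite mulN1r -mulNr mulr_ge0 ?opprB ?subr_ge0// (tensor_ker_rhos_ge0 (hrho n)).
Qed.

End mollification_range.

Section limit.
Variables (R : realType) (Q : set (R4 R)).
Hypotheses (mQ : measurable (Q : set (T4 R))) (Qoo : (mu4 (Q : set (T4 R)) < +oo)%E).
Variable rho : nat -> R -> R.
Hypothesis hrho : forall n, normalized_bump (n.+1%:R^-1) (rho n).
Variable V : R4 R -> R.
Hypothesis mV : measurable_fun setT (V : T4 R -> measurableTypeR R).
Hypothesis IV : (@mu4 R).-integrable setT (EFin \o V).
Implicit Types (x y : R4 R) (n : nat).
Local Notation moll := (moll rho V).

(** [F] is Lipschitz on a set [I] that contains all values of [V] and of its mollifications, so both
    sides change by at most a multiple of the errors. The L^1 error is small for all large [n], the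
    error at [x] only for infinitely many [n], hence some index serves both. *)
Lemma limit_ineq (A : set (R4 R)) (I : set R) (F : R -> R) (L : R) (N0 : nat) x (al : R) :
  measurable (A : set (T4 R)) -> A `<=` Q ->
  measurable_fun setT (F : measurableTypeR R -> measurableTypeR R) ->
  (forall y, I (V y)) -> (forall n y, I (moll n y)) -> 0 <= L ->
  (forall s t, I s -> I t -> `|F s - F t| <= L * `|s - t|) ->
  (forall n, (@mu4 R).-integrable A (EFin \o (fun y => F (moll n y)))) ->
  Q x ->
  (forall n, (N0 <= n)%N -> box x (n.+1%:R^-1) `<=` Q) ->
  (forall n, (N0 <= n)%N -> forall y, A y -> box y (n.+1%:R^-1) `<=` Q) ->
  (forall (d : R) N, 0 < d -> exists2 n, (N <= n)%N & (oscx Q rho V n x < d%:E)%E) ->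
  (forall n, (N0 <= n)%N -> al * F (moll n x) <= \int[@mu4 R]_(y in A) F (moll n y)) ->
  (@mu4 R).-integrable A (EFin \o (fun y => F (V y))) /\
  al * F (V x) <= \int[@mu4 R]_(y in A) F (V y).
Proof.
move=> mA AQ mF IVr Im L0 lipF IFm Qx bx bA fr ineq.
have mm n : measurable_fun setT (moll n : T4 R -> measurableTypeR R).
  apply: continuous_measurable4; apply: continuous_ker_int => //.
  exact: bumplike_rhos (hrho n).
have IVA : (@mu4 R).-integrable A (EFin \o V) by exact: integrableS IV.
have ImA n : (N0 <= n)%N -> (@mu4 R).-integrable A (EFin \o (fun y => moll n y - V y)).
  move=> Nn; apply/integrableP; split.
    apply/measurable_EFinP; apply: measurable_funTS.
    by apply: measurable_funB; [exact: mm|exact: mV].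
  apply: le_lt_trans (integral_moll_sub mQ hrho mV IV mA AQ (bA n Nn)) _.
  apply: le_lt_trans (mean_osc_le_integral mQ hrho n mV) _.
  have := integrableS _ _ _ IV => /(_ Q measurableT mQ (@subsetT _ Q)) /integrableP[_ H].
  by rewrite lte_mul_pinfty.
have IFd n : (N0 <= n)%N ->
    (@mu4 R).-integrable A (EFin \o (fun y => F (moll n y) - F (V y))).
  move=> Nn; apply: (@le_integrable _ _ _ (@mu4 R) A mA _
     (EFin \o (fun y => L * (moll n y - V y)))).
  - apply/measurable_EFinP; apply: measurable_funTS.
    by apply: measurable_funB; [exact: measurableT_comp mF (mm n)|exact: measurableT_comp mF mV].
  - by move=> y _; rewrite /= lee_fin normrM (ger0_norm L0); apply: lipF => //; exact: Im.
  - by apply: integrableZl_fun => //; exact: ImA.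
have IFV : (@mu4 R).-integrable A (EFin \o (fun y => F (V y))).
  have -> : (fun y => F (V y)) = (fun y => F (moll N0 y) - (F (moll N0 y) - F (V y))).
    by apply/funext => y; rewrite opprB addrC subrK.
  by apply: integrableB_fun => //; exact: IFd.
split => //; apply/ler_addgt0Pr => e e0.
pose d := e / (L * (1 + `|al|) + 1).
have den : 0 < L * (1 + `|al|) + 1 by rewrite ltr_wpDl// mulr_ge0// addr_ge0.
have d0 : 0 < d by rewrite divr_gt0.
have [N1 HJ] := mean_osc_V_to0 mQ Qoo hrho mV IV d0.
have [n Nn on] := fr d (maxn N0 N1) d0.
have N0n : (N0 <= n)%N by rewrite (leq_trans _ Nn)// leq_maxl.
have Jn : (mean_osc Q rho n V <= d%:E)%E by apply: HJ; rewrite (leq_trans _ Nn)// leq_maxr.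
have mx : `|moll n x - V x| <= d.
  by rewrite -lee_fin (le_trans (moll_sub_le hrho IV Qx (bx n N0n)))// ltW.
have H1 : al * F (V x) <= al * F (moll n x) + `|al| * L * d.
  rewrite -lerBlDl -mulrBr; apply: le_trans (ler_norm _) _.
  rewrite normrM -mulrA ler_wpM2l// distrC.
  apply: le_trans (lipF _ _ (Im n x) (IVr x)) _; exact: ler_wpM2l.
have H2 : \int[@mu4 R]_(y in A) F (moll n y) <= \int[@mu4 R]_(y in A) F (V y) + L * d.
  rewrite -lerBlDl -RintegralB//; apply: le_trans (ler_norm _) _.
  apply: le_trans (le_normr_Rintegral _ (IFd n N0n)) _ => //.
  apply: (@le_trans _ _ (L * \int[@mu4 R]_(y in A) `|moll n y - V y|)).
    have Iabs := integrable_norm (ImA n N0n).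
    rewrite -RintegralZl//; apply: le_Rintegral => //.
    - exact: integrable_norm (IFd n N0n).
    - exact: integrableZl_fun.
    - by move=> y _; exact: lipF.
  apply: ler_wpM2l => //.
  rewrite -lee_fin /Rintegral fineK; last exact: integrable_fin_num (integrable_norm (ImA n N0n)).
  exact: le_trans (integral_moll_sub mQ hrho mV IV mA AQ (bA n N0n)) Jn.
apply: le_trans H1 _; apply: le_trans (lerD (ineq n N0n) (lexx _)) _.
apply: le_trans (lerD H2 (lexx _)) _; rewrite -addrA lerD2l.
have -> : L * d + `|al| * L * d = e * ((L * (1 + `|al|)) / (L * (1 + `|al|) + 1)).
    by rewrite /d; field; rewrite gt_eqF.
by rewrite ger_pMr// ler_pdivrMr// mul1r lerDl.
Qed.

End limit.

Section mollified_transform.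
Variable R : realType.
Implicit Types (c x y : R4 R) (s t : R) (n : nat) (I : set R).

(* If [\sum_i v_ii + \sum_i v_i ^+ 2 <= 0] then, as [F1 <= 0], the Laplacian of [F \o v]
   is at least [(F2 v - F1 v) * \sum_i v_i ^+ 2]. *)
Definition sub_transform I (F F1 F2 : R -> R) := forall t, I t ->
  [/\ is_derive t 1 F (F1 t), is_derive t 1 F1 (F2 t), {for t, continuous F2},
   F1 t <= 0 & F1 t <= F2 t].

Variables (c : R4 R) (r : R) (r0 : 0 < r).
Local Notation U := (eball c (2 * r)).
Variables (w : R4 R -> R) (Dw : R4 R -> 'rV[R]_4) (D2w : R4 R -> 'M[R]_4).
Hypothesis hW : W22 U w Dw D2w.
Hypothesis super : {ae (@mu4 R), forall y, U y ->
  \sum_i D2w y i i + \sum_i (Dw y 0 i) ^+ 2 <= 0}.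
Variable rho : nat -> R -> R.
Hypothesis hrho : forall n, normalized_bump (n.+1%:R^-1) (rho n).
Variables (k : R) (V : R4 R -> R).
Hypothesis mV : measurable_fun setT (V : T4 R -> measurableTypeR R).
Hypothesis IV : (@mu4 R).-integrable setT (EFin \o V).
Hypothesis Vw : {ae (@mu4 R), forall y, U y -> V y = w y - k}.
Variables (I : set R) (F F1 F2 : R -> R) (L : R).
Hypothesis mF : measurable_fun setT (F : measurableTypeR R -> measurableTypeR R).
Hypothesis hF : sub_transform I F F1 F2.
Hypothesis IVr : forall y, I (V y).
Hypothesis Im : forall n y, I (moll rho V n y).
Hypothesis L0 : 0 <= L.
Hypothesis lipF : forall s t, I s -> I t -> `|F s - F t| <= L * `|s - t|.

Let mU : measurable (U : set (T4 R)). Proof. exact: measurable_eball. Qed.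
Let Uoo : (mu4 (U : set (T4 R)) < +oo)%E. Proof. exact: mu4_eball_lty. Qed.

(** The margin comes from the kernels: the closed box of half-side [2 / (n + 1)], which carries
    their derivatives, lies in the open box of half-side [3 / (n + 1)], and this one in the ball of
    radius [6 / (n + 1)] by [box_eball]. *)
Lemma inner_index s : s < 2 * r -> exists N, forall n, (N <= n)%N -> s + 6 * n.+1%:R^-1 <= 2 * r.
Proof.
move=> sr; have d0 : 0 < (2 * r - s) / 6 by rewrite divr_gt0// subr_gt0.
have [N] := ltr_add_invr d0; rewrite add0r => HN.
exists N => n Nn; rewrite addrC -lerBrDr mulrC -ler_pdivlMr//.
by apply: le_trans (ltW HN); rewrite lef_pV2 ?posrE// ler_nat.
Qed.

Lemma inner_cbox s n x : s + 6 * n.+1%:R^-1 <= 2 * r -> eball c s x ->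
  cbox x (2 * n.+1%:R^-1) `<=` U.
Proof.
have : (0 : R) < n.+1%:R^-1 by rewrite invr_gt0.
move: (n.+1%:R^-1) => e e0; rewrite [X in X x -> _]/eball/= => sr xs y xy.
have e6 : 0 < 6 * e by rewrite mulr_gt0.
apply: (@eballS _ c x (6 * e)); first by lra.
apply: (box_eball e6) => i; apply: le_lt_trans (xy i) _; lra.
Qed.

Lemma inner_box s n x : s + 6 * n.+1%:R^-1 <= 2 * r -> eball c s x ->
  box x (n.+1%:R^-1) `<=` U.
Proof.
move=> sr xs y xy; apply: (inner_cbox sr xs) => i.
apply: le_trans (ltW (xy i)) _; rewrite ler_peMl ?invr_ge0//; lra.
Qed.

Definition trans1 n i x := F1 (moll rho V n x) * - ker_int V (deriv_factor i (rhos (rho n))) x.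
Definition trans2 n i x := F2 (moll rho V n x) * (- ker_int V (deriv_factor i (rhos (rho n))) x) ^+ 2 +
  F1 (moll rho V n x) * ker_int V (deriv_factor i (deriv_factor i (rhos (rho n)))) x.

Lemma slice_C2_transform n : slice_C2 (fun x => F (moll rho V n x)) (trans1 n) (trans2 n).
Proof.
apply: slice_C2_comp; first by apply: slice_C2_ker_int => // j; exact: bumplike_rhos (hrho n) j.
- by move=> x; have [] := hF (Im n x).
- by move=> x; have [] := hF (Im n x).
- by move=> x; have [] := hF (Im n x).
Qed.

Lemma subharmonic_transform s n x : s + 6 * n.+1%:R^-1 <= 2 * r -> eball c s x ->
  0 <= \sum_i trans2 n i x.
Proof.
move=> sr xs; have [_ _ _ F10 F12] := hF (Im n x).
have e0 : (0 : R) < n.+1%:R^-1 by rewrite invr_gt0.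
have := mollified_supersolution mU Uoo e0 (hrho n) hW super IV Vw (x := x) (inner_cbox sr xs).
rewrite /trans2 big_split/= -!mulr_sumr => H.
have S0 : 0 <= \sum_i (- ker_int V (deriv_factor i (rhos (rho n))) x) ^+ 2.
  by apply: sumr_ge0 => i _; exact: sqr_ge0.
move: S0 H F10 F12; set A := \sum_i _; set B := \sum_i _; move: (F1 _) (F2 _) => a b A0 BA a0 ab.
have -> : b * A + a * B = (b - a) * A + a * (B + A) by ring.
by apply: addr_ge0; [apply: mulr_ge0; rewrite ?subr_ge0|exact: mulr_le0].
Qed.

Lemma transform_mean_value : {ae (@mu4 R), forall x, eball c r x ->
  (@mu4 R).-integrable (eball x (r / 2)) (EFin \o (fun y => F (V y))) /\
  fine (mu4 (eball x (r / 2) : set (T4 R))) * F (V x) <=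
    \int[@mu4 R]_(y in eball x (r / 2)) F (V y)}.
Proof.
have [N HN] : exists N, forall n, (N <= n)%N -> 3 / 2 * r + 6 * n.+1%:R^-1 <= 2 * r.
  by apply: inner_index; move: r0; lra.
apply: ae4S (ae_moll_frequently mU Uoo hrho mV IV) => x fr xr.
have sx : eball x (r / 2) `<=` eball c (3 / 2 * r).
  by apply: eballS; move: xr; rewrite /eball/=; lra.
have sU : eball c (3 / 2 * r) `<=` U.
  by move=> y; rewrite /eball/=; move: r0; lra.
have xs : eball c (3 / 2 * r) x by move: xr r0; rewrite /eball/=; lra.
have r20 : 0 < r / 2 by rewrite divr_gt0.
apply: (limit_ineq (N0 := N) mU Uoo hrho mV IV _ _ mF IVr Im L0 lipF) => //.
- exact: measurable_eball.
- by move=> y /sx /sU.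
- by move=> n; apply: integrable_eball; have [] := slice_C2_transform n.
- exact: sU.
- by move=> n /HN H; exact: inner_box H xs.
- by move=> n /HN H y /sx; exact: inner_box H.
- exact: fr (sU _ xs).
- move=> n /HN H; apply: (mean_value_subharmonic r20 (slice_C2_transform n)) => y /sx.
  exact: subharmonic_transform H.
Qed.

(** [superharmonic_harnack] is applied to [- F (moll rho V n x)], which is nonnegative because
    [F <= 0] on [I]. The change of sign reverses the inequality. *)
Lemma transform_harnack s : 29 / 16 * r <= s -> s < 2 * r -> (forall t, I t -> F t <= 0) ->
  {ae (@mu4 R), forall x, eball c r x ->
  (@mu4 R).-integrable (eball c s) (EFin \o (fun y => F (V y))) /\
  16 * doubling_const R ^+ 2 * r ^+ 4 * F (V x) <= \int[@mu4 R]_(y in eball c s) F (V y)}.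
Proof.
move=> rs sr F0; have [N HN] := inner_index sr.
apply: ae4S (ae_moll_frequently mU Uoo hrho mV IV) => x fr xr.
have sU : eball c s `<=` U by move=> y; rewrite /eball/=; move: sr; lra.
have xs : eball c s x by move: xr r0; rewrite /eball/=; move: rs; lra.
apply: (limit_ineq (N0 := N) mU Uoo hrho mV IV _ _ mF IVr Im L0 lipF) => //.
- exact: measurable_eball.
- by move=> n; apply: integrable_eball; have [] := slice_C2_transform n.
- exact: sU.
- by move=> n /HN H; exact: inner_box H xs.
- by move=> n /HN H y; exact: inner_box H.
- exact: fr (sU _ xs).
- move=> n /HN H; have hC2 := slice_C2N (slice_C2_transform n).
  have [ch _ _ _ _] := slice_C2_transform n.
  have := superharmonic_harnack r0 rs (ltW sr) hC2 _ _ xr.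
  rewrite mulrN; under eq_Rintegral do rewrite -mulN1r.
  rewrite RintegralZl//; [|exact: measurable_eball|exact: integrable_eball].
  rewrite mulN1r lerN2; apply => y ys; first by rewrite oppr_ge0 F0.
  by rewrite sumrN oppr_le0; exact: subharmonic_transform H ys.
Qed.

End mollified_transform.

(** * Powers as admissible transforms *)

Section transforms.
Variable R : realType.
Implicit Types (s t a b : R) (I : set R).

Lemma is_derive_powR_affine a s p t : 0 < a + s * t ->
  is_derive t 1 (fun t => (a + s * t) `^ p) (p * (a + s * t) `^ (p - 1) * s).
Proof.
move=> u0; apply: (@is_derive1_comp_ext R t (fun u => u `^ p) (fun t => a + s * t)
  (p * (a + s * t) `^ (p - 1)) s).
  exact: is_derive1_powR.
apply: is_derive_eq (is_derive1D (is_derive1_cst t a) (is_derive1Zl s (is_derive1_id t))) _.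
by rewrite add0r mulr1.
Qed.

Lemma powR_transform I a s p : s ^+ 2 = 1 -> 0 < p ->
  (forall t, I t -> 0 < a + s * t) -> (forall t, I t -> s * (p - 1) <= a + s * t) ->
  sub_transform I (fun t => - s * (a + s * t) `^ p) (fun t => - p * (a + s * t) `^ (p - 1))
    (fun t => - s * (p * (p - 1)) * (a + s * t) `^ (p - 2)).
Proof.
move=> s1 p0 I0 I1 t It; have u0 := I0 t It; split.
- apply: is_derive_eq (is_derive1Zl (- s) (is_derive_powR_affine p u0)) _.
  rewrite -[RHS]mulr1 -s1; ring.
- apply: is_derive_eq (is_derive1Zl (- p) (is_derive_powR_affine (p - 1) u0)) _.
  rewrite (_ : p - 1 - 1 = p - 2); first by ring.
  by ring.
- exact: is_derive1_cvg (is_derive1Zl _ (is_derive_powR_affine (p - 2) u0)).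
- by rewrite mulNr oppr_le0 mulr_ge0 ?powR_ge0// ltW.
- rewrite (_ : p - 1 = p - 2 + 1); last by ring.
  rewrite powRD; last by rewrite (gt_eqF u0) implybT.
  rewrite (powRr1 (ltW u0)) -subr_ge0.
  rewrite (_ : _ - _ = p * (a + s * t) `^ (p - 2) * (a + s * t - s * (p - 1))); last by ring.
  by rewrite !mulr_ge0 ?powR_ge0 ?(ltW p0)// subr_ge0 I1.
Qed.

Lemma sub_transform_lipschitz a b (F F1 F2 : R -> R) : a <= b ->
  sub_transform `[a, b] F F1 F2 -> exists2 L, 0 <= L &
  forall s t, a <= s <= b -> a <= t <= b -> `|F s - F t| <= L * `|s - t|.
Proof.
move=> ab hF.
have cF1 : {within `[a, b], continuous F1}.
  by apply: derivable_within_continuous => t /hF[_ d _ _ _]; exact: ex_derive.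
have [c cab Hc] := EVT_min ab cF1.
have [_ _ _ Fc0 _] := hF c cab.
exists (- F1 c); first by rewrite oppr_ge0.
have key s t : a <= s -> s <= t -> t <= b -> `|F s - F t| <= - F1 c * `|s - t|.
  move=> sa st tb; rewrite distrC (distrC s).
  have sub u : u \in `[s, t] -> `[a, b]%classic u.
    by rewrite in_itv/= => /andP[su ut]; rewrite /= in_itv/= (le_trans sa su) (le_trans ut tb).
  have [u ust ->] : exists2 u, u \in `[s, t] & F t - F s = F1 u * (t - s).
    apply: MVT_segment => //.
      by move=> u /subset_itv_oo_cc us; have [] := hF _ (sub _ us).
    apply: derivable_within_continuous => u us.
    by have [d _ _ _ _] := hF _ (sub _ us); exact: ex_derive.
  rewrite normrM ler_wpM2r//; have [_ _ _ F0 _] := hF _ (sub _ ust).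
  by rewrite ler0_norm// lerN2 Hc//; exact: sub.
move=> s t /andP[sa sb] /andP[ta tb]; have [st|/ltW ts] := leP s t; first exact: key.
by rewrite distrC (distrC s); exact: key.
Qed.

Lemma measurable_powR_affine a s p :
  measurable_fun setT ((fun t => - s * (a + s * t) `^ p) : measurableTypeR R -> measurableTypeR R).
Proof.
apply: measurable_funM; first exact: measurable_cst.
apply: (measurableT_comp (measurable_powR p)).
apply: measurable_funD; first exact: measurable_cst.
by apply: measurable_funM; [exact: measurable_cst|exact: measurable_id].
Qed.

End transforms.

(** * Integral estimates for the supersolution at almost every point *)

Section supersolution.
Variables (R : realType) (c : R4 R) (r : R).
Hypothesis r0 : 0 < r.
Local Notation U := (eball c (2 * r)).
Variables (w : R4 R -> R) (Dw : R4 R -> 'rV[R]_4) (D2w : R4 R -> 'M[R]_4).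
Hypothesis hW : W22 U w Dw D2w.
Hypothesis super : {ae (@mu4 R), forall y, U y ->
  \sum_i D2w y i i + \sum_i (Dw y 0 i) ^+ 2 <= 0}.
Implicit Types (x y : R4 R) (s t : R) (n : nat).

Let mU : measurable (U : set (T4 R)). Proof. exact: measurable_eball. Qed.
Let Uoo : (mu4 (U : set (T4 R)) < +oo)%E. Proof. exact: mu4_eball_lty. Qed.

Let mw : measurable_fun U (w : T4 R -> measurableTypeR R).
Proof. by have [[]] := hW. Qed.

Let Iw : (@mu4 R).-integrable U (EFin \o w).
Proof.
apply: integrable_sqr_integrable => //.
by apply: in_Lp2_integrable_sqr => //; have [] := hW.
Qed.

Lemma exists_mollifiers : exists rho : nat -> R -> R,
  forall n, normalized_bump (n.+1%:R^-1) (rho n).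
Proof.
have /choice[rho H] n : exists rho : R -> R, normalized_bump (n.+1%:R^-1) rho.
  by apply: exists_normalized_bump; rewrite invr_gt0.
by exists rho.
Qed.

Lemma half_eball_sub x : eball c r x -> eball x (r / 2) `<=` U.
Proof. by rewrite {1}/eball/= => xr; apply: eballS; move: r0; lra. Qed.

(** The transform [- t] is Lipschitz on the whole line, so [w], which may be unbounded, is mollified
    without truncation after extension by zero. *)
Lemma supersolution_mean_value : {ae (@mu4 R), forall x, eball c r x ->
  \int[@mu4 R]_(y in eball x (r / 2)) w y <=
    fine (mu4 (eball x (r / 2) : set (T4 R))) * w x}.
Proof.
have [rho hrho] := exists_mollifiers.
have mV : measurable_fun setT ((w \_ U) : T4 R -> measurableTypeR R).
  exact: (measurable_restrictT _ mU).1 mw.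
have IV : (@mu4 R).-integrable setT (EFin \o (w \_ U)).
  rewrite -restrict_EFin; apply/integrable_restrict => //; by rewrite setTI.
have Vw : {ae (@mu4 R), forall y, U y -> (w \_ U) y = w y - 0}.
  by apply: aeW => y Uy; rewrite patchE mem_set// subr0.
have mF : measurable_fun setT ((fun t => - t) : measurableTypeR R -> measurableTypeR R).
  exact: oppr_measurable.
have hF : sub_transform [set: R] (fun t => - t) (fun=> -1) (fun=> 0).
  move=> t _; split; [exact: is_derive1N (is_derive1_id t)|exact: is_derive1_cst|
    exact: cst_continuous| |]; lra.
have lip s t : [set: R] s -> [set: R] t -> `|- s - (- t)| <= 1 * `|s - t|.
  by move=> _ _; rewrite mul1r opprK addrC distrC.
have := transform_mean_value r0 hW super hrho mV IV Vw mF hF _ _ ler01 lip.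
move=> /(_ (fun=> I) (fun _ _ => I)).
apply: ae4S => x H xr; have {H} [] := H xr.
have xU := half_eball_sub xr.
have E y : eball x (r / 2) y -> (w \_ U) y = w y by move=> /xU Uy; rewrite patchE mem_set.
rewrite E; last by rewrite /eball/= enormB /sqd sum4E !subrr expr0n !addr0 sqrtr0 divr_gt0.
have -> : \int[@mu4 R]_(y in eball x (r / 2)) (- (w \_ U) y) =
    \int[@mu4 R]_(y in eball x (r / 2)) (-1 * w y).
  by apply: eq_Rintegral => y; rewrite inE => /E ->; rewrite mulN1r.
move=> _; rewrite RintegralZl//; first by rewrite mulrN mulN1r lerN2.
- exact: measurable_eball.
- by apply: integrableS Iw => //; exact: measurable_eball.
Qed.

Section clamp.
Variables (a b k : R).
Hypotheses (a0 : a <= 0) (b0 : 0 <= b).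
Hypothesis wab : {ae (@mu4 R), forall y, U y -> a <= w y - k <= b}.

(** Bounds valid almost everywhere on [U] become valid at every point, so the mollifications stay in
    [[a, b]] too, where the transforms are smooth. The value 0 outside [U] must lie in [[a, b]],
    hence the recentring by [k]. *)
Definition clamp : R4 R -> R := (fun y => Num.max a (Num.min b (w y - k))) \_ U.

Lemma clamp_itv y : clamp y \in `[a, b].
Proof.
rewrite in_itv/= /clamp patchE; case: ifP => _; last by rewrite a0.
by rewrite le_max lexx/= ge_max ge_min lexx (le_trans a0 b0).
Qed.

Lemma measurable_clamp : measurable_fun setT (clamp : T4 R -> measurableTypeR R).
Proof.
apply: (measurable_restrictT _ mU).1; apply: measurable_maxr; first exact: measurable_cst.
apply: measurable_minr; first exact: measurable_cst.
by apply: measurable_funB => //; exact: measurable_cst.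
Qed.

Lemma integrable_clamp : (@mu4 R).-integrable setT (EFin \o clamp).
Proof.
have -> : EFin \o clamp = (EFin \o clamp) \_ U.
  by apply/funext => y; rewrite /clamp /= !patchE; case: ifP => yU //=; rewrite patchE yU.
apply/integrable_restrict => //; rewrite setTI.
apply: (@le_integrable _ _ _ (@mu4 R) U mU _ (EFin \o (fun _ : R4 R => b - a))).
- by apply/measurable_EFinP; apply: measurable_funTS; exact: measurable_clamp.
- move=> y _; rewrite lee_fin/=; have := clamp_itv y; rewrite in_itv/= => /andP[ya yb].
  have ba : 0 <= b - a by move: a0 b0; lra.
  rewrite (ger0_norm ba) ler_norml; apply/andP; split; move: a0 b0; lra.
- by apply/integrableP; split; [exact: measurable_cst|rewrite integral_cst// lte_mul_pinfty].
Qed.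

Lemma clampE : {ae (@mu4 R), forall y, U y -> clamp y = w y - k}.
Proof.
apply: ae4S wab => y H Uy; have /andP[wa wb] := H Uy.
by rewrite /clamp patchE mem_set// (min_idPr wb) (max_idPr wa).
Qed.

Variable rho : nat -> R -> R.
Hypothesis hrho : forall n, normalized_bump (n.+1%:R^-1) (rho n).

Lemma moll_clamp_itv n y : moll rho clamp n y \in `[a, b].
Proof.
have I1 := integrable_clamp; have H z := clamp_itv z.
rewrite in_itv/=; apply/andP; split.
  by apply: (moll_ge hrho I1) => z; have := H z; rewrite in_itv/= => /andP[].
by apply: (moll_le hrho I1) => z; have := H z; rewrite in_itv/= => /andP[].
Qed.

Variables (al s p : R).
Hypotheses (s1 : s ^+ 2 = 1) (p0 : 0 < p).
Hypothesis I0 : forall t, a <= t <= b -> 0 < al + s * t.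
Hypothesis I1 : forall t, a <= t <= b -> s * (p - 1) <= al + s * t.

Local Notation F := (fun t => - s * (al + s * t) `^ p).

Let hF : sub_transform `[a, b] F (fun t => - p * (al + s * t) `^ (p - 1))
  (fun t => - s * (p * (p - 1)) * (al + s * t) `^ (p - 2)).
Proof. exact: powR_transform. Qed.

Let lipF : exists2 L, 0 <= L & forall s t, `[a, b]%classic s -> `[a, b]%classic t ->
  `|F s - F t| <= L * `|s - t|.
Proof.
have [L L0 H] := sub_transform_lipschitz (le_trans a0 b0) hF.
by exists L => // u v; rewrite /= !in_itv/=; exact: H.
Qed.

Lemma clamp_mean_value : {ae (@mu4 R), forall x, eball c r x ->
  (@mu4 R).-integrable (eball x (r / 2)) (EFin \o (fun y => F (clamp y))) /\
  fine (mu4 (eball x (r / 2) : set (T4 R))) * F (clamp x) <=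
    \int[@mu4 R]_(y in eball x (r / 2)) F (clamp y)}.
Proof.
have [L L0 HL] := lipF.
exact: (transform_mean_value r0 hW super hrho measurable_clamp integrable_clamp clampE
  (measurable_powR_affine al s p) hF clamp_itv moll_clamp_itv L0 HL).
Qed.

Lemma clamp_harnack t : 29 / 16 * r <= t -> t < 2 * r -> 0 <= s ->
  {ae (@mu4 R), forall x, eball c r x ->
  (@mu4 R).-integrable (eball c t) (EFin \o (fun y => F (clamp y))) /\
  16 * doubling_const R ^+ 2 * r ^+ 4 * F (clamp x) <= \int[@mu4 R]_(y in eball c t) F (clamp y)}.
Proof.
move=> rt tr s0; have [L L0 HL] := lipF.
apply: (transform_harnack r0 hW super hrho measurable_clamp integrable_clamp clampE
  (measurable_powR_affine al s p) hF clamp_itv moll_clamp_itv L0 HL) => // u _.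
by rewrite mulNr oppr_le0 mulr_ge0 ?powR_ge0.
Qed.

End clamp.

Lemma ae_eq_integral_sub (A : set (R4 R)) (G1 G2 : R4 R -> R) :
  measurable (A : set (T4 R)) -> A `<=` U ->
  measurable_fun U (G1 : T4 R -> measurableTypeR R) ->
  measurable_fun U (G2 : T4 R -> measurableTypeR R) ->
  {ae (@mu4 R), forall y, U y -> G1 y = G2 y} ->
  (\int[@mu4 R]_(y in A) (G1 y)%:E = \int[@mu4 R]_(y in A) (G2 y)%:E)%E.
Proof.
move=> mA AU m1 m2 E; apply: (@ae_eq_integral _ _ _ (@mu4 R)) => //.
- by apply/measurable_EFinP; apply: measurable_funS m1.
- by apply/measurable_EFinP; apply: measurable_funS m2.
- by apply: ae4S E => y H /AU /H ->.
Qed.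

Lemma measurable_powR_w al s p :
  measurable_fun U ((fun y => (al + s * w y) `^ p) : T4 R -> measurableTypeR R).
Proof.
apply: (measurableT_comp (measurable_powR p)).
apply: measurable_funD; first exact: measurable_cst.
by apply: measurable_funM => //; exact: measurable_cst.
Qed.

Section bounded.
Variables (m M g p : R).
Hypotheses (mM : m <= M) (g1 : 1 <= g) (p0 : 0 < p).
Hypothesis wmM : {ae (@mu4 R), forall y, U y -> m <= w y <= M}.

Lemma supersolution_sub_power : {ae (@mu4 R), forall x, eball c r x ->
  (((r / 2) ^+ 4 * (g + M - w x) `^ p)%:E <=
    \int[@mu4 R]_(y in U) ((g + M - w y) `^ p)%:E)%E}.
Proof.
have [rho hrho] := exists_mollifiers.
have a0 : m - M <= 0 by rewrite subr_le0.
have wab : {ae (@mu4 R), forall y, U y -> m - M <= w y - M <= 0}.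
  by apply: ae4S wmM => y H /H; lra.
have I0 t : m - M <= t <= 0 -> 0 < g + -1 * t by move: g1; lra.
(* Here [g >= 1] enters: [1 - p <= 1 <= g - t], also for exponents below 1. *)
have I1 t : m - M <= t <= 0 -> -1 * (p - 1) <= g + -1 * t by move: g1 p0; lra.
have s1 : (-1 : R) ^+ 2 = 1 by rewrite sqrrN expr1n.
have mF := measurable_powR_affine g (-1) p.
have clE := clampE wab.
apply: ae4S (ae4I clE (clamp_mean_value a0 (lexx 0) wab hrho s1 p0 I0 I1)) => x [+ +] xr.
have xU := half_eball_sub xr.
have r20 : 0 < r / 2 by rewrite divr_gt0.
have xx : eball x (r / 2) x.
  by rewrite /eball/= enormB /sqd sum4E !subrr expr0n !addr0 sqrtr0.
have mD : measurable (eball x (r / 2) : set (T4 R)) by exact: measurable_eball.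
have E t : - -1 * (g + -1 * (t - M)) `^ p = (g + M - t) `^ p.
  by rewrite opprK mul1r; congr (_ `^ _); ring.
move=> /(_ (xU _ xx)) -> /(_ xr); rewrite E => -[ID HD].
apply: (@le_trans _ _ (\int[@mu4 R]_(y in eball x (r / 2)) ((g + M - w y) `^ p)%:E)%E); last first.
  apply: ge0_subset_integral => //; last by move=> y _; rewrite lee_fin powR_ge0.
  apply/measurable_EFinP; have := measurable_powR_w (g + M) (-1) p.
  by apply: eq_measurable_fun => y _; rewrite mulN1r.
have <- : (\int[@mu4 R]_(y in eball x (r / 2)) (- -1 * (g + -1 * clamp (m - M) 0 M y) `^ p)%:E =
    \int[@mu4 R]_(y in eball x (r / 2)) ((g + M - w y) `^ p)%:E)%E.
  apply: ae_eq_integral_sub => //.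
  - by apply: measurable_funTS; apply: measurableT_comp mF (measurable_clamp _ _ _).
  - have := measurable_powR_w (g + M) (-1) p.
    by apply: eq_measurable_fun => y _; rewrite mulN1r.
  - by apply: ae4S clE => y H Uy; rewrite (H Uy) E.
have {HD} : (((r / 2) ^+ 4 * (g + M - w x) `^ p) <=
    \int[@mu4 R]_(y in eball x (r / 2)) (- -1 * (g + -1 * clamp (m - M) 0 M y) `^ p)).
  apply: le_trans HD; rewrite ler_wpM2r ?powR_ge0//.
  by rewrite -lee_fin fineK ?ge0_fin_numE ?mu4_eball_lty ?mu4_eball_ge.
by rewrite -lee_fin /Rintegral fineK//; exact: integrable_fin_num ID.
Qed.


(** The mollifications are controlled only on balls strictly inside [U]. A bound uniform in the
    radius extends to [U] by monotone convergence. *)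
Lemma integral_eball_exhaust (H : R4 R -> R) (K : \bar R) (s : nat -> R) :
  measurable_fun setT (H : T4 R -> measurableTypeR R) -> (forall y, 0 <= H y) ->
  nondecreasing_seq s -> (forall d, d < 2 * r -> exists n, d < s n) -> (forall n, s n <= 2 * r) ->
  (forall n, \int[@mu4 R]_(y in eball c (s n)) (H y)%:E <= K)%E ->
  (\int[@mu4 R]_(y in U) (H y)%:E <= K)%E.
Proof.
move=> mH H0 ns sd s2 HK.
have -> : U = \bigcup_n eball c (s n).
  apply/seteqP; split => [y /sd[n yn]|y [n _ yn]]; first by exists n.
  exact: lt_le_trans yn (s2 n).
apply: cvge_le (ge0_nondecreasing_set_cvg_integral _ _ _ _).
- exact: nearW.
- by move=> i j /ns ij; apply/subsetPset => y /lt_le_trans; apply.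
- by move=> i; exact: measurable_eball.
- by move=> i; apply/measurable_EFinP; exact: measurable_funTS.
- by move=> i y _; rewrite lee_fin.
Qed.

(* The shift by [p] makes [(g + p + (w - m)) `^ p] superharmonic; it costs the
   factor [(1 + p) `^ p], as [1 <= g + w - m]. *)
Lemma supersolution_harnack : {ae (@mu4 R), forall x, eball c r x ->
  (\int[@mu4 R]_(y in U) ((g + w y - m) `^ p)%:E <=
    (16 * doubling_const R ^+ 2 * r ^+ 4 * ((1 + p) `^ p * (g + w x - m) `^ p))%:E)%E}.
Proof.
have [rho hrho] := exists_mollifiers.
have b0 : 0 <= M - m by rewrite subr_ge0.
have wab : {ae (@mu4 R), forall y, U y -> 0 <= w y - m <= M - m}.
  by apply: ae4S wmM => y H /H; lra.
have I0 t : 0 <= t <= M - m -> 0 < g + p + 1 * t by move: g1 p0; lra.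
have I1 t : 0 <= t <= M - m -> 1 * (p - 1) <= g + p + 1 * t by move: g1 p0; lra.
have s1 : (1 : R) ^+ 2 = 1 by rewrite expr1n.
(* Radii that increase to [2 * r] and start at [31 / 16 * r], above the [29 / 16 * r] that the chain
   of balls requires. They are countably many, so one null set serves all of them. *)
pose s n : R := 2 * r - r / 16 * n.+1%:R^-1.
have n0 n : (0 : R) < n.+1%:R^-1 by rewrite invr_gt0.
have sr n : s n < 2 * r.
  by rewrite /s ltrBlDr ltrDl; apply: mulr_gt0; [exact: divr_gt0|exact: n0].
have rs n : 29 / 16 * r <= s n.
  have : n.+1%:R^-1 <= 1 :> R by rewrite invf_le1// ler1n.
  rewrite /s; move: (n.+1%:R^-1) => e e1.
  have : r / 16 * e <= r / 16 by rewrite ger_pMr// divr_gt0.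
  by move: r0; lra.
have clE := clampE wab.
have har n := clamp_harnack (lexx 0) b0 wab hrho s1 p0 I0 I1 (rs n) (sr n) ler01.
apply: ae4S (ae4I (ae4I clE wab) (ae_foralln har)) => x [[+ +] +] xr.
have Ux : U x by apply: lt_trans xr _; move: r0; lra.
move=> /(_ Ux) cx /(_ Ux) /andP[wx _].
set K := 16 * _ ^+ 2 * _ => har'.
pose H (y : R4 R) := (g + p + 1 * clamp 0 (M - m) m y) `^ p.
have mH : measurable_fun setT (H : T4 R -> measurableTypeR R).
  apply: (measurableT_comp (measurable_powR p)).
  apply: measurable_funD; first exact: measurable_cst.
  by apply: measurable_funM; [exact: measurable_cst|exact: measurable_clamp].
have K0 : 0 <= K by apply: mulr_ge0; [exact: mulr_ge0 (ler0n _ _) (sqr_ge0 _)|exact/exprn_ge0/ltW].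
have HU : (\int[@mu4 R]_(y in U) (H y)%:E <= (K * H x)%:E)%E.
  apply: (@integral_eball_exhaust H _ s) => //.
  - by move=> y; exact: powR_ge0.
  - move=> i j ij; rewrite lerD2l lerN2 ler_wpM2l ?divr_ge0 ?(ltW r0)//.
    by rewrite lef_pV2 ?posrE// ler_nat.
  - move=> d dr; have d0 : 0 < (2 * r - d) / (r / 16) by rewrite !divr_gt0// subr_gt0.
    have [n] := ltr_add_invr d0; rewrite add0r => nd; exists n.
    by rewrite ltrBrDl -ltrBrDr mulrC -ltr_pdivlMr// divr_gt0.
  - by move=> n; exact: ltW.
  - move=> n; have [IF] := har' n xr.
    under eq_Rintegral do rewrite mulN1r -mulN1r.
    have mS : measurable (eball c (s n) : set (T4 R)) by exact: measurable_eball.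
    have IH : (@mu4 R).-integrable (eball c (s n)) (EFin \o H).
      have := integrableZl_fun mS (-1) IF; apply: eq_integrable => // y _.
      by rewrite /= !mulN1r opprK.
    rewrite RintegralZl// mulN1r mulNr mul1r mulrN lerN2.
    rewrite mul1r -lee_fin /Rintegral fineK; last exact: integrable_fin_num IH.
    by rewrite {2}/H mul1r.
apply: (@le_trans _ _ (\int[@mu4 R]_(y in U) (H y)%:E)%E).
  pose G y := (g + 1 * clamp 0 (M - m) m y) `^ p.
  have mG : measurable_fun setT (G : T4 R -> measurableTypeR R).
    apply: (measurableT_comp (measurable_powR p)).
    apply: measurable_funD; first exact: measurable_cst.
    by apply: measurable_funM; [exact: measurable_cst|exact: measurable_clamp].
  have -> : (\int[@mu4 R]_(y in U) ((g + w y - m) `^ p)%:E = \int[@mu4 R]_(y in U) (G y)%:E)%E.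
    apply: ae_eq_integral_sub => //.
    - have := measurable_powR_w (g - m) 1 p.
      by apply: eq_measurable_fun => y _; rewrite mul1r addrAC.
    - exact: measurable_funTS.
    - by apply: ae4S clE => y Hy /Hy cy; rewrite /G cy mul1r addrA.
  apply: ge0_le_integral => //.
  - by move=> y _; rewrite lee_fin powR_ge0.
  - by apply/measurable_EFinP; exact: measurable_funTS.
  - by apply/measurable_EFinP; exact: measurable_funTS.
  - move=> y _; rewrite lee_fin; have := clamp_itv m (lexx 0) b0 y.
    rewrite in_itv/= => /andP[+ _]; rewrite /G /H; move: (clamp _ _ _ _) => t t0.
    by apply: ge0_ler_powR; rewrite ?nnegrE; move: g1 p0 t0; lra.
apply: le_trans HU _; rewrite lee_fin; apply: ler_wpM2l => //.
rewrite -powRM; last 2 first.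
- by move: p0; lra.
- by move: g1 wx; lra.
rewrite /H cx; apply: ge0_ler_powR; rewrite ?nnegrE; move: g1 p0 wx; first by lra.
- by lra.
- by move=> *; rewrite mulr_ge0//; lra.
- by nra.
Qed.

End bounded.

End supersolution.

(** * Lower bound and exponential estimate *)

Section lower_bound.
Variables (R : realType) (c : R4 R) (r : R).
Hypothesis r0 : 0 < r.
Local Notation U := (eball c (2 * r)).
Variables (w : R4 R -> R) (Dw : R4 R -> 'rV[R]_4) (D2w : R4 R -> 'M[R]_4).
Hypothesis hW : W22 U w Dw D2w.
Hypothesis super : {ae (@mu4 R), forall y, U y ->
  \sum_i D2w y i i + \sum_i (Dw y 0 i) ^+ 2 <= 0}.
Implicit Types (x y : R4 R).

Let mU : measurable (U : set (T4 R)). Proof. exact: measurable_eball. Qed.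
Let Uoo : (mu4 (U : set (T4 R)) < +oo)%E. Proof. exact: mu4_eball_lty. Qed.

Let mw : measurable_fun U (w : T4 R -> measurableTypeR R).
Proof. by have [[]] := hW. Qed.

Let Iw : (@mu4 R).-integrable U (EFin \o w).
Proof.
apply: integrable_sqr_integrable => //.
by apply: in_Lp2_integrable_sqr => //; have [] := hW.
Qed.

Let mu_half x : (r / 2) ^+ 4 <= fine (mu4 (eball x (r / 2) : set (T4 R))).
Proof.
have r20 : 0 < r / 2 by rewrite divr_gt0.
by rewrite -lee_fin fineK ?ge0_fin_numE ?mu4_eball_lty ?mu4_eball_ge.
Qed.

Lemma supersolution_bounded_below :
  exists b : R, {ae (@mu4 R), forall x, eball c r x -> b <= w x}.
Proof.
pose N := \int[@mu4 R]_(y in U) `|w y|.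
have N0 : 0 <= N by exact: Rintegral_ge0.
exists (- N / (r / 2) ^+ 4); apply: ae4S (supersolution_mean_value r0 hW super) => x H xr.
have xU := half_eball_sub r0 xr.
have q0 : 0 < (r / 2) ^+ 4 by rewrite exprn_gt0// divr_gt0.
have mD : measurable (eball x (r / 2) : set (T4 R)) by exact: measurable_eball.
have ID : (@mu4 R).-integrable (eball x (r / 2)) (EFin \o w) by exact: integrableS Iw.
have ND : - N <= \int[@mu4 R]_(y in eball x (r / 2)) w y.
  rewrite lerNl; apply: le_trans (ler_norm _) _; rewrite normrN.
  apply: le_trans (le_normr_Rintegral mD ID) _.
  by apply: Rintegral_subset => //; exact: integrable_norm.
(* The measure of the ball may be replaced by its lower bound [(r / 2) ^ 4] where [w x] is negative;
   where [w x >= 0] the claim is immediate. *)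
rewrite ler_pdivrMr// mulrC; have [wx|wx] := leP 0 (w x).
  by rewrite (le_trans (y := 0)) ?oppr_le0// mulr_ge0// ltW.
apply: le_trans ND _; apply: le_trans (H xr) _.
by rewrite ler_wnM2r// ltW.
Qed.

(** The tangent to [expR (- p * t)] at [t = w x], rather than at the mean of [w], lies below the
    graph. By the mean value inequality the integral of [w x - w y] over the small ball is
    nonnegative, so only the constant term remains. The right-hand side may be infinite. *)
Lemma supersolution_exp p : 0 < p -> {ae (@mu4 R), forall x, eball c r x ->
  (((r / 2) ^+ 4 * expR (- p * w x))%:E <= \int[@mu4 R]_(y in U) (expR (- p * w y))%:E)%E}.
Proof.
move=> p0; apply: ae4S (supersolution_mean_value r0 hW super) => x H xr.
have xU := half_eball_sub r0 xr.
set D := eball x (r / 2) in H xU *.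
have mD : measurable (D : set (T4 R)) by exact: measurable_eball.
have ID : (@mu4 R).-integrable D (EFin \o w) by exact: integrableS Iw.
have mE : measurable_fun U (EFin \o (fun y => expR (- p * w y)) : T4 R -> \bar R).
  apply/measurable_EFinP; apply: measurableT_comp => //.
  by apply: measurable_funM => //; exact: measurable_cst.
apply: (@le_trans _ _ (\int[@mu4 R]_(y in D) (expR (- p * w y))%:E)%E); last first.
  by apply: ge0_subset_integral => // y _; rewrite lee_fin expR_ge0.
have [->|Efin] := eqVneq (\int[@mu4 R]_(y in D) (expR (- p * w y))%:E)%E +oo%E.
  by rewrite leey.
have IE : (@mu4 R).-integrable D (EFin \o (fun y => expR (- p * w y))).
  apply/integrableP; split; first exact: measurable_funS mE.
  by under eq_integral => y _ do rewrite /= (ger0_norm (expR_ge0 _)); rewrite ltey.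
pose e := expR (- p * w x); have e0 : 0 < e by exact: expR_gt0.
pose T y := e * (1 + p * w x) + - (e * p) * w y.
have cst (t : R) : (@mu4 R).-integrable D (EFin \o (fun _ : R4 R => t)).
  apply: integrable_eball; exact: continuous_cst_fun.
have IT : (@mu4 R).-integrable D (EFin \o T).
  by apply: integrableD_fun => //; exact: integrableZl_fun.
have TE y : D y -> T y <= expR (- p * w y).
  move=> _; rewrite (_ : - p * w y = - p * w x + p * (w x - w y)); last by ring.
  rewrite expRD (_ : T y = e * (1 + p * (w x - w y))); last by rewrite /T; ring.
  by rewrite ler_pM2l// expR_ge1Dx.
have := le_Rintegral mD IT IE TE; rewrite {1}/T RintegralD//; last exact: integrableZl_fun.
rewrite Rintegral_cst// RintegralZl// => HT.
rewrite -(fineK (integrable_fin_num mD IE)) lee_fin; apply: le_trans HT.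
have {}H := H xr; set mm := fine _ in H *.
apply: (@le_trans _ _ (e * mm)).
  by rewrite mulrC ler_wpM2l ?(ltW e0)//; exact: mu_half.
rewrite (_ : _ + _ = e * mm + e * p * (mm * w x - \int[@mu4 R]_(y in D) w y)); last by ring.
by rewrite lerDl mulr_ge0 ?mulr_ge0 ?subr_ge0// ltW.
Qed.

Lemma ae_exists (Q : R4 R -> Prop) :
  {ae (@mu4 R), forall x, eball c r x -> Q x} -> exists2 x, eball c r x & Q x.
Proof.
move=> [N [mN N0 HN]]; apply: contrapT => nex.
have : (mu4 (eball c r : set (T4 R)) <= mu4 (N : set (T4 R)))%E.
  apply: le_measure; rewrite ?inE//; first exact: measurable_eball.
  by move=> x xr; apply: HN => /= /(_ xr) Qx; apply: nex; exists x.
rewrite N0 => /(le_trans (mu4_eball_ge c r0)); rewrite lee_fin leNgt.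
by rewrite exprn_gt0.
Qed.

End lower_bound.

(** * Normalised power means and the final constants *)

Section power_arith.
Variable R : realType.
Implicit Types (r p a e q : R).

Lemma powRVK p a : 0 < p -> 0 <= a -> (a `^ p) `^ p^-1 = a.
Proof. by move=> p0 a0; rewrite -powRrM mulfV ?gt_eqF// powRr1. Qed.

(** The factor [16 = 2 ^ 4] compares the ball of radius [r / 2], on which the mean value inequality
    is used, with the normalisation by [r ^ 4]. *)
Lemma quarter_power_le r p a e : 0 < r -> 0 < p -> 0 <= a ->
  (r / 2) ^+ 4 * a `^ p <= r ^+ 4 * e -> a <= 16 `^ p^-1 * e `^ p^-1.
Proof.
move=> r0 p0 a0 H; have r40 : 0 < r ^+ 4 by rewrite exprn_gt0.
have ae : a `^ p <= 16 * e.
  rewrite -(ler_pM2l r40) mulrCA [r ^+ 4 * _](_ : _ = 16 * ((r / 2) ^+ 4 * a `^ p)); last by field.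
  by rewrite ler_pM2l.
have e0 : 0 <= e by rewrite -(pmulr_rge0 _ (ltr0n R 16)) (le_trans _ ae)// powR_ge0.
rewrite -powRM// -{1}(powRVK p0 a0); apply: ge0_ler_powR => //.
- by rewrite invr_ge0 ltW.
- by rewrite nnegrE powR_ge0.
- by rewrite nnegrE mulr_ge0.
Qed.

End power_arith.

Theorem proposition3 (R : realType) (p beta : R) (hp : 1 < p)
    (hbeta : 0 < beta) :
  exists (C : R -> R) (Cstar : R),
    [/\ forall K, 0 < C K,
        0 < Cstar &
        forall (c : R4 R) (r : R) (f w : R4 R -> R),
          let B := eball c r in
          let B2 := eball c (2 * r) in
          let normf := fine (Lp_norm B2 p f) in
          0 < r ->
          (forall x, B2 x -> 0 <= f x) ->
          in_Lp B2 p f ->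
          admissible_supersolution B2 f w ->
          [/\ exists b : R, {ae (@leb4 R), forall x, B x -> b <= w x},
              ((C (r `^ (4 * (1 - p^-1)) * normf))%:E *
                 (((r ^- 4)%:E *
                   \int[@leb4 R]_(x in B2) (expR (- beta * w x))%:E)
                  `^ beta^-1)^-1
               <= ess_inf_on B (fun x => expR (w x)))%E &
              forall m M : R,
                {ae (@leb4 R), forall x, B2 x -> m <= w x <= M} ->
                let gamma :=
                  Num.max 1 (r `^ (4 / 3 * (1 - p^-1)) * normf `^ 3^-1) in
                (ess_sup_on B (fun x => (gamma + M - w x)%R) <=
                 Cstar%:E *
                   ((r ^- 4)%:E *
                    \int[@leb4 R]_(x in B2) ((gamma + M - w x) `^ beta)%:E)
                   `^ beta^-1)%E /\
                (((r ^- 4)%:E *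
                  \int[@leb4 R]_(x in B2) ((gamma + w x - m) `^ beta)%:E)
                 `^ beta^-1 <=
                 Cstar%:E * ess_inf_on B (fun x => (gamma + w x - m)%R))%E]].
Proof.
pose D2 := 16 * doubling_const R ^+ 2.
have D20 : 0 <= D2 by exact: mulr_ge0 (ler0n _ _) (sqr_ge0 _).
pose a16 : R := 16 `^ beta^-1.
have a160 : 0 < a16 by exact: powR_gt0.
pose aD : R := D2 `^ beta^-1 * (1 + beta).
have aD0 : 0 <= aD by rewrite mulr_ge0 ?powR_ge0// addr_ge0// ltW.
have ib0 : 0 < beta^-1 by rewrite invr_gt0.
(* [a16] comes from halving the radius in the mean value inequality. In [aD], the factor [D2] is the
   constant of the ball chain divided by [r ^ 4], and [1 + beta] is the price of the shift in
   [supersolution_harnack]. The sum serves both bounds with [gamma]. *)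
exists (fun=> a16^-1), (a16 + aD); split.
- by move=> _; rewrite invr_gt0.
- by rewrite ltr_wpDr.
move=> c r f w B B2 normf r0 _ _ [Dw [D2w [hW adm]]].
have super : {ae (@mu4 R), forall y, B2 y -> \sum_i D2w y i i + \sum_i (Dw y 0 i) ^+ 2 <= 0}.
  by apply: ae4S adm => y H /H [/Gamma2_super].
have r40 : 0 < r ^+ 4 by rewrite exprn_gt0.
have BB2 : B `<=` B2 by move=> x; rewrite /B /B2 /eball/=; move: r0; lra.
pose avg (u : R4 R -> R) : \bar R := ((r ^- 4)%:E * \int[@mu4 R]_(x in B2) (u x)%:E)%E.
have avgE (u : R4 R -> R) : (forall x, 0 <= u x) -> avg u = +oo%E \/
    exists e : R, [/\ 0 <= e, avg u = e%:E &
      (\int[@mu4 R]_(x in B2) (u x)%:E = (r ^+ 4 * e)%:E)%E].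
  move=> u0; have : (0 <= \int[@mu4 R]_(x in B2) (u x)%:E)%E.
    by apply: integral_ge0 => x _; rewrite lee_fin.
  rewrite /avg; case: (\int[@mu4 R]_(x in B2) (u x)%:E)%E => [e| |]//.
  - move=> e0; right; exists (r ^- 4 * e); split => //.
      by rewrite mulr_ge0// invr_ge0 ltW.
    by rewrite mulrA divff ?mul1r// gt_eqF.
  - by move=> _; left; rewrite gt0_muley// lte_fin invr_gt0.
have [b Hb] := supersolution_bounded_below r0 hW super.
split; first by exists b.
- rewrite -/(avg (fun x => expR (- beta * w x))).
  apply: ereal_sup_ubound => /=.
  have := avgE (fun x => expR (- beta * w x)) (fun x => expR_ge0 _) => -[->|[e [_ -> Ie]]].
    (* If the average is infinite, the inverse of its power is 0 and the bound reads
       [0 <= expR (w x)]. *)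
    rewrite poweRyr ?gt_eqF// invey mule0.
    by apply: aeW => x _; rewrite lee_fin expR_ge0.
  apply: ae4S (supersolution_exp r0 hW super hbeta) => x H xB; have {H} := H xB.
  rewrite Ie lee_fin (_ : - beta * w x = - w x * beta); last by ring.
  rewrite expRM => /(quarter_power_le r0 hbeta (expR_ge0 _)) H.
  have e0 : 0 < e `^ beta^-1.
    by rewrite -(pmulr_rgt0 _ a160) (lt_le_trans _ H)// expR_gt0.
  rewrite poweR_EFin inver gt_eqF// -EFinM lee_fin -invfM.
  by rewrite -[leRHS]invrK -expRN lef_pV2 ?posrE ?mulr_gt0 ?expR_gt0.
- move=> m M wmM gamma.
  have g1 : 1 <= gamma by rewrite le_max lexx.
  (* The inequality [m <= M] is read off at a point, which exists because [B] has positive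
     measure. *)
  have [x0 x0B /andP[mx0 x0M]] : exists2 x, B x & m <= w x <= M.
    by apply: (ae_exists r0); apply: ae4S wmM => x H /BB2.
  have mM := le_trans mx0 x0M.
  have up := supersolution_sub_power r0 hW super mM g1 hbeta wmM.
  have dn := supersolution_harnack r0 hW super mM g1 hbeta wmM.
  split.
  + rewrite -/(avg (fun x => (gamma + M - w x) `^ beta)).
    apply: ereal_inf_lbound => /=.
    have := avgE (fun x => (gamma + M - w x) `^ beta) (fun x => powR_ge0 _ _) => -[->|[e [_ -> Ie]]].
      rewrite poweRyr ?gt_eqF// gt0_muley ?lte_fin ?ltr_wpDr//.
      by apply: aeW => x _; rewrite leey.
    apply: ae4S (ae4I up wmM) => x [H wx] xB; have {H} := H xB.
    have /andP[_ wM] := wx (BB2 _ xB).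
    have u0 : 0 <= gamma + M - w x by move: g1 wM; lra.
    rewrite Ie lee_fin => /(quarter_power_le r0 hbeta u0) H.
    rewrite poweR_EFin -EFinM lee_fin (le_trans H)// ler_wpM2r ?powR_ge0//.
    by rewrite lerDl.
  + pose v x := (gamma + w x - m) `^ beta; rewrite -/(avg v).
    have up' : {ae (@mu4 R), forall x, B x ->
        (avg v `^ beta^-1 <=
         ((a16 + aD) * (gamma + w x - m))%:E)%E}.
      apply: ae4S (ae4I dn wmM) => x [H wx] xB; have {H} := H xB.
      have /andP[wm _] := wx (BB2 _ xB).
      have v0 : 0 <= gamma + w x - m by move: g1 wm; lra.
      have := avgE v (fun x => powR_ge0 _ _).
      rewrite /avg => -[avy|[e [e0 -> ->]]].
        have i0 : (0 <= (r ^- 4)%:E)%E by rewrite lee_fin invr_ge0 ltW.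
        by move=> /(lee_wpmul2l i0); rewrite avy -EFinM leye_eq.
      rewrite -/D2 lee_fin -powRM//; last by rewrite addr_ge0// ltW.
      rewrite (mulrC D2) -[_ * D2 * _]mulrA ler_pM2l// => H.
      have b0 : 0 <= (1 + beta) * (gamma + w x - m) by rewrite mulr_ge0// addr_ge0// ltW.
      rewrite poweR_EFin lee_fin; apply: (@le_trans _ _ (aD * (gamma + w x - m))); last first.
        by rewrite ler_wpM2r// lerDr ltW.
      rewrite /aD -mulrA -(powRVK hbeta b0) -powRM ?powR_ge0//.
      by apply: ge0_ler_powR; rewrite ?nnegrE ?(ltW ib0)// mulr_ge0 ?powR_ge0.
    have cs0 : 0 < a16 + aD by rewrite ltr_wpDr.
    (* At a single point the right-hand side of [up'] is finite, which rules out an infinite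
       average. *)
    have [x1 _] := ae_exists r0 up'.
    case: (avg _ `^ _)%E (poweR_ge0 (avg v) beta^-1) up' => // q _ up' _.
    rewrite (_ : q%:E = (a16 + aD)%:E * ((a16 + aD)^-1 * q)%:E)%E; last first.
      by rewrite -EFinM mulrA mulfV ?mul1r// gt_eqF.
    apply: lee_wpmul2l; first by rewrite lee_fin ltW.
    apply: ereal_sup_ubound => /=; apply: ae4S up' => x H xB.
    by rewrite lee_fin mulrC ler_pdivrMr// mulrC; have := H xB; rewrite lee_fin.
Qed.
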